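(* (Large batch.) Let $F=f_K\circ f_{K-1}\circ\cdots\circ f_1$ be a $K$-level compositional objective on the closed convex set $\mathcal X\subset\mathbb R^d$, suppose Assumptions (A1)-(A5) of the context hold, and suppose $F$ is convex, i.e. $F(y)\ge F(x)+\langle\nabla F(x),y-x\rangle$ for all $x,y\in\mathcal X$. Denote $S=\mathcal O(\log(\epsilon_1/\epsilon))$ and $\epsilon_s=\epsilon_1/2^s$, where $\epsilon_1$ is a positive constant. By setting (in stage $s$) $B_1=\mathcal O(\epsilon_s^{-1})$, $\eta_s=\mathcal O(\epsilon_s)$, $\alpha_s=\mathcal O(\epsilon_s)$ and $T_s=\mathcal O(\epsilon_s^{-1})$, the Stage-wise PMVR algorithm run for $S$ stages ensures that $$\mathbb E[F(x^{(S)})]-\min_{\hat x\in\mathcal X}F(\hat x)\le\epsilon$$ in $\mathcal O(\epsilon^{-1})$ iterations, where $x^{(S)}$ is its output.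
   Context: Problem: minimise $F(x)=f_K\circ\cdots\circ f_1(x)$ over $x\in\mathcal X$. Each $f_i$ and its gradient (Jacobian) $\nabla f_i$ are accessed only through noisy estimates $f_i(\cdot;\xi)$ and $\nabla f_i(\cdot;\xi)$, where $\xi$ is a sample drawn from the oracle. Jacobians are arranged so that the chain rule reads $\nabla F(x)=\prod_{i=1}^K\nabla f_i(y^{i-1})$ with $y^0=x$, $y^i=f_i(y^{i-1})$, products being taken in increasing order of $i$ from left to right. Assumptions. (A1) $\mathcal X$ is closed and convex with $\max_{x,y\in\mathcal X}\|x-y\|\le D$. (A2) All $f_1,\dots,f_K$ are $L_f$-Lipschitz continuous and their Jacobians $\nabla f_1,\dots,\nabla f_K$ are $L_J$-Lipschitz continuous. (A3) For $1\le i\le K$: $\mathbb E[f_i(x;\xi_t^i)]=f_i(x)$, $\mathbb E[\nabla f_i(x;\xi_t^i)]=\nabla f_i(x)$, $\mathbb E\|f_i(x;\xi_t^i)-f_i(x)\|^2\le\sigma^2$, $\mathbb E\|\nabla f_i(x;\xi_t^i)-\nabla f_i(x)\|^2\le\sigma_J^2$, where $\{\xi_t^i\}_{i=1}^K$ are mutually independent. (A4) For $1\le i\le K$: $\mathbb E\|f_i(x;\xi_t^i)-f_i(y;\xi_t^i)\|^2\le\mathcal L_f^2\|x-y\|^2$ and $\mathbb E\|\nabla f_i(x;\xi_t^i)-\nabla f_i(y;\xi_t^i)\|^2\le\mathcal L_J^2\|x-y\|^2$. (A5) The initial solution $x^{(0)}$ satisfies $F(x^{(0)})-F_\star\le\Delta_F$,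 where $F_\star=\min_{x\in\mathcal X}F(x)$. PMVR routine (parameters $T,\eta,\alpha$, batch size $B_1$, initial points $(x_1,u_1,v_1)$ with $u_1=(u_1^1,\dots,u_1^K)$). At each time step $t=1,\dots,T$ set $u_t^0=x_t$; for $t=1$ the initial $u_1,v_1$ are used, and for later $t$, for each level $i=1,\dots,K$, draw a batch of samples $\xi_t^{i,1},\dots,\xi_t^{i,B_1}$ and compute $$u_t^i=(1-\alpha)u_{t-1}^i+\frac1{B_1}\sum_{j=1}^{B_1}f_i(u_t^{i-1};\xi_t^{i,j})-(1-\alpha)\frac1{B_1}\sum_{j=1}^{B_1}f_i(u_{t-1}^{i-1};\xi_t^{i,j}),$$ then $$v_t=(1-\alpha)v_{t-1}+\frac1{B_1}\sum_{j=1}^{B_1}\prod_{i=1}^K\nabla f_i(u_t^{i-1};\xi_t^{i,j})-(1-\alpha)\frac1{B_1}\sum_{j=1}^{B_1}\prod_{i=1}^K\nabla f_i(u_{t-1}^{i-1};\xi_t^{i,j}).$$ Compute $z_t=\arg\min_{x\in\mathcal X}\langle x,v_t\rangle$ and update $x_{t+1}=x_t+\eta(z_t-x_t)$. Choose $\tau$ uniformly at random from $\{1,\dots,T\}$ and return $(x_\tau,u_\tau,v_\tau)$. Stage-wise PMVR. Input: initial points $(x^{(0)},u^{(0)},v^{(0)})$, where with $u^{(0),0}=x^{(0)}$ the estimators are initialised as $u^{(0),i}=\frac1{B_0}\sum_{j=1}^{B_0}f_i(u^{(0),i-1};\xi^{i,j})$ and $v^{(0)}=\frac1{B_0}\sum_{j=1}^{B_0}\prod_{i=1}^K\nabla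 f_i(u^{(0),i-1};\xi^{i,j})$, $B_0$ being the batch size for the first iteration. For $s=1,\dots,S$, let $(x^{(s)},u^{(s)},v^{(s)})$ be the output of the PMVR routine with parameters $T_s,\eta_s,\alpha_s$ and initial points $(x^{(s-1)},u^{(s-1)},v^{(s-1)})$. Return $x^{(S)}$. $\mathcal O(\cdot)$ is the usual order notation in the displayed quantities. *)

(* Defs.v *)
From HB Require Import structures.
From mathcomp Require Import all_boot all_order all_algebra.
From mathcomp Require Import all_classical all_reals all_analysis.
Set Implicit Arguments.
Unset Strict Implicit.
Unset Printing Implicit Defensive.
Import Order.TTheory GRing.Theory Num.Theory.
Import numFieldNormedType.Exports.
Local Open Scope classical_set_scope.
Local Open Scope ring_scope.

(* Vectors are rows and 'J f x acts on them by v |-> v *m 'J f x, so that the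
   chain rule multiplies Jacobians in increasing order of the level, from left
   to right.
   Levels are counted from 0: the function f_(i+1) of f_K o ... o f_1 is f i,
   from R^(d i).+1 to R^(d i.+1).+1, and the values of f i for i >= K are
   irrelevant.  The objective is scalar when d K = 0. *)

(* Euclidean norm of a vector, Frobenius norm of a matrix; the norm that the
   library puts on matrices is the max norm. *)
Definition norm2 (R : realType) (m n : nat) (A : 'M[R]_(m, n)) : R :=
  Num.sqrt (\sum_i \sum_j A i j ^+ 2).

Definition lipschitz2 (R : realType) (m n p q : nat) (L : R)
    (g : 'M[R]_(m, n) -> 'M[R]_(p, q)) : Prop :=
  forall x y, norm2 (g x - g y) <= L * norm2 (x - y).

Definition borel_mx (R : realType) (m n : nat) :=
  g_sigma_algebraType (@open 'M[R]_(m, n)).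

Fixpoint compose (R : realType) (d : nat -> nat)
    (f : forall i, 'rV[R]_(d i).+1 -> 'rV[R]_(d i.+1).+1) (k : nat)
    (x : 'rV[R]_(d 0%N).+1) : 'rV[R]_(d k).+1 :=
  if k is k'.+1 then f k' (compose f k' x) else x.

Definition objective (R : realType) (d : nat -> nat)
    (f : forall i, 'rV[R]_(d i).+1 -> 'rV[R]_(d i.+1).+1) (K : nat)
    (x : 'rV[R]_(d 0%N).+1) : R :=
  compose f K x ord0 ord0.

Fixpoint jprod (R : realType) (d : nat -> nat)
    (A : forall i, 'M[R]_((d i).+1, (d i.+1).+1)) (k : nat) :
    'M[R]_((d 0%N).+1, (d k).+1) :=
  if k is k'.+1 then jprod A k' *m A k' else 1%:M.

Definition inner (R : realType) (m n : nat)
    (x : 'rV[R]_m) (v : 'M[R]_(m, n.+1)) : R := (x *m v) ord0 ord0.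

(* the gradient of the objective is the unique column of the Jacobian *)
Definition convex_objective (R : realType) (d : nat -> nat)
    (f : forall i, 'rV[R]_(d i).+1 -> 'rV[R]_(d i.+1).+1) (K : nat)
    (X : set 'rV[R]_(d 0%N).+1) : Prop :=
  forall x y, X x -> X y ->
    objective f K x + inner (y - x) ('J (compose f K) x) <= objective f K y.

Definition is_min_on (R : realType) (V : Type) (X : set V) (F : V -> R)
    (c : R) : Prop :=
  (exists2 x, X x & F x = c) /\ (forall x, X x -> c <= F x).

Definition feasible_set (R : realType) (n : nat) (D : R)
    (X : set 'rV[R]_n.+1) : Prop :=
  [/\ closed X, convex_set X & forall x y, X x -> X y -> norm2 (x - y) <= D].

Definition smooth_levels (R : realType) (d : nat -> nat) (K : nat)
    (Lf LJ : R) (f : forall i, 'rV[R]_(d i).+1 -> 'rV[R]_(d i.+1).+1) : Prop :=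
  forall i, (i < K)%N ->
    [/\ lipschitz2 Lf (f i),
        forall x, differentiable (f i) x &
        lipschitz2 LJ (fun x => 'J (f i) x)].

Definition measurable_oracle (R : realType) (dX : measure_display)
    (Xi : measurableType dX) (m n p q : nat)
    (g : 'M[R]_(m, n) -> Xi -> 'M[R]_(p, q)) : Prop :=
  measurable_fun [set: (borel_mx R m n * Xi)%type]
    (fun w => g w.1 w.2 : borel_mx R p q).

Definition unbiased (R : realType) (dX : measure_display)
    (Xi : measurableType dX) (Q : probability Xi R) (m n p q : nat) (s : R)
    (g : 'M[R]_(m, n) -> Xi -> 'M[R]_(p, q))
    (h : 'M[R]_(m, n) -> 'M[R]_(p, q)) : Prop :=
  forall x,
    (forall a b, ('E_Q[fun z => g x z a b])%E = (h x a b)%:E) /\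
    ('E_Q[fun z => (norm2 (g x z - h x) ^+ 2)%R] <= (s ^+ 2)%:E)%E.

Definition mean_square_lipschitz (R : realType) (dX : measure_display)
    (Xi : measurableType dX) (Q : probability Xi R) (m n p q : nat) (L : R)
    (g : 'M[R]_(m, n) -> Xi -> 'M[R]_(p, q)) : Prop :=
  forall x y,
    ('E_Q[fun z => (norm2 (g x z - g y z) ^+ 2)%R]
       <= (L ^+ 2 * norm2 (x - y) ^+ 2)%:E)%E.

Definition mutually_independent (dO : measure_display)
    (Omega : measurableType dO) (R : realType) (P : probability Omega R)
    (I : eqType) (G : I -> set (set Omega)) : Prop :=
  forall (J : seq I) (E : I -> set Omega),
    uniq J -> (forall i, i \in J -> G i (E i)) ->
    P (\bigcap_(i in [set` J]) E i) = (\prod_(i <- J) P (E i))%E.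

Definition sigma_of (dO dX : measure_display) (Omega : measurableType dO)
    (Xi : measurableType dX) (Y : Omega -> Xi) : set (set Omega) :=
  preimage_set_system setT Y measurable.

(* Everything random in one run: xi0 i j is the j-th sample of level i used by
   the initialisation, xi s t i j the j-th sample of level i drawn at time t of
   stage s, tau s the random output index of stage s.  The same sample feeds
   the function oracle and the Jacobian oracle of its level. *)
Definition independent_draws (dO dX : measure_display)
    (Omega : measurableType dO) (Xi : measurableType dX) (R : realType)
    (P : probability Omega R)
    (xi0 : nat -> nat -> {RV P >-> Xi})
    (xi : nat -> nat -> nat -> nat -> {RV P >-> Xi})
    (tau : nat -> {RV P >-> nat}) : Prop :=
  mutually_independent P
    (fun k : (nat * nat + nat * nat * nat * nat + nat)%type =>
       match k with
       | inl (inl (i, j)) => sigma_of (xi0 i j)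
       | inl (inr (s, t, i, j)) => sigma_of (xi s t i j)
       | inr s => sigma_of (tau s)
       end).

Definition sampled_from (dO dX : measure_display)
    (Omega : measurableType dO) (Xi : measurableType dX) (R : realType)
    (P : probability Omega R) (Y : {RV P >-> Xi}) (Q : probability Xi R) :
    Prop :=
  forall A, measurable A -> distribution P Y A = Q A.

Definition uniform_index (dO : measure_display)
    (Omega : measurableType dO) (R : realType) (P : probability Omega R)
    (Y : {RV P >-> nat}) (T : nat) : Prop :=
  forall t, (1 <= t <= T)%N -> distribution P Y [set t] = (T%:R^-1)%:E.

Definition linear_minimizer (R : realType) (m n : nat) (X : set 'rV[R]_m)
    (lmo : 'M[R]_(m, n.+1) -> 'rV[R]_m) : Prop :=
  forall v, X (lmo v) /\ (forall x, X x -> inner (lmo v) v <= inner x v).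

Definition batch_mean (R : realType) (V : lmodType R) (B : nat)
    (g : nat -> V) : V := B%:R^-1 *: \sum_(j < B) g j.

(* (u_t^0, u_t^1, ..., v_t) at a time t, where u_t^0 = x_t is the iterate *)
Record state (R : realType) (d : nat -> nat) (K : nat) := State {
  est : forall i, 'rV[R]_(d i).+1 ;
  grad : 'M[R]_((d 0%N).+1, (d K).+1) }.

Fixpoint update_est (R : realType) (Xi : Type) (d : nat -> nat)
    (fo : forall i, 'rV[R]_(d i).+1 -> Xi -> 'rV[R]_(d i.+1).+1)
    (B : nat) (alpha : R) (uprev : forall i, 'rV[R]_(d i).+1)
    (x : 'rV[R]_(d 0%N).+1) (z : nat -> nat -> Xi) (i : nat) :
    'rV[R]_(d i).+1 :=
  if i is k.+1 then
    (1 - alpha) *: uprev k.+1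
    + batch_mean B (fun j => fo k (update_est fo B alpha uprev x z k) (z k j))
    - (1 - alpha) *: batch_mean B (fun j => fo k (uprev k) (z k j))
  else x.

(* from time t-1 to time t, z being the samples drawn at time t *)
Definition pmvr_step (R : realType) (Xi : Type) (d : nat -> nat) (K : nat)
    (fo : forall i, 'rV[R]_(d i).+1 -> Xi -> 'rV[R]_(d i.+1).+1)
    (Jo : forall i, 'rV[R]_(d i).+1 -> Xi -> 'M[R]_((d i).+1, (d i.+1).+1))
    (lmo : 'M[R]_((d 0%N).+1, (d K).+1) -> 'rV[R]_(d 0%N).+1)
    (B : nat) (eta alpha : R) (z : nat -> nat -> Xi) (st : state R d K) :
    state R d K :=
  let x := est st 0%N + eta *: (lmo (grad st) - est st 0%N) in
  let u := update_est fo B alpha (est st) x z in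
  State u
    ((1 - alpha) *: grad st
     + batch_mean B (fun j => jprod (fun i => Jo i (u i) (z i j)) K)
     - (1 - alpha) *:
         batch_mean B (fun j => jprod (fun i => Jo i (est st i) (z i j)) K)).

(* the state at time t = n.+1, starting from the state st at time 1 *)
Fixpoint pmvr (R : realType) (Xi : Type) (d : nat -> nat) (K : nat)
    (fo : forall i, 'rV[R]_(d i).+1 -> Xi -> 'rV[R]_(d i.+1).+1)
    (Jo : forall i, 'rV[R]_(d i).+1 -> Xi -> 'M[R]_((d i).+1, (d i.+1).+1))
    (lmo : 'M[R]_((d 0%N).+1, (d K).+1) -> 'rV[R]_(d 0%N).+1)
    (B : nat) (eta alpha : R) (z : nat -> nat -> nat -> Xi)
    (st : state R d K) (n : nat) : state R d K :=
  if n is m.+1 then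
    pmvr_step fo Jo lmo B eta alpha (z n.+1) (pmvr fo Jo lmo B eta alpha z st m)
  else st.

Fixpoint init_est (R : realType) (Xi : Type) (d : nat -> nat)
    (fo : forall i, 'rV[R]_(d i).+1 -> Xi -> 'rV[R]_(d i.+1).+1)
    (B0 : nat) (x0 : 'rV[R]_(d 0%N).+1) (z : nat -> nat -> Xi) (i : nat) :
    'rV[R]_(d i).+1 :=
  if i is k.+1 then batch_mean B0 (fun j => fo k (init_est fo B0 x0 z k) (z k j))
  else x0.

Definition init_state (R : realType) (Xi : Type) (d : nat -> nat) (K : nat)
    (fo : forall i, 'rV[R]_(d i).+1 -> Xi -> 'rV[R]_(d i.+1).+1)
    (Jo : forall i, 'rV[R]_(d i).+1 -> Xi -> 'M[R]_((d i).+1, (d i.+1).+1))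
    (B0 : nat) (x0 : 'rV[R]_(d 0%N).+1) (z : nat -> nat -> Xi) :
    state R d K :=
  let u := init_est fo B0 x0 z in
  State u (batch_mean B0 (fun j => jprod (fun i => Jo i (u i) (z i j)) K)).

(* the state after s stages; stage s uses the parameters of index s *)
Fixpoint stagewise_pmvr (R : realType) (Xi : Type) (d : nat -> nat) (K : nat)
    (fo : forall i, 'rV[R]_(d i).+1 -> Xi -> 'rV[R]_(d i.+1).+1)
    (Jo : forall i, 'rV[R]_(d i).+1 -> Xi -> 'M[R]_((d i).+1, (d i.+1).+1))
    (lmo : 'M[R]_((d 0%N).+1, (d K).+1) -> 'rV[R]_(d 0%N).+1)
    (B1 : nat -> nat) (eta alpha : nat -> R)
    (z : nat -> nat -> nat -> nat -> Xi) (tau : nat -> nat)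
    (st : state R d K) (s : nat) : state R d K :=
  if s is r.+1 then
    pmvr fo Jo lmo (B1 s) (eta s) (alpha s) (z s)
      (stagewise_pmvr fo Jo lmo B1 eta alpha z tau st r) (tau s).-1
  else st.

(* Main.v *)
(* The level estimates u and the Jacobian product in v use the same samples, so
   v is conditionally biased.  Freeze the past and let ubar be the deterministic
   predictor obtained from the recursion of u by replacing the oracles by their
   means.  With samples at ubar the Jacobian products of the successive levels
   form a martingale; the error of replacing u by ubar is a product of two
   small terms, level noise times distance from u to ubar, and is bounded in L1
   by O(alpha (1 + S) / B), where S = sum_i |u^(i+1) - f_i(u^i)|^2.  With
   psi = sqrt (alpha^2 + |v - G(u)|^2), G(u) the product of the true Jacobians at
   u, this gives for eta = alpha / 2 and B >= const / alpha
     E S' <= (1 - alpha)^2 S + alpha^3 (1 + S),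
     E psi' <= (1 - alpha) psi + alpha^2 (2 + S),
   while convexity gives for the optimality gap
     gap' <= (1 - eta) gap + O(eta) (psi + sum_i |u^(i+1) - f_i(u^i)|) + O(eta^2).
   So the potential gap + C psi + C S / alpha contracts by 1 - alpha / 2 up to
   O(alpha^2).  Averaging over a stage of length 16 / alpha leaves at most an
   eighth of the initial potential plus O(alpha); halving alpha at most doubles
   the potential; hence the potential after stage s is O(2^-s). *)
Require Import Defs.
From HB Require Import structures.
From mathcomp Require Import all_boot all_order all_algebra.
From mathcomp Require Import all_classical all_reals all_analysis.
From mathcomp Require Import measurable_realfun.
From mathcomp Require Import ring lra zify.
Set Implicit Arguments.
Unset Strict Implicit.
Unset Printing Implicit Defensive.
Import Order.TTheory GRing.Theory Num.Theory.
Import numFieldNormedType.Exports.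
Local Open Scope classical_set_scope.
Local Open Scope ring_scope.

(** * Decoupling of independent draws *)

(** The assumptions control only second moments of the oracles. At the random estimates u, the
    square of a difference of sampled Jacobian products multiplies |u - ubar|^2 by squared sampled
    factors that depend on the same draws, and its mean would need fourth moments. Without the
    squares the AM-GM inequality suffices; hence the bias is measured in L1 and the potential
    contains a norm of v - G(u), not its square. At the deterministic points ubar distances are
    constants and second moments are enough. Conditional expectations are never formed. Disjoint
    groups of independent draws give the pair (past, fresh) a product law, so the past is frozen in
    one argument of a two-argument function and the fresh draws are integrated in the other. The
    parameters are chosen before the dimensions, the functions and the probability space. All
    constants are therefore functions of K and of one number L that dominates the constants of the
    assumptions; dimension-dependent inequalities serve only for continuity and
    differentiability. *)

Definition join_pi (Omega : Type) (I : eqType) (G : I -> set (set Omega))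
    (A : set I) : set (set Omega) :=
  [set X | exists (J : seq I) (E : I -> set Omega),
     [/\ uniq J, forall i, i \in J -> A i, forall i, i \in J -> G i (E i) &
         X = \bigcap_(i in [set` J]) E i]].

Lemma join_pi_sub (Omega : Type) (I : eqType) (G : I -> set (set Omega))
    (A : set I) i X : A i -> G i X -> join_pi G A X.
Proof.
move=> Ai GX; exists [:: i], (fun _ => X); split => //.
- by move=> j; rewrite inE => /eqP ->.
- by move=> j; rewrite inE => /eqP ->.
apply/seteqP; split => w /=; first by move=> Xw j _.
by move=> /(_ i); apply; rewrite /= inE.
Qed.

(** The sigma-algebra generated by the draws in [A], as a measurable structure on [Omega] itself:
    being a function of these draws becomes measurability on [joinT G A]. *)
Definition joinT (Omega : Type) (I : eqType) (G : I -> set (set Omega))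
  (A : set I) := g_sigma_algebraType (join_pi G A).

Section decoupling.
Context (dO : measure_display) (Omega : measurableType dO) (R : realType)
  (P : probability Omega R) (I : eqType) (G : I -> set (set Omega)).
Hypothesis Gm : forall i, G i `<=` measurable.
Hypothesis GT : forall i, G i setT.
Hypothesis GI : forall i, setI_closed (G i).
Hypothesis indG : mutually_independent P G.

Lemma join_pi_measurable A : join_pi G A `<=` measurable.
Proof.
move=> _ [J [E [_ _ GE ->]]].
apply: fin_bigcap_measurable => [|i /= iJ]; first exact: finite_seq.
exact/Gm/GE.
Qed.

Lemma join_piT A : join_pi G A setT.
Proof.
exists [::], (fun=> setT); split => //.
by apply/seteqP; split.
Qed.

(** Padding by [setT] lets two finite intersections be written over one common list of indices. *)
Let ext (J : seq I) (E : I -> set Omega) i := if i \in J then E i else setT.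

Let extG J E i : (forall i, i \in J -> G i (E i)) -> G i (ext J E i).
Proof. by move=> GE; rewrite /ext; case: ifPn => [/GE|_]. Qed.

Let ext_capU J J' E : \bigcap_(i in [set` J]) E i =
  \bigcap_(i in [set` undup (J ++ J')]) ext J E i.
Proof.
apply/seteqP; split => w /= H i.
  by rewrite /ext => /= _; case: ifPn => // iJ; exact: H.
move=> /= iJ; have := H i; rewrite /ext /= iJ; apply.
by rewrite mem_undup mem_cat iJ.
Qed.

Lemma join_piI A : setI_closed (join_pi G A).
Proof.
move=> _ _ [J [E [uJ JA GE ->]]] [J' [E' [uJ' JA' GE' ->]]].
exists (undup (J ++ J')), (fun i => ext J E i `&` ext J' E' i); split.
- exact: undup_uniq.
- by move=> i; rewrite mem_undup mem_cat => /orP[/JA|/JA'].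
- by move=> i _; apply: GI; exact: extG.
rewrite (ext_capU J J' E) (ext_capU J' J E').
apply/seteqP; split => w /=.
  move=> [H H'] i iJ; split; first exact: H.
  by apply: H'; move: iJ; rewrite /= !mem_undup !mem_cat orbC.
move=> H; split => i iJ; first by have [] := H i iJ.
by have [//|] := H i; move: iJ; rewrite /= !mem_undup !mem_cat orbC.
Qed.

Lemma join_pi_indep A A' X Y : A `&` A' = set0 ->
  join_pi G A X -> join_pi G A' Y -> P (X `&` Y) = (P X * P Y)%E.
Proof.
move=> AA' [J [E [uJ JA GE ->]]] [J' [E' [uJ' JA' GE' ->]]].
have dJ i : i \in J -> i \in J' = false.
  move=> iJ; apply/negP => iJ'; have : (A `&` A') i by split; [exact: JA|exact: JA'].
  by rewrite AA'.
pose F i := if i \in J then E i else E' i.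
have EF : \bigcap_(i in [set` J]) E i `&` \bigcap_(i in [set` J']) E' i =
    \bigcap_(i in [set` J ++ J']) F i.
  apply/seteqP; split => w /=.
    move=> [H H'] i /=; rewrite mem_cat /F; case: ifPn => [iJ _|iJ /= iJ'].
      exact: H.
    exact: H'.
  move=> H; split => i /= iJ.
    by have := H i; rewrite /= mem_cat iJ /F iJ; apply.
  have := H i; rewrite /= mem_cat iJ orbT /F.
  by case: ifPn => [/dJ|_]; [rewrite iJ|apply].
have GF i : i \in J ++ J' -> G i (F i).
  by rewrite mem_cat /F; case: ifPn => [/GE //|_ /= /GE' //].
have FJ : \bigcap_(i in [set` J]) E i = \bigcap_(i in [set` J]) F i.
  by apply: eq_bigcapr => i /= iJ; rewrite /F iJ.
have FJ' : \bigcap_(i in [set` J']) E' i = \bigcap_(i in [set` J']) F i.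
  apply: eq_bigcapr => i /= iJ'; rewrite /F; case: ifPn => // iJ.
  by move: (dJ _ iJ); rewrite iJ'.
rewrite EF FJ FJ' (indG uJ) ?(indG uJ') ?(indG (J := J ++ J')) ?big_cat //.
- rewrite cat_uniq uJ uJ' andbT /=; apply/hasPn => i iJ' /=.
  by apply/negP => /dJ; rewrite iJ'.
- by move=> i iJ; apply: GF; rewrite mem_cat iJ orbT.
- by move=> i iJ; apply: GF; rewrite mem_cat iJ.
Qed.

(** For fixed [Y] both sides are finite measures in [X]; agreeing on the pi-system [U], they agree
    on the sigma-algebra that it generates. *)
Lemma indep_extend (U V : set (set Omega)) :
  U `<=` measurable -> V `<=` measurable -> setI_closed U -> U setT ->
  (forall X Y, U X -> V Y -> P (X `&` Y) = (P X * P Y)%E) ->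
  forall X Y, <<s U >> X -> V Y -> P (X `&` Y) = (P X * P Y)%E.
Proof.
move=> Um Vm UI UT UV X Y sX VY.
have mY := Vm _ VY.
have pY : 0 <= fine (P Y) by rewrite fine_ge0.
have fY : P Y \is a fin_num by exact: fin_num_measure.
have -> : (P X * P Y)%E = mscale (NngNum pY) P X.
  by rewrite /mscale /= fineK// muleC.
pose m1 : {measure set Omega -> \bar R} := mrestr P mY.
pose m2 : {measure set Omega -> \bar R} := mscale (NngNum pY) P.
change (m1 X = m2 X).
apply: (@g_sigma_algebra_measure_unique _ _ _ U Um (fun=> setT)) => //.
- by apply/seteqP; split => // w _; exists 0%N.
- move=> Z UZ; rewrite /= /mrestr UV// /mscale /= fineK// muleC //.
move=> k; rewrite /= /mrestr setTI.
by rewrite (le_lt_trans (probability_le1 P mY))// ltry.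
Qed.

Lemma join_indep A A' X Y : A `&` A' = set0 ->
  <<s join_pi G A >> X -> <<s join_pi G A' >> Y ->
  P (X `&` Y) = (P X * P Y)%E.
Proof.
move=> AA' sX sY.
have sm B : <<s join_pi G B >> `<=` measurable.
  by apply: smallest_sub; [exact: sigma_algebra_measurable|exact: join_pi_measurable].
(* One of the two pi-systems is extended at a time, with the factors exchanged in between. *)
move: sY sX; rewrite setIC muleC.
apply: (indep_extend (@join_pi_measurable A') (sm A) (@join_piI A') (join_piT A')) => //.
move=> {}Y {}X GY sX; rewrite setIC muleC; move: sX GY.
apply: (indep_extend (@join_pi_measurable A) (@join_pi_measurable A')
  (@join_piI A) (join_piT A)) => // X' Y' UX' UY'.
exact: join_pi_indep AA' UX' UY'.
Qed.

Lemma measurable_joinT (A : set I) :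
  measurable_fun [set: Omega] (fun w => w : joinT G A).
Proof.
move=> _ Y mY; rewrite setTI /= preimage_id.
apply: (smallest_sub _ _ mY); first exact: sigma_algebra_measurable.
exact: join_pi_measurable.
Qed.

Lemma measurable_from_joinT (A : set I) d' (S : measurableType d')
    (f : Omega -> S) : measurable_fun [set: joinT G A] f ->
  measurable_fun [set: Omega] f.
Proof.
move=> mf _ Y mY; rewrite setTI.
have mZ : measurable ((f : joinT G A -> S) @^-1` Y).
  by rewrite -[X in measurable X]setTI; exact: mf.
by have := measurable_joinT measurableT mZ; rewrite setTI.
Qed.

(** Since the groups of draws are disjoint, the diagonal map into the product of the two
    sigma-algebras has the product law; Tonelli then separates the arguments. This replaces
    conditioning on the past. *)
Lemma ge0_integral_decouple (A A' : set I) (g : Omega -> Omega -> R) :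
  A `&` A' = set0 ->
  measurable_fun [set: (joinT G A * joinT G A')%type] (fun w => g w.1 w.2 : R) ->
  (forall w w', 0 <= g w w') ->
  (\int[P]_w (g w w)%:E = \int[P]_w \int[P]_w' (g w w')%:E)%E.
Proof.
move=> AA' /measurable_EFinP mg g0.
pose D := fun w : Omega => ((w, w) : joinT G A * joinT G A').
have mD : measurable_fun setT D.
  exact: (measurable_fun_pair (measurable_joinT (A := A)) (measurable_joinT (A := A'))).
pose P1 : {mfun Omega >-> joinT G A} :=
  HB.pack (fun w : Omega => w : joinT G A)
    (isMeasurableFun.Build _ _ _ _ _ (measurable_joinT (A := A))).
pose P2 : {mfun Omega >-> joinT G A'} :=
  HB.pack (fun w : Omega => w : joinT G A')
    (isMeasurableFun.Build _ _ _ _ _ (measurable_joinT (A := A'))).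
pose DD : {mfun Omega >-> (joinT G A * joinT G A')%type} :=
  HB.pack D (isMeasurableFun.Build _ _ _ _ _ mD).
have g0' z : (0 <= (EFin \o (fun w => g w.1 w.2)) z)%E by rewrite /= lee_fin.
transitivity (\int[distribution P DD]_z (EFin \o (fun w => g w.1 w.2)) z)%E.
  by rewrite ge0_integral_distribution.
rewrite (@eq_measure_integral _ _ _ _ (distribution P P1 \x distribution P P2)%E); last first.
  move=> Z mZ _; apply/esym/product_measure_unique => // X Y mX mY.
  rewrite /distribution /pushforward /=.
  exact: (join_indep AA' mX mY).
rewrite fubini_tonelli1 //=.
rewrite (@ge0_integral_distribution _ _ _ _ _ P P1) //.
- apply: eq_integral => w _ /=; rewrite /fubini_F /= .
  rewrite (@ge0_integral_distribution _ _ _ _ _ P P2) //.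
    exact: (measurableT_comp mg (pair1_measurable _)).
  by move=> y; rewrite lee_fin.
- exact: measurable_fun_fubini_tonelli_F.
by move=> w; apply: integral_ge0.
Qed.

Lemma measurable_decouple (A A' : set I) (g : Omega -> Omega -> R) :
  measurable_fun [set: (joinT G A * joinT G A')%type] (fun w => g w.1 w.2 : R) ->
  (forall w, measurable_fun [set: Omega] (g w)).
Proof.
move=> mg w; apply: (@measurable_from_joinT A').
exact: (measurableT_comp mg (@pair1_measurable _ _ (joinT G A) (joinT G A') w)).
Qed.
End decoupling.

(** * Norms, measurability and expectation *)

Section euclidean_norm.
Context (R : realType).
Implicit Types (m n p q : nat).

Definition dot m n (A B : 'M[R]_(m, n)) : R := \sum_i \sum_j A i j * B i j.

Lemma dotC m n (A B : 'M[R]_(m, n)) : dot A B = dot B A.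
Proof. by apply: eq_bigr => i _; apply: eq_bigr => j _; rewrite mulrC. Qed.

Lemma dotDl m n (A B C : 'M[R]_(m, n)) : dot (A + B) C = dot A C + dot B C.
Proof.
rewrite /dot -big_split; apply: eq_bigr => i _; rewrite -big_split.
by apply: eq_bigr => j _; rewrite mxE mulrDl.
Qed.

Lemma dotZl m n a (A C : 'M[R]_(m, n)) : dot (a *: A) C = a * dot A C.
Proof.
rewrite /dot big_distrr; apply: eq_bigr => i _; rewrite big_distrr.
by apply: eq_bigr => j _; rewrite mxE /= mulrA.
Qed.

Lemma dotDr m n (A B C : 'M[R]_(m, n)) : dot A (B + C) = dot A B + dot A C.
Proof. by rewrite dotC dotDl !(dotC A). Qed.

Lemma dotZr m n a (A C : 'M[R]_(m, n)) : dot A (a *: C) = a * dot A C.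
Proof. by rewrite dotC dotZl dotC. Qed.

Lemma dotAA_ge0 m n (A : 'M[R]_(m, n)) : 0 <= dot A A.
Proof.
by apply: sumr_ge0 => i _; apply: sumr_ge0 => j _; rewrite -expr2 sqr_ge0.
Qed.

Lemma norm2_ge0 m n (A : 'M[R]_(m, n)) : 0 <= norm2 A.
Proof. exact: sqrtr_ge0. Qed.

Lemma sqr_norm2 m n (A : 'M[R]_(m, n)) : norm2 A ^+ 2 = dot A A.
Proof.
have E : dot A A = \sum_i \sum_j A i j ^+ 2.
  by apply: eq_bigr => i _; apply: eq_bigr => j _; rewrite expr2.
by rewrite sqr_sqrtr -E ?dotAA_ge0.
Qed.

Lemma norm2E m n (A : 'M[R]_(m, n)) : norm2 A = Num.sqrt (dot A A).
Proof. by rewrite -sqr_norm2 sqrtr_sqr ger0_norm ?norm2_ge0. Qed.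

Lemma sqr_norm2D m n (A B : 'M[R]_(m, n)) :
  norm2 (A + B) ^+ 2 = norm2 A ^+ 2 + dot A B *+ 2 + norm2 B ^+ 2.
Proof. by rewrite !sqr_norm2 !(dotDl, dotDr) (dotC B A) mulr2n !addrA. Qed.

Lemma norm2Z m n a (A : 'M[R]_(m, n)) : norm2 (a *: A) = `|a| * norm2 A.
Proof.
by rewrite !norm2E dotZl dotZr mulrA -expr2 sqrtrM ?sqr_ge0// sqrtr_sqr.
Qed.

Lemma norm2N m n (A : 'M[R]_(m, n)) : norm2 (- A) = norm2 A.
Proof. by rewrite -scaleN1r norm2Z normrN normr1 mul1r. Qed.

Lemma norm2_0 m n : norm2 (0 : 'M[R]_(m, n)) = 0.
Proof. by rewrite -(scale0r 0) norm2Z normr0 mul0r. Qed.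

Lemma norm2B m n (A B : 'M[R]_(m, n)) : norm2 (A - B) = norm2 (B - A).
Proof. by rewrite -norm2N opprB. Qed.

Lemma norm2_entry m n (A : 'M[R]_(m, n)) i j : `|A i j| <= norm2 A.
Proof.
rewrite -sqrtr_sqr norm2E ler_sqrt ?dotAA_ge0//.
rewrite /dot (bigD1 i)//= (bigD1 j)//= -expr2 -addrA lerDl addr_ge0//.
  by apply: sumr_ge0 => k _; rewrite -expr2 sqr_ge0.
by apply: sumr_ge0 => k _; apply: sumr_ge0 => l _; rewrite -expr2 sqr_ge0.
Qed.

Lemma norm2_eq0 m n (A : 'M[R]_(m, n)) : norm2 A = 0 -> A = 0.
Proof.
move=> A0; apply/matrixP => i j; rewrite mxE; apply/eqP; rewrite -normr_eq0.
by rewrite eq_le normr_ge0 andbT -A0 norm2_entry.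
Qed.

Lemma dot_le m n (A B : 'M[R]_(m, n)) : dot A B <= norm2 A * norm2 B.
Proof.
have [B0|Bn0] := eqVneq (norm2 B) 0.
  rewrite B0 mulr0 (norm2_eq0 B0) /dot big1// => i _.
  by rewrite big1// => j _; rewrite mxE mulr0.
have B_gt0 : 0 < norm2 B by rewrite lt0r Bn0 norm2_ge0.
have := dotAA_ge0 (norm2 B ^+ 2 *: A - dot A B *: B).
rewrite -scaleNr !(dotDl, dotDr, dotZl, dotZr) (dotC B A) -!sqr_norm2.
set a := norm2 A; set b := norm2 B in B_gt0 *; set c := dot A B.
rewrite [X in 0 <= X](_ : _ = b ^+ 2 * (a ^+ 2 * b ^+ 2 - c ^+ 2)); last by ring.
rewrite pmulr_rge0 ?exprn_gt0// subr_ge0 -exprMn => h.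
have ab : 0 <= a * b by rewrite mulr_ge0// norm2_ge0.
by rewrite (le_trans (ler_norm _))// -ler_sqr ?nnegrE// real_normK// num_real.
Qed.

Lemma abs_dot_le m n (A B : 'M[R]_(m, n)) : `|dot A B| <= norm2 A * norm2 B.
Proof.
rewrite ler_norml dot_le andbT lerNl -(norm2N A) -mulN1r -dotZl scaleN1r.
exact: dot_le.
Qed.

Lemma norm2D m n (A B : 'M[R]_(m, n)) : norm2 (A + B) <= norm2 A + norm2 B.
Proof.
rewrite -ler_sqr ?nnegrE ?addr_ge0 ?norm2_ge0// sqr_norm2D sqrrD.
by rewrite lerD2r lerD2l lerMn2r/= dot_le.
Qed.

Lemma sqr_norm2D_le m n (A B : 'M[R]_(m, n)) :
  norm2 (A + B) ^+ 2 <= 2 * (norm2 A ^+ 2 + norm2 B ^+ 2).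
Proof.
apply: (@le_trans _ _ ((norm2 A + norm2 B) ^+ 2)).
  by rewrite ler_sqr ?nnegrE ?addr_ge0 ?norm2_ge0 ?norm2D.
by have := sqr_ge0 (norm2 A - norm2 B); nra.
Qed.

Lemma sqr_norm2D3_le m n (A B C : 'M[R]_(m, n)) :
  norm2 (A + B + C) ^+ 2 <= 3 * (norm2 A ^+ 2 + norm2 B ^+ 2 + norm2 C ^+ 2).
Proof.
have h1 := norm2D (A + B) C; have h2 := norm2D A B.
have h3 := norm2_ge0 (A + B + C).
have h : norm2 (A + B + C) <= norm2 A + norm2 B + norm2 C by lra.
apply: (@le_trans _ _ ((norm2 A + norm2 B + norm2 C) ^+ 2)).
  by rewrite ler_sqr ?nnegrE ?(le_trans h3 h)//.
set a := norm2 A; set b := norm2 B; set c := norm2 C.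
have := sqr_ge0 (a - b); have := sqr_ge0 (a - c); have := sqr_ge0 (b - c).
nra.
Qed.

Lemma norm2_rows m n (A : 'M[R]_(m, n)) :
  norm2 A ^+ 2 = \sum_i norm2 (row i A) ^+ 2.
Proof.
rewrite sqr_norm2; apply: eq_bigr => i _; rewrite sqr_norm2 /dot big_ord1.
by apply: eq_bigr => j _; rewrite !mxE.
Qed.

Lemma norm2_tr m n (A : 'M[R]_(m, n)) : norm2 A^T = norm2 A.
Proof.
rewrite !norm2E /dot exchange_big /=; congr Num.sqrt.
by apply: eq_bigr => i _; apply: eq_bigr => j _; rewrite !mxE.
Qed.

(* [c] bounds the operator norm of [A]; unlike the Frobenius norm, operator
   norms of Jacobians are bounded by the Lipschitz constant whatever the
   dimension. *)
Definition opbound m n (A : 'M[R]_(m, n)) (c : R) :=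
  0 <= c /\ forall x : 'rV_m, norm2 (x *m A) <= c * norm2 x.

Lemma opbound_mull m n p (X : 'M[R]_(p, m)) (A : 'M[R]_(m, n)) c :
  opbound A c -> norm2 (X *m A) <= c * norm2 X.
Proof.
move=> [c0 Ac]; rewrite -ler_sqr ?nnegrE ?mulr_ge0 ?norm2_ge0//.
rewrite exprMn !norm2_rows big_distrr /=; apply: ler_sum => i _.
by rewrite row_mul -exprMn ler_sqr ?nnegrE ?mulr_ge0 ?norm2_ge0.
Qed.

Lemma dot_mulmx_tr m n (A : 'M[R]_(m, n)) (x : 'rV_m) (y : 'rV_n) :
  dot (y *m A^T) x = dot y (x *m A).
Proof.
rewrite /dot !big_ord1.
under eq_bigr do rewrite mxE big_distrl /=.
rewrite exchange_big /=; apply: eq_bigr => j _; rewrite mxE big_distrr /=.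
by apply: eq_bigr => i _; rewrite mxE mulrAC -mulrA.
Qed.

(** The square of |y A^T| is the pairing of y with (y A^T) A, so after Cauchy-Schwarz one factor |y
    A^T| cancels. It yields [opbound_mulr] from [opbound_mull]. *)
Lemma opbound_tr m n (A : 'M[R]_(m, n)) c : opbound A c -> opbound A^T c.
Proof.
move=> [c0 Ac]; split=> // y; set x := y *m A^T.
have [->|x0] := eqVneq (norm2 x) 0; first by rewrite mulr_ge0 ?norm2_ge0.
have xp : 0 < norm2 x by rewrite lt0r x0 norm2_ge0.
rewrite -(ler_pM2r xp) -expr2 sqr_norm2 {1}/x dot_mulmx_tr.
rewrite (le_trans (dot_le _ _))// mulrC mulrAC ler_wpM2r ?norm2_ge0//.
Qed.

Lemma opbound_mulr m n p (A : 'M[R]_(m, n)) (X : 'M[R]_(n, p)) c :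
  opbound A c -> norm2 (A *m X) <= c * norm2 X.
Proof.
by move=> /opbound_tr Ac; rewrite -norm2_tr trmx_mul -(norm2_tr X) opbound_mull.
Qed.

Lemma opboundM m n p (A : 'M[R]_(m, n)) (B : 'M[R]_(n, p)) a b :
  opbound A a -> opbound B b -> opbound (A *m B) (a * b).
Proof.
move=> [a0 Aa] Bb; have [b0 _] := Bb; split; first exact: mulr_ge0.
move=> x; rewrite mulmxA (le_trans (opbound_mull _ Bb))//.
by rewrite (mulrC a) -mulrA ler_wpM2l.
Qed.

Lemma opboundD m n (A B : 'M[R]_(m, n)) a b :
  opbound A a -> opbound B b -> opbound (A + B) (a + b).
Proof.
move=> [a0 Aa] [b0 Bb]; split=> [|x]; first exact: addr_ge0.
by rewrite mulmxDr (le_trans (norm2D _ _))// mulrDl lerD.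
Qed.

Lemma opbound_norm2 m n (A : 'M[R]_(m, n)) : opbound A (norm2 A).
Proof.
split=> [|x]; first exact: norm2_ge0.
rewrite -ler_sqr ?nnegrE ?mulr_ge0 ?norm2_ge0// exprMn.
rewrite -(norm2_tr A) (norm2_rows A^T) sqr_norm2 /dot big_ord1 big_distrl /=.
apply: ler_sum => j _; rewrite -expr2 -exprMn.
rewrite -real_normK ?num_real// ler_sqr ?nnegrE ?mulr_ge0 ?norm2_ge0//.
rewrite [X in `|X|](_ : _ = dot (row j A^T) x) ?abs_dot_le//.
by rewrite /dot big_ord1 mxE; apply: eq_bigr => k _; rewrite !mxE mulrC.
Qed.

Lemma opbound1 m : opbound (1%:M : 'M[R]_m) 1.
Proof. by split=> // x; rewrite mulmx1 mul1r. Qed.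

Lemma inner_le m n (x : 'rV[R]_m) (v : 'M[R]_(m, n.+1)) :
  `|inner x v| <= norm2 x * norm2 v.
Proof.
rewrite /inner (le_trans (norm2_entry _ _ _))// mulrC.
exact: (opbound_mull _ (opbound_norm2 v)).
Qed.

End euclidean_norm.

(** * Measurability of matrix-valued maps *)

Section matrix_measurability.
Context (R : realType).

(** The entrywise form passes through the matrix operations at once; [mxmeasP] identifies it with
    measurability for the Borel structure in which the oracles are given. *)
Definition mxmeas d (T : measurableType d) m n (f : T -> 'M[R]_(m, n)) :=
  forall i j, measurable_fun [set: T] (fun w => f w i j : R).

Lemma measurable_coord m n i j :
  measurable_fun [set: borel_mx R m n] (fun A : 'M[R]_(m, n) => A i j : R).
Proof.
apply: (measurability _ (RGenOInfty.measurableE R)) => /= _ [_ [x ->] <-].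
rewrite setTI; apply: sub_sigma_algebra.
by apply: open_comp => [A _|]; [exact: coord_continuous|exact: interval_open].
Qed.

Let box m n (qk : 'M[rat]_(m, n) * nat) : set 'M[R]_(m, n) :=
  [set A | forall i j, `|A i j - ratr (qk.1 i j)| < qk.2.+1%:R^-1].

(** Rational centres and radii 1 / (k + 1) make the family of boxes countable, so an open set is a
    countable union of sets described by entries. *)
Let open_box m n (U : set 'M[R]_(m, n)) : open U ->
  U = \bigcup_(qk in [set qk | box qk `<=` U]) box qk.
Proof.
move=> oU; apply/seteqP; split => [A UA|A [qk /= h bA]]; last exact: h.
have /nbhs_ballP[e /= e0 eU] : nbhs A U by apply: open_nbhs_nbhs.
have [k ke] : exists k : nat, k.+1%:R^-1 < e / 2.
  have /(@ltr_add_invr R)[k h] : 0 < e / 2 by rewrite divr_gt0.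
  by exists k; move: h; rewrite add0r.
have hq i j : exists q : rat, `|A i j - ratr q| < k.+1%:R^-1.
  have [|q] := @rat_in_itvoo R (A i j - k.+1%:R^-1) (A i j + k.+1%:R^-1).
    by rewrite ltrBlDr -addrA ltrDl addr_gt0 ?invr_gt0.
  by rewrite in_itv/= => /andP[h1 h2]; exists q; rewrite distrC ltr_distl h1.
pose q := \matrix_(i, j) projT1 (cid (hq i j)).
exists (q, k) => /=; last by move=> i j /=; rewrite mxE; case: cid.
move=> B bB; apply: eU; split=> // i j.
rewrite /ball /=.
have h1 := bB i j; have h2 : `|A i j - ratr (q i j)| < k.+1%:R^-1.
  by rewrite mxE; case: cid.
rewrite -(subrK (ratr (q i j)) (A i j)) -addrA (le_lt_trans (ler_normD _ _))//.
rewrite [ltRHS](splitr e) ltrD ?(lt_trans h2)// distrC (lt_trans h1)//.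
Qed.

Lemma mxmeasP d (T : measurableType d) m n (f : T -> 'M[R]_(m, n)) :
  mxmeas f <-> measurable_fun [set: T] (f : T -> borel_mx R m n).
Proof.
split=> [mf|mf i j]; last exact: (measurableT_comp (measurable_coord i j) mf).
apply: (@measurability _ _ T (borel_mx R m n) setT f (@open 'M[R]_(m, n))) => //.
move=> _ [U oU <-]; rewrite setTI (open_box oU) preimage_bigcup.
rewrite bigcup_mkcond; apply: countable_bigcupT_measurable.
  exact: countableP.
move=> qk; case: ifPn => // _.
rewrite [X in measurable X](_ : _ = \bigcap_(i in [set: 'I_m])
   \bigcap_(j in [set: 'I_n]) [set w | `|f w i j - ratr (qk.1 i j)| < qk.2.+1%:R^-1]).
  apply: fin_bigcap_measurable => // i _; apply: fin_bigcap_measurable => // j _.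
  rewrite -[X in measurable X]setTI; apply: measurable_fun_ltr => //.
  by apply: measurableT_comp => //; apply: measurable_funB.
apply/seteqP; split => w /= h; first by move=> i _ j _; exact: h.
by move=> i j; exact: h.
Qed.

Lemma mxmeas_cst d (T : measurableType d) m n (A : 'M[R]_(m, n)) :
  mxmeas (fun _ : T => A).
Proof. by move=> i j. Qed.

Lemma mxmeasD d (T : measurableType d) m n (f g : T -> 'M[R]_(m, n)) :
  mxmeas f -> mxmeas g -> mxmeas (fun w => f w + g w).
Proof.
move=> mf mg i j; under eq_fun do rewrite mxE; exact: measurable_funD.
Qed.

Lemma mxmeasZ d (T : measurableType d) m n (a : T -> R) (f : T -> 'M[R]_(m, n)) :
  measurable_fun setT a -> mxmeas f -> mxmeas (fun w => a w *: f w).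
Proof.
by move=> ma mf i j; under eq_fun do rewrite mxE; exact: measurable_funM.
Qed.

Lemma mxmeasN d (T : measurableType d) m n (f : T -> 'M[R]_(m, n)) :
  mxmeas f -> mxmeas (fun w => - f w).
Proof.
move=> mf i j; under eq_fun do rewrite mxE; exact: measurable_funN.
Qed.

Lemma mxmeasB d (T : measurableType d) m n (f g : T -> 'M[R]_(m, n)) :
  mxmeas f -> mxmeas g -> mxmeas (fun w => f w - g w).
Proof. by move=> mf mg; apply: mxmeasD => //; exact: mxmeasN. Qed.

Lemma mxmeas_sum d (T : measurableType d) m n (I : Type) (r : seq I)
    (f : I -> T -> 'M[R]_(m, n)) :
  (forall i, mxmeas (f i)) -> mxmeas (fun w => \sum_(i <- r) f i w).
Proof.
move=> mf i j; under eq_fun do rewrite summxE.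
by apply: measurable_sum => k; exact: mf.
Qed.

Lemma mxmeasM d (T : measurableType d) m n p
    (f : T -> 'M[R]_(m, n)) (g : T -> 'M[R]_(n, p)) :
  mxmeas f -> mxmeas g -> mxmeas (fun w => f w *m g w).
Proof.
move=> mf mg i j; under eq_fun do rewrite mxE.
by apply: measurable_sum => k; exact: measurable_funM.
Qed.

Lemma mxmeas_batch_mean d (T : measurableType d) m n B
    (f : nat -> T -> 'M[R]_(m, n)) : (forall j, (j < B)%N -> mxmeas (f j)) ->
  mxmeas (fun w => batch_mean B (fun j => f j w)).
Proof.
move=> mf; apply: mxmeasZ; first exact: measurable_cst.
by apply: mxmeas_sum => j; exact: mf.
Qed.

Lemma measurable_sqrt : measurable_fun [set: R] (@Num.sqrt R).
Proof. by apply: continuous_measurable_fun; exact: sqrt_continuous. Qed.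

Lemma measurable_fun_sqrt d (T : measurableType d) (f : T -> R) :
  measurable_fun setT f -> measurable_fun setT (fun w => Num.sqrt (f w)).
Proof. by move=> mf; exact: (measurableT_comp measurable_sqrt mf). Qed.

Lemma measurable_norm2 d (T : measurableType d) m n (f : T -> 'M[R]_(m, n)) :
  mxmeas f -> measurable_fun setT (fun w => norm2 (f w)).
Proof.
move=> mf; apply: measurable_fun_sqrt.
apply: measurable_sum => i; apply: measurable_sum => j.
by apply: measurable_funX; exact: mf.
Qed.

Lemma mxmeas_comp d d' (T : measurableType d) (T' : measurableType d') m n
    (f : T' -> 'M[R]_(m, n)) (g : T -> T') :
  mxmeas f -> measurable_fun setT g -> mxmeas (fun w => f (g w)).
Proof. by move=> mf mg i j; exact: (measurableT_comp (mf i j) mg). Qed.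

Lemma mxmeas_oracle d dX (T : measurableType d) (Xi : measurableType dX)
    m n p q (g : 'M[R]_(m, n) -> Xi -> 'M[R]_(p, q)) a z :
  measurable_oracle g -> mxmeas a -> measurable_fun [set: T] z ->
  mxmeas (fun w => g (a w) (z w)).
Proof.
move=> mg /mxmeasP ma mz; apply/mxmeasP.
exact: (measurableT_comp mg (measurable_fun_pair ma mz)).
Qed.

Lemma mxmeas_borel d (T : measurableType d) m n p q
    (g : borel_mx R m n -> borel_mx R p q) (a : T -> 'M[R]_(m, n)) :
  measurable_fun setT g -> mxmeas a -> mxmeas (fun w => g (a w) : 'M[R]_(p, q)).
Proof.
by move=> mg /mxmeasP ma; apply/mxmeasP; exact: (measurableT_comp mg ma).
Qed.

Lemma continuous_borel m n p q (g : 'M[R]_(m, n) -> 'M[R]_(p, q)) :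
  continuous g ->
  measurable_fun [set: borel_mx R m n] (g : _ -> borel_mx R p q).
Proof.
move=> cg; apply: (@measurability _ _ (borel_mx R m n) (borel_mx R p q) setT g (@open 'M[R]_(p, q))) => //.
move=> _ [U oU <-]; rewrite setTI; apply: sub_sigma_algebra.
by apply: open_comp => // x _; exact: cg.
Qed.

(** A crude comparison with the max norm, whose balls define the topology; the successor keeps the
    factor positive for empty matrices. *)
Lemma norm2_le_entries m n (A : 'M[R]_(m, n)) e : 0 <= e ->
  (forall i j, `|A i j| <= e) -> norm2 A <= (m * n).+1%:R * e.
Proof.
move=> e0 h; rewrite -ler_sqr ?nnegrE ?mulr_ge0 ?norm2_ge0// sqr_norm2 exprMn.
apply: (@le_trans _ _ (\sum_(i < m) \sum_(j < n) e ^+ 2)).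
  apply: ler_sum => i _; apply: ler_sum => j _.
  by rewrite -expr2 -real_normK ?num_real// ler_sqr ?nnegrE.
under eq_bigr do rewrite sumr_const card_ord.
rewrite sumr_const card_ord -mulrnA -(mulr_natl (e ^+ 2)) ler_wpM2r ?sqr_ge0//.
rewrite -natrX ler_nat mulnC.
by rewrite (leq_trans (leqnSn _))// -{1}(expn1 (m * n).+1) leq_pexp2l.
Qed.

Lemma lipschitz2_continuous m n p q L (g : 'M[R]_(m, n) -> 'M[R]_(p, q)) :
  lipschitz2 L g -> continuous g.
Proof.
move=> Lg x A /= /(nbhs_ballP (g x)) [e /= e0 eA].
pose c := (`|L| + 1) * (m * n).+1%:R.
have c0 : 0 < c by rewrite mulr_gt0// ltr_wpDl.
apply/nbhs_ballP; exists (e / (c * 2)) => /=; first by rewrite divr_gt0// mulr_gt0.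
move=> y [_ xy]; apply: eA; split => // i j; rewrite /ball /=.
have -> : g x i j - g y i j = (g x - g y) i j by rewrite !mxE.
rewrite (le_lt_trans (norm2_entry _ _ _))// (le_lt_trans (Lg _ _))//.
have : norm2 (x - y) <= (m * n).+1%:R * (e / (c * 2)).
  apply: norm2_le_entries => [|k l]; first by rewrite divr_ge0 ?ltW// mulr_gt0.
  by have := xy k l; rewrite /ball /= !mxE => /ltW.
move=> h; apply: (@le_lt_trans _ _ ((`|L| + 1) * norm2 (x - y))).
  by rewrite ler_wpM2r ?norm2_ge0// (le_trans (ler_norm L))// lerDl.
apply: (@le_lt_trans _ _ (c * (e / (c * 2)))).
  by rewrite /c -mulrA ler_wpM2l// addr_ge0.
rewrite [ltLHS](_ : _ = e / 2); last by field; rewrite gt_eqF.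
by lra.
Qed.

Lemma mxmeas_lipschitz d (T : measurableType d) m n p q L
    (g : 'M[R]_(m, n) -> 'M[R]_(p, q)) (a : T -> 'M[R]_(m, n)) :
  lipschitz2 L g -> mxmeas a -> mxmeas (fun w => g (a w)).
Proof.
move=> Lg; apply: mxmeas_borel.
by apply: continuous_borel; exact: lipschitz2_continuous Lg.
Qed.

End matrix_measurability.

(** * Bounds on expectations of nonnegative functions *)

Section expectation.
Context d (T : measurableType d) (R : realType) (P : probability T R).
Implicit Types f g h : T -> R.

Definition ex f : \bar R := (\int[P]_w (f w)%:E)%E.

Lemma expectationE f : ('E_P[f] = ex f)%E.
Proof. by rewrite unlock. Qed.

Lemma ex_ge0 f : (forall w, 0 <= f w) -> (0 <= ex f)%E.
Proof. by move=> f0; apply: integral_ge0 => w _; rewrite lee_fin. Qed.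

(* no measurability is needed: the integral is a supremum over the simple
   functions below the integrand *)
Lemma ex_le f g : (forall w, 0 <= f w) -> (forall w, f w <= g w) ->
  (ex f <= ex g)%E.
Proof.
move=> f0 fg; have g0 w : 0 <= g w by exact: le_trans (fg w).
rewrite /ex !ge0_integralTE; try by move=> w; rewrite lee_fin.
apply: ge_ereal_sup => _ [h /= hf <-]; apply: ereal_sup_ubound => /=.
by exists h => //= w; rewrite (le_trans (hf w))// lee_fin.
Qed.

Lemma ex_cst c : ex (fun=> c) = c%:E.
Proof.
by rewrite -expectationE; exact: expectation_cst.
Qed.

Lemma exD f g : measurable_fun setT f -> measurable_fun setT g ->
  (forall w, 0 <= f w) -> (forall w, 0 <= g w) ->
  ex (fun w => f w + g w) = (ex f + ex g)%E.
Proof.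
move=> mf mg f0 g0; rewrite /ex -ge0_integralD //.
- by move=> w _; rewrite lee_fin.
- exact/measurable_EFinP.
- by move=> w _; rewrite lee_fin.
- exact/measurable_EFinP.
Qed.

Lemma exZ a f : 0 <= a -> measurable_fun setT f -> (forall w, 0 <= f w) ->
  ex (fun w => a * f w) = (a%:E * ex f)%E.
Proof.
move=> a0 mf f0; rewrite /ex -ge0_integralZl_EFin //.
- by move=> w _; rewrite lee_fin.
- exact/measurable_EFinP.
Qed.

Lemma ex_sum (n : nat) (F : nat -> T -> R) :
  (forall i, (i < n)%N -> measurable_fun setT (F i)) ->
  (forall i w, (i < n)%N -> 0 <= F i w) ->
  ex (fun w => \sum_(i < n) F i w) = (\sum_(i < n) ex (F i))%E.
Proof.
move=> mF F0; rewrite /ex -ge0_integral_sum //.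
- by apply: eq_integral => w _; rewrite sumEFin.
- by move=> i; apply/measurable_EFinP/mF.
- by move=> i w _; rewrite lee_fin F0.
Qed.

(** For a nonnegative measurable [f] a real bound in the extended reals carries integrability with
    it, so bounds chain without separate integrability conditions. *)
Definition exle f c := (ex f <= c%:E)%E.

Lemma exleW f c c' : c <= c' -> exle f c -> exle f c'.
Proof. by move=> cc' /le_trans; apply; rewrite lee_fin. Qed.

Lemma exle_le f g c : (forall w, 0 <= f w) -> (forall w, f w <= g w) ->
  exle g c -> exle f c.
Proof. by move=> f0 fg; apply: le_trans; exact: ex_le. Qed.

Lemma exle_cst f c : (forall w, 0 <= f w) -> (forall w, f w <= c) -> exle f c.
Proof. by move=> f0 fc; rewrite /exle -ex_cst; exact: ex_le. Qed.

Lemma exleD f g a b : measurable_fun setT f -> measurable_fun setT g ->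
  (forall w, 0 <= f w) -> (forall w, 0 <= g w) ->
  exle f a -> exle g b -> exle (fun w => f w + g w) (a + b).
Proof. by move=> mf mg f0 g0 fa gb; rewrite /exle exD// EFinD leeD. Qed.

Lemma exleZ a f c : 0 <= a -> measurable_fun setT f -> (forall w, 0 <= f w) ->
  exle f c -> exle (fun w => a * f w) (a * c).
Proof. by move=> a0 mf f0 fc; rewrite /exle exZ// EFinM lee_wpmul2l// lee_fin. Qed.

Lemma exle_sum (n : nat) (F : nat -> T -> R) c :
  (forall i, (i < n)%N -> measurable_fun setT (F i)) ->
  (forall i w, (i < n)%N -> 0 <= F i w) ->
  (forall i, (i < n)%N -> exle (F i) (c i)) ->
  exle (fun w => \sum_(i < n) F i w) (\sum_(i < n) c i).
Proof.
move=> mF F0 Fc; rewrite /exle ex_sum// -sumEFin; apply: lee_sum => i _.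
exact: Fc.
Qed.

(** The shape of most estimates below: a pointwise bound by two controlled functions and a constant
    becomes a bound in mean. *)
Lemma exle_lin2 f g h a b c G H : (forall w, 0 <= f w) ->
  0 <= a -> 0 <= b -> 0 <= c ->
  (forall w, f w <= a * g w + b * h w + c) ->
  measurable_fun setT g -> measurable_fun setT h ->
  (forall w, 0 <= g w) -> (forall w, 0 <= h w) ->
  exle g G -> exle h H -> exle f (a * G + b * H + c).
Proof.
move=> f0 a0 b0 c0 fgh mg mh g0 h0 gG hH.
apply: (exle_le f0 fgh); apply: exleD => //.
- by apply: measurable_funD; apply: measurable_funM.
- by move=> w; rewrite addr_ge0 ?mulr_ge0.
- by apply: exleD; rewrite ?mulr_ge0//; try (by move=> w; rewrite mulr_ge0);
    try exact: measurable_funM; exact: exleZ.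
- by apply: exle_cst.
Qed.

Lemma exle_lin1 f g a c G : (forall w, 0 <= f w) -> 0 <= a -> 0 <= c ->
  (forall w, f w <= a * g w + c) -> measurable_fun setT g ->
  (forall w, 0 <= g w) -> exle g G -> exle f (a * G + c).
Proof.
move=> f0 a0 c0 fg mg g0 gG; rewrite -[X in X + c](addr0) -(mulr0 0).
apply: (@exle_lin2 f g (fun=> 0) a 0 c G 0) => //.
  by move=> w; rewrite mulr0 addr0.
exact: exle_cst.
Qed.

(** The right-hand side is the tangent of the square root at t^2. *)
Lemma sqrt_le_AMGM (x t : R) : 0 <= x -> 0 < t ->
  Num.sqrt x <= (2 * t)^-1 * x + t / 2.
Proof.
move=> x0 t0; have s := sqr_sqrtr x0; set y := Num.sqrt x in s *.
rewrite -s -subr_ge0 (_ : _ - _ = (2 * t)^-1 * (y - t) ^+ 2).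
  by rewrite mulr_ge0 ?sqr_ge0// invr_ge0 mulr_ge0// ltW.
by field; rewrite gt_eqF.
Qed.

(** Jensen's inequality by tangents: the bound of [sqrt_le_AMGM] is integrated, then t = sqrt c is
    the best choice. *)
Lemma exle_sqrt f c : 0 <= c -> measurable_fun setT f -> (forall w, 0 <= f w) ->
  exle f c -> exle (fun w => Num.sqrt (f w)) (Num.sqrt c).
Proof.
move=> c0 mf f0 fc; set s := fun w => Num.sqrt (f w).
have ht t : 0 < t -> exle s ((2 * t)^-1 * c + t / 2).
  move=> t0; apply: (@exle_lin1 s f) => //.
  - by move=> w; exact: sqrtr_ge0.
  - by rewrite invr_ge0 mulr_ge0// ltW.
  - by rewrite divr_ge0// ltW.
  - by move=> w; apply: sqrt_le_AMGM.
(* The root has no tangent at c = 0; there t tends to 0 instead. *)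
have [c00|cn0] := eqVneq c 0.
  rewrite c00 sqrtr0; apply/lee_addgt0Pr => e e0.
  apply: le_trans (ht e e0) _; rewrite c00 mulr0 !add0r lee_fin.
  by rewrite ler_pdivrMr// ler_peMr ?ltW// ltr1n.
have cp : 0 < c by rewrite lt0r cn0.
have sp : 0 < Num.sqrt c by rewrite sqrtr_gt0.
apply: exleW (ht _ sp); rewrite -{2}(sqr_sqrtr c0) le_eqVlt; apply/orP; left.
by apply/eqP; field; rewrite gt_eqF.
Qed.

Section mean_zero.
Context (m n : nat).
Implicit Types Y : T -> 'M[R]_(m, n).

Definition mean0 Y := mxmeas Y /\ forall i j,
  P.-integrable setT (fun w => (Y w i j)%:E) /\
  (\int[P]_w (Y w i j)%:E = 0)%E.

Lemma mean0D Y Y' : mean0 Y -> mean0 Y' -> mean0 (fun w => Y w + Y' w).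
Proof.
move=> [mY hY] [mY' hY']; split=> [|i j]; first exact: mxmeasD.
have [iY Y0] := hY i j; have [iY' Y0'] := hY' i j.
split.
  under eq_fun do rewrite mxE EFinD; exact: integrableD.
by under eq_integral do rewrite mxE EFinD; rewrite integralD// Y0 Y0' add0e.
Qed.

Lemma mean0Z a Y : mean0 Y -> mean0 (fun w => a *: Y w).
Proof.
move=> [mY hY]; split=> [|i j]; first exact: mxmeasZ.
have [iY Y0] := hY i j; split.
  under eq_fun do rewrite mxE EFinM; exact: integrableZl.
by under eq_integral do rewrite mxE EFinM; rewrite integralZl// Y0 mule0.
Qed.

Lemma mean0B Y Y' : mean0 Y -> mean0 Y' -> mean0 (fun w => Y w - Y' w).
Proof.
by move=> hY hY'; under [X in mean0 X]eq_fun do rewrite -scaleN1r;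
  apply: mean0D => //; exact: mean0Z.
Qed.

Lemma integral_fin_sum (I : Type) (s : seq I) (c : I -> R) (f : I -> T -> R) :
  (forall i, P.-integrable setT (fun w => (f i w)%:E)) ->
  (forall i, \int[P]_w (f i w)%:E = 0)%E ->
  P.-integrable setT (fun w => (\sum_(i <- s) c i * f i w)%:E) /\
  (\int[P]_w (\sum_(i <- s) c i * f i w)%:E = 0)%E.
Proof.
move=> fi f0.
have E w : (\sum_(i <- s) c i * f i w)%:E = (\sum_(i <- s) (c i)%:E * (f i w)%:E)%E.
  by rewrite -sumEFin.
split.
  under eq_fun do rewrite E; apply: integrable_sum => // i _.
  exact: integrableZl.
under eq_integral do rewrite E.
rewrite integral_sum// => [|i]; last exact: integrableZl.
by rewrite big1// => i _; rewrite integralZl// f0 mule0.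
Qed.

(* the cross term vanishes *)
Lemma mean0_sqr Y c V : mean0 Y -> exle (fun w => norm2 (Y w) ^+ 2) V ->
  exle (fun w => norm2 (c + Y w) ^+ 2) (norm2 c ^+ 2 + V).
Proof.
move=> [mY hY] YV.
have mN : measurable_fun setT (fun w => norm2 (Y w) ^+ 2).
  by apply: measurable_funX; exact: measurable_norm2.
have hdot : P.-integrable setT (fun w => (dot c (Y w) *+ 2)%:E) /\
    (\int[P]_w (dot c (Y w) *+ 2)%:E = 0)%E.
  have E w : dot c (Y w) *+ 2 =
      \sum_(ij : 'I_m * 'I_n) (c ij.1 ij.2 *+ 2) * Y w ij.1 ij.2.
    rewrite /dot pair_big_dep /= -sumrMnl; apply: eq_bigr => ij _.
    by rewrite mulrnAl.
  rewrite (_ : (fun w => _) = fun w => (\sum_(ij : 'I_m * 'I_n)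
      (c ij.1 ij.2 *+ 2) * Y w ij.1 ij.2)%:E); last by apply/funext => w; rewrite E.
  by apply: integral_fin_sum => ij; have [] := hY ij.1 ij.2.
have iN : P.-integrable setT (fun w => (norm2 (Y w) ^+ 2)%:E).
  apply/integrableP; split; first exact/measurable_EFinP.
  under eq_integral do rewrite gee0_abs ?lee_fin ?sqr_ge0//.
  by apply: le_lt_trans YV _; rewrite ltry.
have iC : P.-integrable setT (fun w => (norm2 c ^+ 2)%:E).
  exact: finite_measure_integrable_cst.
rewrite /exle /ex; under eq_integral do rewrite sqr_norm2D !EFinD.
rewrite integralD//; last exact: (integrableD measurableT iC hdot.1).
rewrite (integralD measurableT iC hdot.1) hdot.2 adde0 EFinD leeD//.
by rewrite -[leLHS]/(ex (fun=> norm2 c ^+ 2)) ex_cst.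
Qed.

End mean_zero.

Lemma mean0_mull m n p (A : 'M[R]_(p, m)) (Y : T -> 'M[R]_(m, n)) :
  mean0 Y -> mean0 (fun w => A *m Y w).
Proof.
move=> [mY hY]; split=> [|i j].
  by apply: mxmeasM => //; exact: mxmeas_cst.
under eq_fun do rewrite mxE.
by apply: integral_fin_sum => k; have [] := hY k j.
Qed.

Lemma mean0_mulr m n p (A : 'M[R]_(n, p)) (Y : T -> 'M[R]_(m, n)) :
  mean0 Y -> mean0 (fun w => Y w *m A).
Proof.
move=> [mY hY]; split=> [|i j].
  by apply: mxmeasM => //; exact: mxmeas_cst.
under eq_fun do (rewrite mxE; under eq_bigr do rewrite mulrC).
by apply: integral_fin_sum => k; have [] := hY i k.
Qed.

End expectation.

(** The integral is the difference of those of the positive and negative parts and is finite only if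
    both are, so the finite mean in [unbiased] already yields integrability. *)
Lemma unbiased_mean0 (R : realType) (dX : measure_display)
    (Xi : measurableType dX) (Q : probability Xi R) (m n p q : nat) (s : R)
    (g : 'M[R]_(m, n) -> Xi -> 'M[R]_(p, q)) h x :
  measurable_oracle g -> unbiased Q s g h ->
  mean0 Q (fun z => g x z - h x).
Proof.
move=> mg /(_ x)[gh _].
have mgx : mxmeas (g x) by exact: (mxmeas_oracle mg (mxmeas_cst x)).
split=> [|i j]; first by apply: mxmeasB => //; exact: mxmeas_cst.
have := gh i j; rewrite expectationE /ex => E.
have ig : Q.-integrable setT (fun z => (g x z i j)%:E).
  apply/integrableP; split; first exact/measurable_EFinP/mgx.
  by rewrite integral_fin_num_abs// E.
have ih : Q.-integrable setT (fun z => (- h x i j)%:E).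
  exact: finite_measure_integrable_cst.
split.
  under eq_fun do rewrite !mxE EFinB -EFinN; exact: integrableD.
under eq_integral do rewrite !mxE EFinB -EFinN.
by rewrite integralD// E -[X in (_ + X)%E]/(ex Q (fun=> - h x i j)) ex_cst -EFinD subrr.
Qed.

Lemma ex_sampled (R : realType) (dX dO : measure_display)
    (Xi : measurableType dX) (Omega : measurableType dO)
    (P : probability Omega R) (Q : probability Xi R) (Y : {RV P >-> Xi})
    (f : Xi -> R) : sampled_from Y Q -> measurable_fun setT f ->
  (forall z, 0 <= f z) -> ex P (fun w => f (Y w)) = ex Q f.
Proof.
move=> YQ mf f0; rewrite /ex.
rewrite -(@ge0_integral_distribution _ _ _ _ _ _ Y (EFin \o f)).
- by apply: eq_measure_integral => A mA _; exact: YQ.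
- exact/measurable_EFinP.
- by move=> z; rewrite lee_fin.
Qed.

Definition indep_family (dO : measure_display) (Omega : measurableType dO)
    (R : realType) (P : probability Omega R) (I : eqType)
    (G : I -> set (set Omega)) :=
  [/\ forall i, G i `<=` measurable, forall i, G i setT,
      forall i, setI_closed (G i) & mutually_independent P G].

(** Restricts the independence of all draws of a run to those of one time step, or of the
    initialisation, indexed by level and position in the batch. *)
Lemma indep_family_inj (dO : measure_display) (Omega : measurableType dO)
    (R : realType) (P : probability Omega R) (I J : eqType)
    (G : I -> set (set Omega)) (u : J -> I) : injective u ->
  indep_family P G -> indep_family P (fun j => G (u j)).
Proof.
move=> uI [Gm GT GI indG]; split=> // s E us GE.
(* Events are transported along [u] and completed by [setT] outside its range, so that independence
   over [I] applies to the list [map u s]. *)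
pose F i := if pselect (exists j, u j = i) is left e then E (projT1 (cid e)) else setT.
have FE j : F (u j) = E j.
  rewrite /F; case: pselect => [e|[]]; last by exists j.
  by case: cid => j' /= /uI ->.
have := indG (map u s) F; rewrite map_inj_uniq// us => /(_ isT).
rewrite big_map; under eq_bigr do rewrite FE.
move=> <-; last by move=> _ /mapP[j js ->]; rewrite FE; exact: GE.
congr (P _); apply/seteqP; split => w /= h.
  by move=> _ /= /mapP[j js ->]; rewrite FE; exact: h.
by move=> j /= js; rewrite -FE; apply: h => /=; apply: map_f.
Qed.

Section tower.
Context (dO : measure_display) (Omega : measurableType dO) (R : realType)
  (P : probability Omega R) (I : eqType) (G : I -> set (set Omega)).
Hypothesis famG : indep_family P G.

Lemma ge0_le_integralT (f g : Omega -> \bar R) :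
  (forall w, 0 <= f w)%E -> (forall w, f w <= g w)%E ->
  (\int[P]_w f w <= \int[P]_w g w)%E.
Proof.
move=> f0 fg; have g0 w : (0 <= g w)%E by exact: le_trans (fg w).
rewrite !ge0_integralTE//.
apply: ge_ereal_sup => _ [h /= hf <-]; apply: ereal_sup_ubound => /=.
by exists h => //= w; rewrite (le_trans (hf w)).
Qed.

(** The first argument of [g] is the past, the second the fresh draws; [h] bounds what would be the
    conditional expectation. *)
Lemma tower (A A' : set I) (g : Omega -> Omega -> R) (h : Omega -> R) :
  A `&` A' = set0 ->
  measurable_fun [set: (joinT G A * joinT G A')%type] (fun w => g w.1 w.2 : R) ->
  (forall w w', 0 <= g w w') -> (forall w, exle P (g w) (h w)) ->
  (ex P (fun w => g w w) <= ex P h)%E.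
Proof.
move=> AA' mg g0 gh; case: famG => Gm GT GI indG.
rewrite /ex (ge0_integral_decouple Gm GT GI indG AA' mg g0).
by apply: ge0_le_integralT => // w; apply: integral_ge0 => w' _; rewrite lee_fin.
Qed.

(** Jensen's inequality given the past: only the fresh draws are averaged under the root. The root
    of [h] can have a bounded mean where [h] has none, which is how products of two
    square-integrable quantities are treated. *)
Lemma tower_sqrt (A A' : set I) (g : Omega -> Omega -> R) (h : Omega -> R) :
  A `&` A' = set0 ->
  measurable_fun [set: (joinT G A * joinT G A')%type] (fun w => g w.1 w.2 : R) ->
  (forall w w', 0 <= g w w') -> (forall w, exle P (g w) (h w)) ->
  (ex P (fun w => Num.sqrt (g w w)) <= ex P (fun w => Num.sqrt (h w)))%E.
Proof.
move=> AA' mg g0 gh.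
apply: (@tower A A' (fun w w' => Num.sqrt (g w w'))) => //.
  exact: measurable_fun_sqrt.
move=> w; apply: exle_sqrt => //.
- by rewrite -lee_fin; apply: le_trans (gh w); exact: ex_ge0.
- case: famG => Gm _ _ _.
  exact: (@measurable_decouple _ _ _ _ _ Gm A A' g mg w).
Qed.

End tower.

Section batch.
Context (dO dX : measure_display) (Omega : measurableType dO)
  (Xi : measurableType dX) (R : realType) (P : probability Omega R)
  (z : nat -> nat -> {RV P >-> Xi}).

Definition sigma_sample (ij : nat * nat) := sigma_of (z ij.1 ij.2).

Hypothesis famz : indep_family P sigma_sample.

Lemma measurable_sample (A : set (nat * nat)) i j : A (i, j) ->
  measurable_fun [set: joinT sigma_sample A] (z i j).
Proof.
move=> Aij _ B mB; rewrite setTI; apply: sub_sigma_algebra.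
by apply: (@join_pi_sub _ _ _ _ (i, j)) => //; exists B => //; rewrite setTI.
Qed.

(** Variances of independent centred terms add: the last sample is fresh relative to the sum of the
    others, and [mean0_sqr] removes the cross term. *)
Lemma exle_batch_sum (Q : probability Xi R) k B m n (Y : nat -> Xi -> 'M[R]_(m, n))
    (V : nat -> R) c :
  (forall j, sampled_from (z k j) Q) ->
  (forall j, (j < B)%N -> mean0 Q (Y j)) ->
  (forall j, (j < B)%N -> exle Q (fun x => norm2 (Y j x) ^+ 2) (V j)) ->
  exle P (fun w => norm2 (c + \sum_(j < B) Y j (z k j w)) ^+ 2)
         (norm2 c ^+ 2 + \sum_(j < B) V j).
Proof.
move=> zQ; elim: B => [|B IH] Y0 YV.
  by rewrite big_ord0 addr0; apply: exle_cst => w; rewrite ?sqr_ge0// big_ord0 addr0.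
pose A : set (nat * nat) := [set p | p.1 = k /\ (p.2 < B)%N].
pose A' : set (nat * nat) := [set p | p = (k, B)].
have mYz A0 j : (j < B.+1)%N -> A0 (k, j) ->
    mxmeas (fun w : joinT sigma_sample A0 => Y j (z k j w)).
  by move=> jB Aj; apply: mxmeas_comp; [have [] := Y0 j jB|exact: measurable_sample].
pose S w := c + \sum_(j < B) Y j (z k j w).
have mS A0 : (forall j, (j < B)%N -> A0 (k, j)) ->
    mxmeas (S : joinT sigma_sample A0 -> _).
  move=> hA; apply: mxmeasD; first exact: mxmeas_cst.
  by apply: mxmeas_sum => j; apply: mYz => //; [exact/leqW/ltn_ord|exact: hA].
have VB : 0 <= V B.
  rewrite -lee_fin; apply: le_trans (YV B (ltnSn B)).
  by apply: ex_ge0 => w; exact: sqr_ge0.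
rewrite /exle (_ : (fun w => _) =
    fun w => norm2 (S w + Y B (z k B w)) ^+ 2); last first.
  by apply/funext => w; rewrite big_ord_recr/= addrA.
apply: (le_trans (@tower _ _ _ _ _ _ famz A A' (fun w w' => norm2 (S w + Y B (z k B w')) ^+ 2)
    (fun w => norm2 (S w) ^+ 2 + V B) _ _ _ _)).
- apply/seteqP; split => // -[i j] [] /= [_ jB] [_ jE].
  by rewrite jE ltnn in jB.
- apply: measurable_funX; apply: measurable_norm2; apply: mxmeasD.
    apply: (mxmeas_comp (mS A _)); last exact: measurable_fst.
    by move=> j jB; split.
  apply: (mxmeas_comp (f := fun w : joinT sigma_sample A' => Y B (z k B w))).
    exact: mYz.
  exact: measurable_snd.
- by move=> *; exact: sqr_ge0.
- move=> w; have := mean0_sqr (S w) (Y0 B (ltnSn B)) (YV B (ltnSn B)).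
  rewrite /exle -(ex_sampled (zQ B)) // => [|x]; last exact: sqr_ge0.
  have [mY _] := Y0 B (ltnSn B).
  apply: measurable_funX; apply: measurable_norm2; apply: mxmeasD.
    exact: mxmeas_cst.
  exact: mY.
rewrite big_ord_recr/= addrA; apply: exleD => //.
- apply: measurable_funX; apply: measurable_norm2.
  have [Gm _ _ _] := famz.
  move=> a b; apply: (@measurable_from_joinT _ _ _ _ Gm setT).
  exact: mS.
- by move=> w; exact: sqr_ge0.
- by apply: IH => j jB; [apply: Y0|apply: YV]; exact: leqW.
by apply: exle_cst.
Qed.

Definition mean (B : nat) (v : nat -> R) := B%:R^-1 * \sum_(j < B) v j.

(** The factor 1 / B is the gain from averaging; [mean B V] remains because the terms of a batch
    have different pasts, hence different variances. *)
Lemma exle_batch_mean (Q : probability Xi R) k B m n (Y : nat -> Xi -> 'M[R]_(m, n))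
    (V : nat -> R) c :
  (forall j, sampled_from (z k j) Q) ->
  (forall j, (j < B)%N -> mean0 Q (Y j)) ->
  (forall j, (j < B)%N -> exle Q (fun x => norm2 (Y j x) ^+ 2) (V j)) ->
  exle P (fun w => norm2 (c + batch_mean B (fun j => Y j (z k j w))) ^+ 2)
         (norm2 c ^+ 2 + B%:R^-1 * mean B V).
Proof.
move=> zQ Y0 YV; set b : R := B%:R^-1.
have b0 : 0 <= b by rewrite invr_ge0.
have := @exle_batch_sum Q k B m n (fun j x => b *: Y j x) (fun j => b ^+ 2 * V j) c.
rewrite /mean -big_distrr /= expr2 -mulrA; under [X in exle _ X _]eq_fun do rewrite -scaler_sumr.
apply=> // j jB; first exact/mean0Z/Y0.
under [X in exle _ X _]eq_fun do rewrite norm2Z exprMn ger0_norm//.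
apply: exleZ => //; rewrite ?sqr_ge0//.
- have [mY _] := Y0 j jB.
  by apply: measurable_funX; exact: measurable_norm2.
- by move=> x; exact: sqr_ge0.
- exact: YV.
Qed.

End batch.

(** * Stochastic oracles *)

Section oracle.
Context (R : realType) (dX : measure_display) (Xi : measurableType dX)
  (Q : probability Xi R) (l m n p : nat) (L : R)
  (A : 'M[R]_(l, m) -> Xi -> 'M[R]_(n, p)) (J : 'M[R]_(l, m) -> 'M[R]_(n, p)).
Hypothesis L1 : 1 <= L.
Hypothesis mA : measurable_oracle A.
Hypothesis uA : unbiased Q L A J.
Hypothesis sA : mean_square_lipschitz Q L A.
Hypothesis lJ : lipschitz2 L J.

Let L0 : 0 <= L. Proof. exact: le_trans L1. Qed.

Definition noise a x := A a x - J a.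

Lemma mxmeas_sample a : mxmeas (A a).
Proof. exact: (mxmeas_oracle mA (mxmeas_cst a)). Qed.

Lemma mxmeas_noise a : mxmeas (noise a).
Proof. by apply: mxmeasB; [exact: mxmeas_sample|exact: mxmeas_cst]. Qed.

Lemma noise_mean0 a : mean0 Q (noise a).
Proof. exact: unbiased_mean0 uA. Qed.

Lemma exle_noise a : exle Q (fun x => norm2 (noise a x) ^+ 2) (L ^+ 2).
Proof. by have [_] := uA a; rewrite expectationE. Qed.

Lemma exle_sampleB a a' :
  exle Q (fun x => norm2 (A a x - A a' x) ^+ 2) (L ^+ 2 * norm2 (a - a') ^+ 2).
Proof. by have := sA a a'; rewrite expectationE. Qed.

Lemma measurable_sqr_norm2 q r (F : Xi -> 'M[R]_(q, r)) : mxmeas F ->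
  measurable_fun setT (fun x => norm2 (F x) ^+ 2).
Proof. by move=> mF; apply: measurable_funX; exact: measurable_norm2. Qed.

Lemma sqr_lipschitz a a' :
  norm2 (J a - J a') ^+ 2 <= L ^+ 2 * norm2 (a - a') ^+ 2.
Proof.
by rewrite -exprMn ler_sqr ?nnegrE ?mulr_ge0 ?norm2_ge0// lJ.
Qed.

Lemma exle_noiseB a a' : exle Q (fun x => norm2 (noise a x - noise a' x) ^+ 2)
  (4 * L ^+ 2 * norm2 (a - a') ^+ 2).
Proof.
have -> : 4 * L ^+ 2 * norm2 (a - a') ^+ 2 =
    2 * (L ^+ 2 * norm2 (a - a') ^+ 2) + 2 * (L ^+ 2 * norm2 (a - a') ^+ 2) by ring.
apply: (@exle_lin1 _ _ _ _ _ (fun x => norm2 (A a x - A a' x) ^+ 2)) => //.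
- by move=> x; exact: sqr_ge0.
- by rewrite mulr_ge0// mulr_ge0 ?sqr_ge0.
- move=> x; rewrite (_ : _ - _ = A a x - A a' x + (J a' - J a)); last first.
    by rewrite /noise opprB (addrC (J a')) addrACA (addrC (- J a)).
  rewrite (le_trans (sqr_norm2D_le _ _))// mulrDr lerD2l ler_wpM2l//.
  by rewrite norm2B sqr_lipschitz.
- by apply: measurable_sqr_norm2; apply: mxmeasB; exact: mxmeas_sample.
- by move=> x; exact: sqr_ge0.
exact: exle_sampleB.
Qed.

(** By [opbound_sample], [L + norm2 (noise a x)] bounds the operator norm of a sampled Jacobian. Its
    second moment splits into 2 L^2 + 2 L^2, whatever the dimension. *)
Lemma exle_opbound_noise a :
  exle Q (fun x => (L + norm2 (noise a x)) ^+ 2) (4 * L ^+ 2).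
Proof.
have -> : 4 * L ^+ 2 = 2 * L ^+ 2 + 2 * L ^+ 2 by ring.
apply: (@exle_lin1 _ _ _ _ _ (fun x => norm2 (noise a x) ^+ 2)) => //.
- by move=> x; exact: sqr_ge0.
- by rewrite mulr_ge0// sqr_ge0.
- by move=> x; have := sqr_ge0 (L - norm2 (noise a x)); nra.
- exact/measurable_sqr_norm2/mxmeas_noise.
- by move=> x; exact: sqr_ge0.
exact: exle_noise.
Qed.

Lemma opbound_sample a x : opbound (J a) L -> opbound (A a x) (L + norm2 (noise a x)).
Proof.
move=> JL; rewrite -[A a x](subrK (J a)) addrC.
by apply: opboundD => //; exact: opbound_norm2.
Qed.

(** [U] and [U'] stand for the sampled products of the lower levels at two sequences of points. The
    change of the prefix and the change of the last factor are separated. *)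
Lemma exle_mul_sampleB q (U U' : 'M[R]_(q, n)) u' a a' :
  opbound (J a) L -> opbound U' u' ->
  exle Q (fun x => norm2 (U *m A a x - U' *m A a' x) ^+ 2)
    (8 * L ^+ 2 * norm2 (U - U') ^+ 2 +
     2 * L ^+ 2 * (u' ^+ 2 * norm2 (a - a') ^+ 2)).
Proof.
move=> JL Uu; have [u0 _] := Uu.
have -> : 8 * L ^+ 2 * norm2 (U - U') ^+ 2 +
     2 * L ^+ 2 * (u' ^+ 2 * norm2 (a - a') ^+ 2) =
   (2 * norm2 (U - U') ^+ 2) * (4 * L ^+ 2) +
   (2 * u' ^+ 2) * (L ^+ 2 * norm2 (a - a') ^+ 2) + 0 by ring.
apply: (@exle_lin2 _ _ _ _ _ (fun x => (L + norm2 (noise a x)) ^+ 2)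
  (fun x => norm2 (A a x - A a' x) ^+ 2)) => //.
- by move=> x; exact: sqr_ge0.
- by rewrite mulr_ge0// sqr_ge0.
- by rewrite mulr_ge0// sqr_ge0.
- move=> x; have -> : U *m A a x - U' *m A a' x =
      (U - U') *m A a x + U' *m (A a x - A a' x).
    by rewrite mulmxBl mulmxBr addrA subrK.
  have h1 : norm2 ((U - U') *m A a x) ^+ 2 <=
      norm2 (U - U') ^+ 2 * (L + norm2 (noise a x)) ^+ 2.
    rewrite -exprMn ler_sqr ?nnegrE ?norm2_ge0 ?mulr_ge0 ?addr_ge0 ?norm2_ge0//.
    by rewrite mulrC; apply: opbound_mull; exact: opbound_sample.
  have h2 : norm2 (U' *m (A a x - A a' x)) ^+ 2 <= u' ^+ 2 * norm2 (A a x - A a' x) ^+ 2.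
    rewrite -exprMn ler_sqr ?nnegrE ?norm2_ge0 ?mulr_ge0 ?norm2_ge0//.
    exact: opbound_mulr.
  by rewrite addr0 (le_trans (sqr_norm2D_le _ _))//; lra.
- by apply: measurable_funX; apply: measurable_funD => //;
    exact/measurable_norm2/mxmeas_noise.
- by apply: measurable_sqr_norm2; apply: mxmeasB; exact: mxmeas_sample.
- by move=> x; exact: sqr_ge0.
- by move=> x; exact: sqr_ge0.
- exact: exle_opbound_noise.
exact: exle_sampleB.
Qed.

Lemma exle_mul_noiseB q (U U' : 'M[R]_(q, n)) u' a a' : opbound U' u' ->
  exle Q (fun x => norm2 (U *m noise a x - U' *m noise a' x) ^+ 2)
    (2 * L ^+ 2 * norm2 (U - U') ^+ 2 +
     8 * L ^+ 2 * (u' ^+ 2 * norm2 (a - a') ^+ 2)).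
Proof.
move=> Uu; have [u0 _] := Uu.
have -> : 2 * L ^+ 2 * norm2 (U - U') ^+ 2 +
     8 * L ^+ 2 * (u' ^+ 2 * norm2 (a - a') ^+ 2) =
   (2 * norm2 (U - U') ^+ 2) * (L ^+ 2) +
   (2 * u' ^+ 2) * (4 * L ^+ 2 * norm2 (a - a') ^+ 2) + 0 by ring.
apply: (@exle_lin2 _ _ _ _ _ (fun x => norm2 (noise a x) ^+ 2)
  (fun x => norm2 (noise a x - noise a' x) ^+ 2)) => //.
- by move=> x; exact: sqr_ge0.
- by rewrite mulr_ge0// sqr_ge0.
- by rewrite mulr_ge0// sqr_ge0.
- move=> x; have -> : U *m noise a x - U' *m noise a' x =
      (U - U') *m noise a x + U' *m (noise a x - noise a' x).
    by rewrite mulmxBl (mulmxBr U' (noise a x) (noise a' x)) addrA subrK.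
  have h1 : norm2 ((U - U') *m noise a x) ^+ 2 <=
      norm2 (U - U') ^+ 2 * norm2 (noise a x) ^+ 2.
    rewrite -exprMn ler_sqr ?nnegrE ?norm2_ge0 ?mulr_ge0 ?norm2_ge0//.
    by rewrite mulrC; apply: opbound_mull; exact: opbound_norm2.
  have h2 : norm2 (U' *m (noise a x - noise a' x)) ^+ 2 <=
      u' ^+ 2 * norm2 (noise a x - noise a' x) ^+ 2.
    rewrite -exprMn ler_sqr ?nnegrE ?norm2_ge0 ?mulr_ge0 ?norm2_ge0//.
    exact: opbound_mulr.
  by rewrite addr0 (le_trans (sqr_norm2D_le _ _))//; lra.
- exact/measurable_sqr_norm2/mxmeas_noise.
- by apply: measurable_sqr_norm2; apply: mxmeasB; exact: mxmeas_noise.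
- by move=> x; exact: sqr_ge0.
- by move=> x; exact: sqr_ge0.
- exact: exle_noise.
exact: exle_noiseB.
Qed.

Lemma exle_mul_noise q (U : 'M[R]_(q, n)) u a : opbound U u ->
  exle Q (fun x => norm2 (U *m noise a x) ^+ 2) (L ^+ 2 * u ^+ 2).
Proof.
move=> Uu; have [u0 _] := Uu.
rewrite mulrC -[X in exle _ _ X]addr0.
apply: (@exle_lin1 _ _ _ _ _ (fun x => norm2 (noise a x) ^+ 2)) => //.
- by move=> x; exact: sqr_ge0.
- exact: sqr_ge0.
- move=> x; rewrite addr0 -exprMn.
  rewrite ler_sqr ?nnegrE ?norm2_ge0 ?mulr_ge0 ?norm2_ge0//.
  exact: opbound_mulr.
- exact/measurable_sqr_norm2/mxmeas_noise.
- by move=> x; exact: sqr_ge0.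
exact: exle_noise.
Qed.

(** One noisy level of a product under momentum, with true suffixes [M] and [M']. The difference
    consists of a change of prefix and noise, a change of suffix, and a fraction [alpha] of the old
    noise; each part is small although the noise is not. *)
Lemma exle_mul_noise_mul q r (U U' : 'M[R]_(q, n)) u' a a' (M M' : 'M[R]_(p, r))
    mu alpha : opbound U' u' -> opbound M mu -> opbound M' mu ->
  exle Q (fun x => norm2 (U *m noise a x *m M
                          - (1 - alpha) *: (U' *m noise a' x *m M')) ^+ 2)
    (3 * mu ^+ 2 * (2 * L ^+ 2 * norm2 (U - U') ^+ 2 +
                    8 * L ^+ 2 * (u' ^+ 2 * norm2 (a - a') ^+ 2)) +
     3 * (norm2 (M - M') ^+ 2 + alpha ^+ 2 * mu ^+ 2) * (L ^+ 2 * u' ^+ 2)).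
Proof.
move=> Uu Mm Mm'; have [u0 _] := Uu; have [mu0 _] := Mm.
rewrite -[X in exle _ _ X]addr0.
apply: (@exle_lin2 _ _ _ _ _
  (fun x => norm2 (U *m noise a x - U' *m noise a' x) ^+ 2)
  (fun x => norm2 (U' *m noise a' x) ^+ 2)) => //.
- by move=> x; exact: sqr_ge0.
- by rewrite mulr_ge0// sqr_ge0.
- by rewrite mulr_ge0// addr_ge0 ?sqr_ge0// mulr_ge0 ?sqr_ge0.
- move=> x; have -> : U *m noise a x *m M - (1 - alpha) *: (U' *m noise a' x *m M') =
      (U *m noise a x - U' *m noise a' x) *m M + U' *m noise a' x *m (M - M') +
      alpha *: (U' *m noise a' x *m M').
    rewrite mulmxBl (mulmxBr _ M M') scalerBl scale1r !opprB.
    by rewrite (addrA (_ *m M - _)) subrK -addrA (addrC (- (_ *m M'))).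
  rewrite addr0 (le_trans (sqr_norm2D3_le _ _ _))//.
  set N := norm2 (U' *m noise a' x).
  have N0 : 0 <= N by exact: norm2_ge0.
  have h1 : norm2 ((U *m noise a x - U' *m noise a' x) *m M) ^+ 2 <=
      mu ^+ 2 * norm2 (U *m noise a x - U' *m noise a' x) ^+ 2.
    rewrite -exprMn ler_sqr ?nnegrE ?norm2_ge0 ?mulr_ge0 ?norm2_ge0//.
    exact: opbound_mull.
  have h2 : norm2 (U' *m noise a' x *m (M - M')) ^+ 2 <= norm2 (M - M') ^+ 2 * N ^+ 2.
    rewrite -exprMn ler_sqr ?nnegrE ?norm2_ge0 ?mulr_ge0 ?norm2_ge0//.
    exact/opbound_mull/opbound_norm2.
  have h3 : norm2 (alpha *: (U' *m noise a' x *m M')) ^+ 2 <= alpha ^+ 2 * mu ^+ 2 * N ^+ 2.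
    rewrite norm2Z exprMn real_normK ?num_real// -mulrA ler_wpM2l ?sqr_ge0//.
    rewrite -exprMn ler_sqr ?nnegrE ?norm2_ge0 ?mulr_ge0 ?norm2_ge0//.
    exact: opbound_mull.
  by nra.
- apply: measurable_sqr_norm2; apply: mxmeasB; apply: mxmeasM;
  by [exact: mxmeas_cst|exact: mxmeas_noise].
- by apply: measurable_sqr_norm2; apply: mxmeasM; [exact: mxmeas_cst|exact: mxmeas_noise].
- by move=> x; exact: sqr_ge0.
- by move=> x; exact: sqr_ge0.
- exact: exle_mul_noiseB.
exact: exle_mul_noise.
Qed.

(** Both noises come from the same sample and nearly cancel: there remain a fraction [alpha] of one
    noise and a difference controlled by the distance of the points. This is the gain of the
    momentum estimator. *)
Lemma exle_momentum_noise a a' alpha :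
  exle Q (fun x => norm2 (noise a x - (1 - alpha) *: noise a' x) ^+ 2)
    (8 * L ^+ 2 * (alpha ^+ 2 + norm2 (a - a') ^+ 2)).
Proof.
apply: (@exleW _ _ _ _ _ (2 * (4 * L ^+ 2 * norm2 (a - a') ^+ 2)
    + (2 * alpha ^+ 2) * L ^+ 2 + 0)).
  have := mulr_ge0 (sqr_ge0 L) (sqr_ge0 alpha); nra.
apply: (@exle_lin2 _ _ _ _ _ (fun x => norm2 (noise a x - noise a' x) ^+ 2)
  (fun x => norm2 (noise a' x) ^+ 2)) => //.
- by move=> x; exact: sqr_ge0.
- by rewrite mulr_ge0// sqr_ge0.
- move=> x; rewrite addr0.
  have -> : noise a x - (1 - alpha) *: noise a' x =
      (noise a x - noise a' x) + alpha *: noise a' x.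
    by rewrite scalerBl scale1r opprB addrCA addrC -addrA (addrC (- _)).
  rewrite (le_trans (sqr_norm2D_le _ _))// norm2Z exprMn real_normK ?num_real//.
  by lra.
- by apply: measurable_sqr_norm2; apply: mxmeasB; exact: mxmeas_noise.
- exact/measurable_sqr_norm2/mxmeas_noise.
- by move=> x; exact: sqr_ge0.
- by move=> x; exact: sqr_ge0.
- exact: exle_noiseB.
exact: exle_noise.
Qed.

End oracle.

(** A directional derivative is a limit of difference quotients, each of norm at most L |v|. *)
Lemma lipschitz2_opbound (R : realType) (m n : nat) (L : R)
    (f : 'rV[R]_m.+1 -> 'rV[R]_n.+1) x :
  0 <= L -> lipschitz2 L f -> differentiable f x -> opbound ('J f x) L.
Proof.
move=> L0 Lf df; split=> // v; rewrite -deriveEjacobian//.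
have /cvg_ball dq := @diff_derivable _ _ _ f x v df.
apply/ler_addgt0Pr => e e0.
(* The quotients converge in the max norm; this factor pays for the passage to [norm2]. *)
have c0 : 0 < (1 * n.+1).+1%:R :> R by [].
have e'0 : 0 < e / (1 * n.+1).+1%:R by rewrite divr_gt0.
have [h [h0 [_ hq]]] : exists h : R, h != 0 /\
    ball ('D_v f x) (e / (1 * n.+1).+1%:R) (h^-1 *: ((f \o shift x) (h *: v) - f x)).
  apply: (@filter_ex _ (0^') _); near=> h; split.
    by near: h; exact: nbhs_dnbhs_neq.
  by near: h; exact: dq.
set q := h^-1 *: _ in hq.
rewrite -(subrK q ('D_v f x)) addrC (le_trans (norm2D _ _))// lerD//.
  rewrite /q norm2Z normfV ler_pdivrMl ?normr_gt0// (le_trans (Lf _ _))//=.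
  by rewrite addrK norm2Z mulrCA.
apply: (@le_trans _ _ ((1 * n.+1).+1%:R * (e / (1 * n.+1).+1%:R))).
  apply: norm2_le_entries => [|i j]; first exact: ltW.
  by have := hq i j; rewrite /ball /= !mxE => /ltW.
by rewrite mulrCA mulfV ?mulr1// gt_eqF.
Unshelve. all: by end_near. Qed.

Lemma measurable_joinT_sub (Omega : pointedType) (I : eqType)
    (G : I -> set (set Omega)) (A A' : set I) d (S : measurableType d)
    (F : Omega -> S) : A `<=` A' ->
  measurable_fun [set: joinT G A] F -> measurable_fun [set: joinT G A'] F.
Proof.
move=> AA' mF _ B mB.
have := mF measurableT B mB; rewrite !setTI; apply: smallest_sub.
  exact: smallest_sigma_algebra.
move=> X [J [E [uJ JA GE ->]]]; apply: sub_sigma_algebra; exists J, E; split => //.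
by move=> k kJ; exact/AA'/JA.
Qed.

(** * Levels as time: the filtration within one update *)

Section levels.
Context (R : realType) (K : nat) (L : R) (d : nat -> nat)
  (f : forall i, 'rV[R]_(d i).+1 -> 'rV[R]_(d i.+1).+1)
  (dX : measure_display) (Xi : measurableType dX) (Q : nat -> probability Xi R)
  (fo : forall i, 'rV[R]_(d i).+1 -> Xi -> 'rV[R]_(d i.+1).+1)
  (Jo : forall i, 'rV[R]_(d i).+1 -> Xi -> 'M[R]_((d i).+1, (d i.+1).+1)).

Record regular_problem : Prop := RegularProblem {
  const_ge1 : 1 <= L;
  levels_smooth : smooth_levels K L L f;
  levels_measurable : forall i, (i < K)%N ->
    measurable_oracle (@fo i) /\ measurable_oracle (@Jo i);
  levels_unbiased : forall i, (i < K)%N ->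
    unbiased (Q i) L (@fo i) (@f i) /\
    unbiased (Q i) L (@Jo i) (fun x => 'J (@f i) x);
  levels_mean_square : forall i, (i < K)%N ->
    mean_square_lipschitz (Q i) L (@fo i) /\
    mean_square_lipschitz (Q i) L (@Jo i) }.

Hypothesis reg : regular_problem.

Let L1 : 1 <= L := const_ge1 reg.
Let L0 : 0 <= L. Proof. exact: le_trans L1. Qed.

Definition jnoise i := noise (@Jo i) (fun x => 'J (@f i) x).

Lemma opbound_J i x : (i < K)%N -> opbound ('J (@f i) x) L.
Proof.
by move=> iK; have [h1 h2 _] := levels_smooth reg iK; exact: lipschitz2_opbound.
Qed.

Context (dO : measure_display) (Omega : measurableType dO)
  (P : probability Omega R) (z : nat -> nat -> {RV P >-> Xi}) (B : nat).
Hypothesis famz : indep_family P (sigma_sample z).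
Hypothesis zQ : forall i j, (i < K)%N -> sampled_from (z i j) (Q i).
Hypothesis B_gt0 : (0 < B)%N.

(** Within one update the level acts as time: the estimate at level k is a function of samples of
    levels below k, hence independent of those of level k. *)
Definition lower k : set (nat * nat) := [set p | (p.1 < k)%N].
Definition history k := joinT (sigma_sample z) (lower k).
Definition fresh k := joinT (sigma_sample z) [set p | p.1 = k].

Definition adapted (a : forall i, Omega -> 'rV[R]_(d i).+1) :=
  forall k, (k <= K)%N -> mxmeas (a k : history k -> _).

Lemma measurable_historyS d' (S : measurableType d') k (F : Omega -> S) :
  measurable_fun [set: history k] F -> measurable_fun [set: history k.+1] F.
Proof. by apply: measurable_joinT_sub => -[i j] /= h; exact: leqW. Qed.

Lemma mxmeas_historyS k m n (F : Omega -> 'M[R]_(m, n)) :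
  mxmeas (F : history k -> _) -> mxmeas (F : history k.+1 -> _).
Proof. by move=> mF i j; exact: measurable_historyS. Qed.

Lemma mxmeas_history k m n (F : Omega -> 'M[R]_(m, n)) :
  mxmeas (F : history k -> _) -> mxmeas F.
Proof.
by have [Gm _ _ _] := famz; move=> mF i j; apply: (measurable_from_joinT Gm (mF i j)).
Qed.

Lemma measurable_history d' (S : measurableType d') k (F : Omega -> S) :
  measurable_fun [set: history k] F -> measurable_fun [set: Omega] F.
Proof.
by have [Gm _ _ _] := famz; move=> mF; exact: (measurable_from_joinT Gm mF).
Qed.

Lemma measurable_sample_history i j k : (i < k)%N ->
  measurable_fun [set: history k] (z i j).
Proof. by move=> ik; exact: measurable_sample. Qed.

Lemma measurable_sample_fresh j k : measurable_fun [set: fresh k] (z k j).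
Proof. exact: measurable_sample. Qed.

Lemma disjoint_fresh k : lower k `&` [set p | p.1 = k] = set0.
Proof.
by apply/seteqP; split => // -[i j] [] /= ik kE; move: ik; rewrite /lower /= kE ltnn.
Qed.

Section level_step.
Context (k : nat) (kK : (k < K)%N) (m n : nat)
  (c : Omega -> 'M[R]_(m, n)) (Y : nat -> Omega -> Xi -> 'M[R]_(m, n))
  (V : Omega -> nat -> R).
Hypothesis mc : mxmeas (c : history k -> _).
Hypothesis mY : forall j, (j < B)%N ->
  mxmeas (fun v : (history k * Xi)%type => Y j v.1 v.2).
Hypothesis Y0 : forall w j, (j < B)%N -> mean0 (Q k) (Y j w).
Hypothesis YV : forall w j, (j < B)%N ->
  exle (Q k) (fun x => norm2 (Y j w x) ^+ 2) (V w j).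

Let g w w' := norm2 (c w + batch_mean B (fun j => Y j w (z k j w'))) ^+ 2.

Let mg : measurable_fun [set: (history k * fresh k)%type]
  (fun v => g v.1 v.2 : R).
Proof.
apply: measurable_funX; apply: measurable_norm2; apply: mxmeasD.
  by apply: (mxmeas_comp mc); exact: measurable_fst.
apply: (@mxmeas_batch_mean _ _ _ _ _ B
  (fun j (v : (history k * fresh k)%type) => Y j v.1 (z k j v.2))) => j jB.
apply: (mxmeas_comp (mY jB)
  (g := fun v : (history k * fresh k)%type => (v.1, z k j v.2))).
apply: measurable_fun_pair; first exact: measurable_fst.
exact: (measurableT_comp (@measurable_sample_fresh j k)
  (@measurable_snd _ _ (history k) (fresh k))).
Qed.

Let gle w : exle P (g w) (norm2 (c w) ^+ 2 + B%:R^-1 * mean B (V w)).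
Proof.
exact: (exle_batch_mean famz (Y := fun j => Y j w) (c w)
  (fun j => zQ j kK) (Y0 w) (YV w)).
Qed.

(** Given the lower levels the batch noise is centred, so its variance adds to the square of [c];
    the variance [V] of a sample may depend on the past. *)
Lemma level_sqr : (ex P (fun w => norm2 (c w + batch_mean B (fun j => Y j w (z k j w))) ^+ 2)%R
  <= ex P (fun w => norm2 (c w) ^+ 2 + B%:R^-1 * mean B (V w))%R)%E.
Proof.
apply: (tower famz (disjoint_fresh k) (g := g)) => //.
by move=> w w'; exact: sqr_ge0.
Qed.

Lemma level_norm : (ex P (fun w => norm2 (c w + batch_mean B (fun j => Y j w (z k j w))))%R
  <= ex P (fun w => Num.sqrt (norm2 (c w) ^+ 2 + B%:R^-1 * mean B (V w)))%R)%E.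
Proof.
have -> : (fun w => norm2 (c w + batch_mean B (fun j => Y j w (z k j w)))) =
    fun w => Num.sqrt (g w w).
  by apply/funext => w; rewrite sqrtr_sqr ger0_norm// norm2_ge0.
apply: (tower_sqrt famz (disjoint_fresh k) (g := g)) => //.
by move=> w w'; exact: sqr_ge0.
Qed.

End level_step.

Section level_mean.
Context (k : nat) (kK : (k < K)%N) (X : nat -> Omega -> Xi -> R) (V : Omega -> nat -> R).
Hypothesis mX : forall j, (j < B)%N ->
  measurable_fun setT (fun v : (history k * Xi)%type => X j v.1 v.2 : R).
Hypothesis X0 : forall w j x, 0 <= X j w x.
Hypothesis XV : forall w j, (j < B)%N -> exle (Q k) (X j w) (V w j).

Let g w w' := mean B (fun j => X j w (z k j w')).

Let g0 w w' : 0 <= g w w'.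
Proof. by rewrite mulr_ge0 ?invr_ge0// sumr_ge0. Qed.

Let mg : measurable_fun [set: (history k * fresh k)%type] (fun v => g v.1 v.2 : R).
Proof.
apply: measurable_funM => //; apply: measurable_sum => j.
apply: (measurableT_comp (mX (ltn_ord j))
  (g := fun v : (history k * fresh k)%type => (v.1, z k j v.2))).
apply: measurable_fun_pair; first exact: measurable_fst.
exact: (measurableT_comp (@measurable_sample_fresh j k)
  (@measurable_snd _ _ (history k) (fresh k))).
Qed.

Let gle w : exle P (g w) (mean B (V w)).
Proof.
have mXw j : (j < B)%N -> measurable_fun setT (X j w).
  by move=> jB; exact: (measurableT_comp (mX jB) (@pair1_measurable _ _ (history k) _ w)).
apply: exleZ; rewrite ?invr_ge0//.
- apply: measurable_sum => j; apply: measurableT_comp => //; exact: mXw.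
- by move=> w'; apply: sumr_ge0.
apply: (@exle_sum _ _ _ _ _ (fun j w' => X j w (z k j w')) (V w)) => //.
- by move=> j jB; apply: measurableT_comp => //; exact: mXw.
- move=> j jB; rewrite /exle (ex_sampled (zQ _ kK)) //; [exact: XV|exact: mXw].
Qed.

Lemma level_mean : (ex P (fun w => mean B (fun j => X j w (z k j w)))
  <= ex P (fun w => mean B (V w)))%E.
Proof. exact: (tower famz (disjoint_fresh k) (g := g)). Qed.

Lemma level_mean_sqrt : (ex P (fun w => Num.sqrt (mean B (fun j => X j w (z k j w))))
  <= ex P (fun w => Num.sqrt (mean B (V w))))%E.
Proof. exact: (tower_sqrt famz (disjoint_fresh k) (g := g)). Qed.

End level_mean.

End levels.

(** * Products of sampled Jacobians *)

Section jacobian_products.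
Context (R : realType) (K : nat) (L : R) (d : nat -> nat)
  (f : forall i, 'rV[R]_(d i).+1 -> 'rV[R]_(d i.+1).+1)
  (dX : measure_display) (Xi : measurableType dX) (Q : nat -> probability Xi R)
  (fo : forall i, 'rV[R]_(d i).+1 -> Xi -> 'rV[R]_(d i.+1).+1)
  (Jo : forall i, 'rV[R]_(d i).+1 -> Xi -> 'M[R]_((d i).+1, (d i.+1).+1)).
Hypothesis reg : regular_problem K L f Q fo Jo.
Context (dO : measure_display) (Omega : measurableType dO)
  (P : probability Omega R) (z : nat -> nat -> {RV P >-> Xi}) (B : nat).
Hypothesis famz : indep_family P (sigma_sample z).
Hypothesis zQ : forall i j, (i < K)%N -> sampled_from (z i j) (Q i).
Hypothesis B_gt0 : (0 < B)%N.

Let L1 : 1 <= L := const_ge1 reg.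
Let L0 : 0 <= L. Proof. exact: le_trans L1. Qed.

Notation process := (forall i, Omega -> 'rV[R]_(d i).+1).
Notation adapted := (adapted K z).
Notation history := (history z).
Notation jnoise := (jnoise f Jo).

Definition jac_sample (a : process) k j w :=
  jprod (fun i => @Jo i (a i w) (z i j w)) k.
Definition jac_true (a : process) k w := jprod (fun i => 'J (@f i) (a i w)) k.
(** Bounds the operator norm of the sampled product. At random points the factors are dependent, but
    each has second moment at most 4 L^2 given the lower levels, so the square is integrated from
    the last level down. *)
Definition op_sample (a : process) k j w :=
  \prod_(i < k) (L + norm2 (jnoise (a i w) (z i j w))).
Definition jac_error (a : process) k w :=
  batch_mean B (fun j => jac_sample a k j w) - jac_true a k w.
Definition op_sample2 (a : process) k w := mean B (fun j => op_sample a k j w ^+ 2).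

Lemma mxmeas_adapted_J (a : process) k : (k < K)%N -> adapted a ->
  mxmeas ((fun w => 'J (@f k) (a k w)) : history k -> _).
Proof.
move=> kK aa; have [_ _ lJ] := levels_smooth reg kK.
by apply: (mxmeas_lipschitz lJ); (apply: aa; exact: ltnW).
Qed.

Lemma mxmeas_jac_sample (a : process) k j : (k <= K)%N -> adapted a ->
  mxmeas (jac_sample a k j : history k -> _).
Proof.
move=> + aa; elim: k => [|k IH] kK; first exact: mxmeas_cst.
apply: mxmeasM; first (apply: mxmeas_historyS; apply: IH; exact: ltnW).
apply: mxmeas_oracle; first by have [] := levels_measurable reg kK.
  (apply: mxmeas_historyS; apply: aa; exact: ltnW).
exact: measurable_sample_history.
Qed.

Lemma mxmeas_jac_true (a : process) k : (k <= K)%N -> adapted a ->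
  mxmeas (jac_true a k : history k -> _).
Proof.
move=> + aa; elim: k => [|k IH] kK; first exact: mxmeas_cst.
apply: mxmeasM; first (apply: mxmeas_historyS; apply: IH; exact: ltnW).
(apply: mxmeas_historyS; exact: mxmeas_adapted_J).
Qed.

Lemma mxmeas_jac_error (a : process) k : (k <= K)%N -> adapted a ->
  mxmeas (jac_error a k : history k -> _).
Proof.
move=> kK aa; apply: mxmeasB; last exact: mxmeas_jac_true.
by apply: mxmeas_batch_mean => j _; exact: mxmeas_jac_sample.
Qed.

Lemma measurable_op_sample (a : process) k j : (k <= K)%N -> adapted a ->
  measurable_fun [set: history k] (op_sample a k j).
Proof.
move=> + aa; elim: k => [|k IH] kK.
  by rewrite /op_sample; under eq_fun do rewrite big_ord0; exact: measurable_cst.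
rewrite /op_sample; under eq_fun do rewrite big_ord_recr /=.
apply: measurable_funM; first (apply: measurable_historyS; apply: IH; exact: ltnW).
apply: measurable_funD => //; apply: measurable_norm2; apply: mxmeasB.
  apply: mxmeas_oracle; first by have [] := levels_measurable reg kK.
    (apply: mxmeas_historyS; apply: aa; exact: ltnW).
  exact: measurable_sample_history.
(apply: mxmeas_historyS; exact: mxmeas_adapted_J).
Qed.

Lemma measurable_op_sample2 (a : process) k : (k <= K)%N -> adapted a ->
  measurable_fun [set: history k] (op_sample2 a k).
Proof.
move=> kK aa; apply: measurable_funM => //; apply: measurable_sum => j.
by apply: measurable_funX; exact: measurable_op_sample.
Qed.

Lemma mean_ge0 (v : nat -> R) : (forall j, (j < B)%N -> 0 <= v j) -> 0 <= mean B v.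
Proof. by move=> v0; rewrite mulr_ge0 ?invr_ge0// sumr_ge0// => j _; exact: v0. Qed.

Lemma op_sample2_ge0 (a : process) k w : 0 <= op_sample2 a k w.
Proof. by apply: mean_ge0 => j _; exact: sqr_ge0. Qed.

Lemma opbound_jac_sample (a : process) k j w : (k <= K)%N ->
  opbound (jac_sample a k j w) (op_sample a k j w).
Proof.
elim: k => [_|k IH kK]; first by rewrite /op_sample big_ord0; exact: opbound1.
rewrite /op_sample big_ord_recr /=; apply: opboundM; first (apply: IH; exact: ltnW).
by apply: opbound_sample; exact: (opbound_J reg).
Qed.

Lemma meanZ c (v : nat -> R) : mean B (fun j => c * v j) = c * mean B v.
Proof. by rewrite /mean -big_distrr /= mulrCA. Qed.

Lemma meanD (u v : nat -> R) : mean B (fun j => u j + v j) = mean B u + mean B v.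
Proof. by rewrite /mean big_split /= mulrDr. Qed.

Lemma mean_cst (c : R) : mean B (fun=> c) = c.
Proof.
by rewrite /mean sumr_const card_ord -(mulr_natl c) mulKf// pnatr_eq0 -lt0n.
Qed.

Lemma meanZr c (v : nat -> R) : mean B (fun j => v j * c) = mean B v * c.
Proof. by rewrite /mean -big_distrl /= mulrA. Qed.

Lemma exle_op_sample2 (a : process) k : (k <= K)%N -> adapted a ->
  exle P (op_sample2 a k) ((4 * L ^+ 2) ^+ k).
Proof.
move=> + aa; elim: k => [_|k IH kK].
  apply: exle_cst => w; first exact: op_sample2_ge0.
  rewrite /op_sample2 /op_sample expr0 /mean.
  under eq_bigr do rewrite big_ord0 expr1n.
  by rewrite sumr_const card_ord mulVf// pnatr_eq0 -lt0n.
have c0 : 0 <= 4 * L ^+ 2 by rewrite mulr_ge0// sqr_ge0.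
have mJk := (levels_measurable reg kK).2.
pose X j w x := op_sample a k j w ^+ 2 * (L + norm2 (jnoise (a k w) x)) ^+ 2.
have -> : op_sample2 a k.+1 = fun w => mean B (fun j => X j w (z k j w)).
  apply/funext => w; rewrite /op_sample2; congr (_ * _); apply: eq_bigr => j _.
  by rewrite /op_sample big_ord_recr /= exprMn.
pose V w j := op_sample a k j w ^+ 2 * (4 * L ^+ 2).
apply: le_trans (@level_mean _ _ _ _ _ _ _ _ _ _ famz zQ k kK X V _ _ _) _.
- move=> j _; apply: measurable_funM; apply: measurable_funX.
    apply: (measurableT_comp (@measurable_op_sample a k j (ltnW kK) aa)).
    exact: measurable_fst.
  apply: measurable_funD => //; apply: measurable_norm2; apply: mxmeasB.
    apply: (mxmeas_oracle mJk); last exact: measurable_snd.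
    by apply: (mxmeas_comp (aa k (ltnW kK))); exact: measurable_fst.
  by apply: (mxmeas_comp (mxmeas_adapted_J kK aa)); exact: measurable_fst.
- by move=> w j x; rewrite mulr_ge0 ?sqr_ge0.
- move=> w j _; have [ub ubJ] := levels_unbiased reg kK.
  apply: exleZ; rewrite ?sqr_ge0//; last exact: (exle_opbound_noise mJk ubJ).
    apply: measurable_funX; apply: measurable_funD => //; apply: measurable_norm2.
    exact: mxmeas_noise.
  by move=> x; exact: sqr_ge0.
have -> : (fun w => mean B (V w)) = fun w => (4 * L ^+ 2) * op_sample2 a k w.
  by apply/funext => w; rewrite /V meanZr mulrC.
rewrite (exprS _ k); apply: exleZ => //; last (apply: IH; exact: ltnW).
- (apply: (measurable_history famz); apply: measurable_op_sample2; [exact: ltnW|exact: aa]).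
- exact: op_sample2_ge0.
Qed.

Definition jac_step_noise (a : process) k j w x :=
  jac_sample a k j w *m jnoise (a k w) x.

Lemma batch_meanM m n p (F : nat -> 'M[R]_(m, n)) (A : 'M[R]_(n, p)) :
  batch_mean B F *m A = batch_mean B (fun j => F j *m A).
Proof. by rewrite /batch_mean -scalemxAl mulmx_suml. Qed.

Lemma batch_meanD (V : lmodType R) (F F' : nat -> V) :
  batch_mean B (fun j => F j + F' j) = batch_mean B F + batch_mean B F'.
Proof. by rewrite /batch_mean big_split scalerDr. Qed.

Lemma batch_meanZ (V : lmodType R) c (F : nat -> V) :
  batch_mean B (fun j => c *: F j) = c *: batch_mean B F.
Proof.
rewrite /batch_mean [RHS]scalerA mulrC -scalerA; congr (_ *: _).
by rewrite scaler_sumr.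
Qed.

Lemma batch_meanB (V : lmodType R) (F F' : nat -> V) :
  batch_mean B (fun j => F j - F' j) = batch_mean B F - batch_mean B F'.
Proof. by rewrite /batch_mean sumrB scalerBr. Qed.

Lemma batch_mean_cst (V : lmodType R) (x : V) : batch_mean B (fun=> x) = x.
Proof.
rewrite /batch_mean sumr_const card_ord -(scaler_nat B x) scalerA mulVf ?scale1r//.
by rewrite pnatr_eq0 -lt0n.
Qed.

(** The last sampled factor is its mean plus noise. The mean propagates the earlier error; the noise
    gives a martingale increment, since the prefix uses only samples of lower levels. *)
Lemma jac_errorS (a : process) k w : jac_error a k.+1 w =
  jac_error a k w *m 'J (@f k) (a k w) +
  batch_mean B (fun j => jac_step_noise a k j w (z k j w)).
Proof.
rewrite /jac_error mulmxBl batch_meanM addrAC -batch_meanD.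
congr (batch_mean _ _ - _); apply/funext => j.
by rewrite -mulmxDr addrC subrK.
Qed.

Lemma mxmeas_jac_step_noise (a : process) k j : (k < K)%N -> adapted a ->
  mxmeas (fun v : (history k * Xi)%type => jac_step_noise a k j v.1 v.2).
Proof.
move=> kK aa; have mJk := (levels_measurable reg kK).2.
apply: mxmeasM.
  apply: (mxmeas_comp (@mxmeas_jac_sample a k j (ltnW kK) aa)).
  exact: measurable_fst.
apply: mxmeasB; last first.
  by apply: (mxmeas_comp (mxmeas_adapted_J kK aa)); exact: measurable_fst.
apply: (mxmeas_oracle mJk); last exact: measurable_snd.
by apply: (mxmeas_comp (aa k (ltnW kK))); exact: measurable_fst.
Qed.

Lemma jac_step_noise_mean0 (a : process) k j w : (k < K)%N ->
  mean0 (Q k) (jac_step_noise a k j w).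
Proof.
move=> kK; apply: mean0_mull; apply: (noise_mean0 (L := L)).
  exact: (levels_measurable reg kK).2.
exact: (levels_unbiased reg kK).2.
Qed.

Lemma exle_jac_error (a : process) k : (k <= K)%N -> adapted a ->
  exle P (fun w => norm2 (jac_error a k w) ^+ 2)
         (k%:R * (4 * L ^+ 2) ^+ k * B%:R^-1).
Proof.
move=> + aa; elim: k => [_|k IH kK].
  rewrite mul0r mul0r; apply: exle_cst => w; first exact: sqr_ge0.
  by rewrite /jac_error /jac_sample /jac_true /= batch_mean_cst subrr norm2_0 expr0n.
have b0 : 0 <= B%:R^-1 :> R by rewrite invr_ge0.
have mJk := (levels_measurable reg kK).2.
pose c w := jac_error a k w *m 'J (@f k) (a k w).
pose V w j := L ^+ 2 * op_sample a k j w ^+ 2.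
rewrite (_ : (fun w => _) = fun w => norm2 (c w +
  batch_mean B (fun j => jac_step_noise a k j w (z k j w))) ^+ 2); last first.
  by apply/funext => w; rewrite jac_errorS.
apply: le_trans (@level_sqr _ _ _ _ _ _ _ _ _ _ famz zQ k kK _ _ c
   (jac_step_noise a k) V _ _ _ _) _.
- apply: mxmeasM; last exact: mxmeas_adapted_J.
  exact: mxmeas_jac_error (ltnW kK) aa.
- by move=> j _; exact: mxmeas_jac_step_noise.
- by move=> w j _; exact: jac_step_noise_mean0.
- move=> w j _; apply: exle_mul_noise => //; first exact: (levels_unbiased reg kK).2.
  (apply: opbound_jac_sample; exact: ltnW).
(* A level multiplies the earlier squared error by at most L^2 and adds an increment of at most L^2
   / B times [op_sample2]; both factors L^2 are relaxed to 4 L^2 so that the powers match. *)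
have E : k.+1%:R * (4 * L ^+ 2) ^+ k.+1 * B%:R^-1 =
  (4 * L ^+ 2) * (k%:R * (4 * L ^+ 2) ^+ k * B%:R^-1) +
  (4 * L ^+ 2 * B%:R^-1) * ((4 * L ^+ 2) ^+ k) + 0.
  by rewrite addr0 (exprS _ k) -natr1; ring.
rewrite E.
apply: (@exle_lin2 _ _ _ _ _ (fun w => norm2 (jac_error a k w) ^+ 2) (op_sample2 a k)).
- by move=> w; rewrite addr_ge0 ?sqr_ge0// mulr_ge0// mean_ge0// => j _;
    rewrite mulr_ge0 ?sqr_ge0.
- by rewrite mulr_ge0// sqr_ge0.
- by rewrite !mulr_ge0// sqr_ge0.
- by [].
- move=> w; rewrite addr0 /V meanZ -/(op_sample2 a k w); apply: lerD.
    apply: (@le_trans _ _ (L ^+ 2 * norm2 (jac_error a k w) ^+ 2)).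
      rewrite -exprMn ler_sqr ?nnegrE ?norm2_ge0 ?mulr_ge0 ?norm2_ge0//.
      by apply: opbound_mull; exact: (opbound_J reg).
    by rewrite ler_wpM2r ?sqr_ge0// ler_peMl ?sqr_ge0// ler1n.
  rewrite mulrA ler_wpM2r ?op_sample2_ge0// mulrC ler_wpM2r//.
  by rewrite ler_peMl ?sqr_ge0// ler1n.
- apply: measurable_funX; apply: measurable_norm2.
  exact: (mxmeas_history famz (mxmeas_jac_error (ltnW kK) aa)).
- (apply: (measurable_history famz); apply: measurable_op_sample2; [exact: ltnW|exact: aa]).
- by move=> w; exact: sqr_ge0.
- exact: op_sample2_ge0.
- (apply: IH; exact: ltnW).
(apply: exle_op_sample2; [exact: ltnW|exact: aa]).
Qed.

End jacobian_products.

(* the conditional mean of the next estimate, up to the nonlinearity of the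
   levels *)
Fixpoint predictor (R : realType) (d : nat -> nat)
    (f : forall i, 'rV[R]_(d i).+1 -> 'rV[R]_(d i.+1).+1) (alpha : R)
    (u' : forall i, 'rV[R]_(d i).+1) (x : 'rV[R]_(d 0%N).+1) (k : nat) :
    'rV[R]_(d k).+1 :=
  if k is i.+1 then
    (1 - alpha) *: u' i.+1 + f i (predictor f alpha u' x i)
    - (1 - alpha) *: f i (u' i)
  else x.

Definition tracking (R : realType) (d : nat -> nat)
    (f : forall i, 'rV[R]_(d i).+1 -> 'rV[R]_(d i.+1).+1) (K : nat)
    (u : forall i, 'rV[R]_(d i).+1) : R :=
  \sum_(k < K) norm2 (u k.+1 - f k (u k)) ^+ 2.

(** Bounds the mean of |u_k - ubar_k|^2 in units of q / B, where q = alpha^2 (1 + S). In 17, the 1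
    is propagation through the level and the 16 is noise due to the distance from [u] to [u']; the
    power of 2 L is that of [predictor_dist]. *)
Fixpoint drift_const (R : realType) (L : R) (k : nat) : R :=
  if k is i.+1 then
    17 * L ^+ 2 * drift_const L i + 8 * L ^+ 2 * (1 + 2 * ((2 * L) ^+ i.+1) ^+ 2)
  else 0.

(** * One update of the level estimates from a frozen state *)

Section one_update.
Context (R : realType) (K : nat) (L : R) (d : nat -> nat)
  (f : forall i, 'rV[R]_(d i).+1 -> 'rV[R]_(d i.+1).+1)
  (dX : measure_display) (Xi : measurableType dX) (Q : nat -> probability Xi R)
  (fo : forall i, 'rV[R]_(d i).+1 -> Xi -> 'rV[R]_(d i.+1).+1)
  (Jo : forall i, 'rV[R]_(d i).+1 -> Xi -> 'M[R]_((d i).+1, (d i.+1).+1)).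
Hypothesis reg : regular_problem K L f Q fo Jo.
Context (dO : measure_display) (Omega : measurableType dO)
  (P : probability Omega R) (z : nat -> nat -> {RV P >-> Xi}) (B : nat).
Hypothesis famz : indep_family P (sigma_sample z).
Hypothesis zQ : forall i j, (i < K)%N -> sampled_from (z i j) (Q i).
Hypothesis B_gt0 : (0 < B)%N.

Let L1 : 1 <= L := const_ge1 reg.
Let L0 : 0 <= L. Proof. exact: le_trans L1. Qed.

Context (u' : forall i, 'rV[R]_(d i).+1) (x : 'rV[R]_(d 0%N).+1) (alpha : R).
Hypothesis alpha_ge0 : 0 <= alpha.
Hypothesis xu' : norm2 (x - u' 0%N) <= alpha * L.

Notation history := (history z).
Notation s := (tracking f K u').
Notation q := (alpha ^+ 2 * (1 + s)).
Notation ubar := (predictor f alpha u' x).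

Definition updated k w := update_est fo B alpha u' x (fun i j => z i j w) k.

Lemma tracking_ge0 (u : forall i, 'rV[R]_(d i).+1) : 0 <= tracking f K u.
Proof. by apply: sumr_ge0 => i _; exact: sqr_ge0. Qed.

Lemma tracking_level k : (k < K)%N -> norm2 (u' k.+1 - f (u' k)) ^+ 2 <= s.
Proof.
move=> kK; rewrite /tracking (bigD1 (Ordinal kK)) //= lerDl.
by apply: sumr_ge0 => i _; exact: sqr_ge0.
Qed.

Lemma drift_scale_ge0 : 0 <= q.
Proof. by rewrite mulr_ge0 ?sqr_ge0// addr_ge0// tracking_ge0. Qed.

Lemma sqr_alpha_le : alpha ^+ 2 <= q.
Proof. by rewrite ler_peMr ?sqr_ge0// lerDl tracking_ge0. Qed.

Lemma adapted_cst (a : forall i, 'rV[R]_(d i).+1) : adapted K z (fun k _ => a k).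
Proof. by move=> k _; exact: mxmeas_cst. Qed.

Lemma adapted_updated : adapted K z updated.
Proof.
move=> k; elim: k => [_|k IH kK]; first exact: mxmeas_cst.
have [mf _] := levels_measurable reg kK.
apply: mxmeasB.
  apply: mxmeasD; first exact: mxmeas_cst.
  apply: (@mxmeas_batch_mean _ _ _ _ _ B (fun j (w : history k.+1) => fo (updated k w) (z k j w))) => j _.
  apply: mxmeas_oracle => //; last exact: measurable_sample_history.
  by apply: mxmeas_historyS; apply: IH; exact: ltnW.
apply: mxmeasZ => //.
apply: (@mxmeas_batch_mean _ _ _ _ _ B (fun j (w : history k.+1) => fo (u' k) (z k j w))) => j _.
by apply: mxmeas_oracle => //; exact: measurable_sample_history.
Qed.

Definition momentum_noise k w y :=
  noise (@fo k) (@f k) (updated k w) y - (1 - alpha) *: noise (@fo k) (@f k) (u' k) y.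

(** Exhibits the mean given the lower levels: the old level error shrunk by 1 - alpha, on top of [f]
    at the new lower estimate. The rest is centred noise. *)
Lemma updatedS k w : updated k.+1 w =
  (1 - alpha) *: (u' k.+1 - f (u' k)) + f (updated k w) +
  batch_mean B (fun j => momentum_noise k w (z k j w)).
Proof.
rewrite /momentum_noise batch_meanB batch_meanZ !batch_meanB !batch_mean_cst//.
rewrite /= -/(updated k w) scalerBr.
set a := (1 - alpha) *: u' k.+1; set b := batch_mean _ _; set c := batch_mean _ _.
rewrite scalerBr opprB; set e := (1 - alpha) *: f (u' k); set g := f _.
rewrite !addrA; apply/rowP => i; rewrite !mxE; ring.
Qed.

(** A level moves by alpha times its old error, at most sqrt q, plus the change of [f] caused by the
    move below. Absorbing the first term into the second doubles the factor L. *)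
Lemma predictor_dist k : (k <= K)%N ->
  norm2 (ubar k - u' k) <= (2 * L) ^+ k.+1 * Num.sqrt q.
Proof.
have ar : alpha <= Num.sqrt q.
  rewrite -(@ler_sqr R) ?nnegrE ?sqrtr_ge0// sqr_sqrtr ?drift_scale_ge0//.
  exact: sqr_alpha_le.
have l1 : 1 <= L by exact: L1.
have L2 : 1 <= 2 * L by lra.
elim: k => [_|k IH kK].
  rewrite (le_trans xu')// mulrC ler_pM//.
  by rewrite expr1; lra.
have {}IH := IH (ltnW kK).
have [lf _ _] := levels_smooth reg kK.
have -> : ubar k.+1 - u' k.+1 =
    - alpha *: (u' k.+1 - f (u' k)) + (f (ubar k) - f (u' k)).
  by rewrite /=; apply/rowP => i; rewrite !mxE; ring.
rewrite (le_trans (norm2D _ _))// norm2Z normrN (ger0_norm alpha_ge0).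
have h1 : alpha * norm2 (u' k.+1 - f (u' k)) <= Num.sqrt q.
  rewrite -ler_sqr ?nnegrE ?sqrtr_ge0 ?mulr_ge0 ?norm2_ge0//.
  rewrite sqr_sqrtr ?drift_scale_ge0// exprMn ler_wpM2l ?sqr_ge0//.
  by rewrite (le_trans (tracking_level kK))// lerDr.
have h2 : norm2 (f (ubar k) - f (u' k)) <= L * ((2 * L) ^+ k.+1 * Num.sqrt q).
  by rewrite (le_trans (lf _ _))// ler_wpM2l.
have h3 : Num.sqrt q <= L * (2 * L) ^+ k.+1 * Num.sqrt q.
  by rewrite ler_peMl ?sqrtr_ge0// mulr_ege1// exprn_ege1.
rewrite (exprS _ k.+1); nra.
Qed.

Lemma predictor_sqr_dist k : (k <= K)%N ->
  norm2 (ubar k - u' k) ^+ 2 <= ((2 * L) ^+ k.+1) ^+ 2 * q.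
Proof.
move=> kK; rewrite -[q in leRHS](@sqr_sqrtr R) ?drift_scale_ge0// -exprMn.
rewrite ler_sqr ?nnegrE ?norm2_ge0 ?mulr_ge0 ?sqrtr_ge0 ?exprn_ge0 ?mulr_ge0//.
exact: predictor_dist.
Qed.

Lemma mxmeas_updated k : (k <= K)%N -> mxmeas (updated k).
Proof. by move=> kK; apply: (mxmeas_history famz (adapted_updated kK)). Qed.

(** Shared by the drift from the predictor and the level error, which differ only in the mean part
    [c]: the drift has m = 0, the level error has for m the square of the shrunk old error. *)
Lemma exle_momentum_batch k m (c : Omega -> 'rV[R]_(d k.+1).+1) : (k < K)%N ->
  mxmeas (c : history k -> _) ->
  (forall w, norm2 (c w) ^+ 2 <= m + L ^+ 2 * norm2 (updated k w - ubar k) ^+ 2) ->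
  0 <= m ->
  exle P (fun w => norm2 (updated k w - ubar k) ^+ 2) (drift_const L k * (q / B%:R)) ->
  exle P (fun w => norm2 (c w + batch_mean B (fun j => momentum_noise k w (z k j w))) ^+ 2)
    (m + drift_const L k.+1 * (q / B%:R)).
Proof.
move=> kK mc cle m0 IH.
have [lf _ _] := levels_smooth reg kK.
have [mf _] := levels_measurable reg kK.
have [uf _] := levels_unbiased reg kK.
have [sf _] := levels_mean_square reg kK.
have b0 : 0 <= B%:R^-1 :> R by rewrite invr_ge0.
have b1 : B%:R^-1 <= 1 :> R by rewrite invf_le1// ?ltr0n// ler1n.
have mu : mxmeas (fun v : (history k * Xi)%type => updated k v.1).
  apply: (mxmeas_comp (adapted_updated (ltnW kK))); exact: measurable_fst.
have mfu (a : history k * Xi -> 'rV[R]_(d k).+1) : mxmeas a ->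
    mxmeas (fun v => noise (@fo k) (@f k) (a v) v.2).
  move=> ma; apply: mxmeasB; last exact: (mxmeas_lipschitz lf ma).
  by apply: (mxmeas_oracle mf ma); exact: measurable_snd.
pose V w (j : nat) := 8 * L ^+ 2 * (alpha ^+ 2 + norm2 (updated k w - u' k) ^+ 2).
apply: le_trans (@level_sqr _ _ _ _ _ _ _ _ _ _ famz zQ k kK _ _ c
   (fun j => momentum_noise k) V mc _ _ _) _.
- move=> j _; apply: mxmeasB; first exact: mfu.
  by apply: mxmeasZ => //; apply: mfu; exact: mxmeas_cst.
- move=> w j _; apply: mean0B; first exact: (noise_mean0 mf uf).
  by apply: mean0Z; exact: (noise_mean0 mf uf).
- by move=> w j _; exact: exle_momentum_noise.
set E := ((2 * L) ^+ k.+1) ^+ 2.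
have -> : m + drift_const L k.+1 * (q / B%:R) =
    17 * L ^+ 2 * (drift_const L k * (q / B%:R)) +
    (m + 8 * L ^+ 2 * (1 + 2 * E) * (q / B%:R)).
  by rewrite /= -/E; ring.
apply: (@exle_lin1 _ _ _ _ _ (fun w => norm2 (updated k w - ubar k) ^+ 2)).
- move=> w; rewrite addr_ge0 ?sqr_ge0// mulr_ge0// mean_ge0// => j _.
  by rewrite !mulr_ge0 ?addr_ge0 ?sqr_ge0.
- by rewrite mulr_ge0// sqr_ge0.
- rewrite addr_ge0// mulr_ge0 ?divr_ge0 ?drift_scale_ge0 ?ler0n//.
  by rewrite !mulr_ge0 ?sqr_ge0// addr_ge0// mulr_ge0 ?sqr_ge0.
- move=> w; rewrite /V mean_cst//.
  have h1 := cle w; have h2 := predictor_sqr_dist (ltnW kK).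
  have h3 : norm2 (updated k w - u' k) ^+ 2 <=
     2 * (norm2 (updated k w - ubar k) ^+ 2 + norm2 (ubar k - u' k) ^+ 2).
    by rewrite (le_trans _ (sqr_norm2D_le _ _))// addrA subrK.
  have h4 := sqr_alpha_le; rewrite -/E in h2.
  set Z := norm2 (updated k w - ubar k) ^+ 2 in h1 h3 *.
  have Z0 : 0 <= Z by exact: sqr_ge0.
  have h5 : alpha ^+ 2 + norm2 (updated k w - u' k) ^+ 2 <= 2 * Z + (1 + 2 * E) * q.
    by lra.
  have l2 : 0 <= L ^+ 2 by exact: sqr_ge0.
  have h6 : B%:R^-1 * (8 * L ^+ 2 * (alpha ^+ 2 + norm2 (updated k w - u' k) ^+ 2)) <=
      B%:R^-1 * (8 * L ^+ 2 * (2 * Z + (1 + 2 * E) * q)).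
    by apply: ler_wpM2l => //; apply: ler_wpM2l; rewrite ?mulr_ge0.
  (* Here 1 / B <= 1 is enough, since the mean of [Z] is already of order q / B. *)
  have h7 : B%:R^-1 * (16 * L ^+ 2 * Z) <= 16 * L ^+ 2 * Z.
    by apply: ler_piMl => //; rewrite mulr_ge0// mulr_ge0.
  have -> : 8 * L ^+ 2 * (1 + 2 * E) * (q / B%:R) =
     B%:R^-1 * (8 * L ^+ 2 * (1 + 2 * E) * q) by ring.
  by lra.
- apply: measurable_funX; apply: measurable_norm2; apply: mxmeasB.
    (apply: mxmeas_updated; exact: ltnW).
  exact: mxmeas_cst.
- by move=> w; exact: sqr_ge0.
exact: IH.
Qed.

Lemma exle_drift k : (k <= K)%N ->
  exle P (fun w => norm2 (updated k w - ubar k) ^+ 2) (drift_const L k * (q / B%:R)).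
Proof.
elim: k => [_|k IH kK].
  rewrite mul0r; apply: exle_cst => w; first exact: sqr_ge0.
  by rewrite subrr norm2_0 expr0n.
have {}IH := IH (ltnW kK).
have [lf _ _] := levels_smooth reg kK.
have -> : (fun w => norm2 (updated k.+1 w - ubar k.+1) ^+ 2) = fun w =>
    norm2 (f (updated k w) - f (ubar k) +
      batch_mean B (fun j => momentum_noise k w (z k j w))) ^+ 2.
  apply/funext => w; congr (norm2 _ ^+ 2); rewrite updatedS /=.
  by apply/rowP => i; rewrite !mxE; ring.
rewrite -[X in exle _ _ X]add0r; apply: exle_momentum_batch => //.
- apply: mxmeasB; last exact: mxmeas_cst.
  by apply: (mxmeas_lipschitz lf); apply: adapted_updated; exact: ltnW.
- by move=> w; rewrite add0r; apply: (sqr_lipschitz _ lf).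
Qed.

Lemma exle_tracking_level k : (k < K)%N ->
  exle P (fun w => norm2 (updated k.+1 w - f (updated k w)) ^+ 2)
    ((1 - alpha) ^+ 2 * norm2 (u' k.+1 - f (u' k)) ^+ 2 +
     drift_const L k.+1 * (q / B%:R)).
Proof.
move=> kK.
have -> : (fun w => norm2 (updated k.+1 w - f (updated k w)) ^+ 2) = fun w =>
    norm2 ((1 - alpha) *: (u' k.+1 - f (u' k)) +
      batch_mean B (fun j => momentum_noise k w (z k j w))) ^+ 2.
  by apply/funext => w; rewrite updatedS addrAC addrK.
apply: exle_momentum_batch => //.
- move=> w; rewrite norm2Z exprMn real_normK ?num_real// lerDl.
  by rewrite mulr_ge0 ?sqr_ge0.
- by rewrite mulr_ge0 ?sqr_ge0.
- exact/exle_drift/ltnW.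
Qed.

End one_update.

(** * Sampled products at two sequences of points *)

Section jacobian_differences.
Context (R : realType) (K : nat) (L : R) (d : nat -> nat)
  (f : forall i, 'rV[R]_(d i).+1 -> 'rV[R]_(d i.+1).+1)
  (dX : measure_display) (Xi : measurableType dX) (Q : nat -> probability Xi R)
  (fo : forall i, 'rV[R]_(d i).+1 -> Xi -> 'rV[R]_(d i.+1).+1)
  (Jo : forall i, 'rV[R]_(d i).+1 -> Xi -> 'M[R]_((d i).+1, (d i.+1).+1)).
Hypothesis reg : regular_problem K L f Q fo Jo.
Context (dO : measure_display) (Omega : measurableType dO)
  (P : probability Omega R) (z : nat -> nat -> {RV P >-> Xi}) (B : nat).
Hypothesis famz : indep_family P (sigma_sample z).
Hypothesis zQ : forall i j, (i < K)%N -> sampled_from (z i j) (Q i).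
Hypothesis B_gt0 : (0 < B)%N.

Let L1 : 1 <= L := const_ge1 reg.
Let L0 : 0 <= L. Proof. exact: le_trans L1. Qed.

Notation process := (forall i, Omega -> 'rV[R]_(d i).+1).
Notation adapted := (adapted K z).
Notation history := (history z).
Notation jnoise := (jnoise f Jo).
Notation jac_sample := (jac_sample Jo z).
Notation op_sample := (op_sample L f Jo z).
Notation op_sample2 := (op_sample2 L f Jo z B).
Notation jac_step_noise := (jac_step_noise f Jo z).

Definition jac_dist2 (a a' : process) k w :=
  mean B (fun j => norm2 (jac_sample a k j w - jac_sample a' k j w) ^+ 2).

Lemma jac_dist2_ge0 (a a' : process) k w : 0 <= jac_dist2 a a' k w.
Proof. by apply: mean_ge0 => j _; exact: sqr_ge0. Qed.

Lemma measurable_jac_dist2 (a a' : process) k : (k <= K)%N -> adapted a -> adapted a' ->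
  measurable_fun [set: history k] (jac_dist2 a a' k).
Proof.
move=> kK aa aa'; apply: measurable_funM => //; apply: measurable_sum => j.
apply: measurable_funX; apply: measurable_norm2; apply: mxmeasB.
  exact: (mxmeas_jac_sample reg j kK aa).
exact: (mxmeas_jac_sample reg j kK aa').
Qed.

Lemma mxmeas_prod_sample (a : process) k j : (k < K)%N -> adapted a ->
  mxmeas (fun v : (history k * Xi)%type => jac_sample a k j v.1 *m Jo (a k v.1) v.2).
Proof.
move=> kK aa; have mJk := (levels_measurable reg kK).2.
apply: mxmeasM.
  apply: (mxmeas_comp (mxmeas_jac_sample reg j (ltnW kK) aa)).
  exact: measurable_fst.
apply: (mxmeas_oracle mJk); last exact: measurable_snd.
by apply: (mxmeas_comp (aa k (ltnW kK))); exact: measurable_fst.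
Qed.

Section pair.
Context (a a' : process) (k : nat) (kK : (k < K)%N).
Hypothesis aa : adapted a.
Hypothesis aa' : adapted a'.

Let X j w x := norm2 (jac_sample a k j w *m Jo (a k w) x
                      - jac_sample a' k j w *m Jo (a' k w) x) ^+ 2.
Let V w j := 8 * L ^+ 2 * norm2 (jac_sample a k j w - jac_sample a' k j w) ^+ 2 +
  2 * L ^+ 2 * (op_sample a' k j w ^+ 2 * norm2 (a k w - a' k w) ^+ 2).

Let mX j : (j < B)%N ->
  measurable_fun setT (fun v : (history k * Xi)%type => X j v.1 v.2 : R).
Proof.
move=> _; apply: measurable_funX; apply: measurable_norm2; apply: mxmeasB;
  exact: mxmeas_prod_sample.
Qed.

Let XV w j : (j < B)%N -> exle (Q k) (X j w) (V w j).
Proof.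
move=> _; apply: exle_mul_sampleB => //.
- exact: (levels_measurable reg kK).2.
- exact: (levels_unbiased reg kK).2.
- exact: (levels_mean_square reg kK).2.
- exact: (opbound_J reg).
by apply: (opbound_jac_sample reg); exact: ltnW.
Qed.

Let XE : jac_dist2 a a' k.+1 = fun w => mean B (fun j => X j w (z k j w)).
Proof. by []. Qed.

Let VE w : mean B (V w) = 8 * L ^+ 2 * jac_dist2 a a' k w +
  2 * L ^+ 2 * (op_sample2 a' k w * norm2 (a k w - a' k w) ^+ 2).
Proof. by rewrite meanD !meanZ meanZr. Qed.

Lemma ex_jac_dist2S : (ex P (jac_dist2 a a' k.+1) <=
  ex P (fun w => 8 * L ^+ 2 * jac_dist2 a a' k w +
    2 * L ^+ 2 * (op_sample2 a' k w * norm2 (a k w - a' k w) ^+ 2))%R)%E.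
Proof.
rewrite XE; apply: le_trans (level_mean famz zQ kK mX _ XV) _.
  by move=> *; exact: sqr_ge0.
by under eq_fun do rewrite VE.
Qed.

(** At random points [op_sample2] and the squared distance are dependent and second moments do not
    bound the mean of their product; they do bound the mean of its root. *)
Lemma ex_sqrt_jac_dist2S : (ex P (fun w => Num.sqrt (jac_dist2 a a' k.+1 w)) <=
  ex P (fun w => Num.sqrt (8 * L ^+ 2 * jac_dist2 a a' k w +
    2 * L ^+ 2 * (op_sample2 a' k w * norm2 (a k w - a' k w) ^+ 2))%R))%E.
Proof.
rewrite XE; apply: le_trans (level_mean_sqrt famz zQ kK mX _ XV) _.
  by move=> *; exact: sqr_ge0.
by under eq_fun do rewrite VE.
Qed.

(** The difference of two martingale increments is centred given the lower levels, so the batch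
    contributes a factor 1 / B under the root. *)
Lemma ex_step_noiseB : (ex P (fun w => norm2 (batch_mean B (fun j =>
     jac_step_noise a k j w (z k j w) - jac_step_noise a' k j w (z k j w))))%R <=
  ex P (fun w => Num.sqrt (B%:R^-1 * (2 * L ^+ 2 * jac_dist2 a a' k w +
    8 * L ^+ 2 * (op_sample2 a' k w * norm2 (a k w - a' k w) ^+ 2)))%R))%E.
Proof.
pose W w j := 2 * L ^+ 2 * norm2 (jac_sample a k j w - jac_sample a' k j w) ^+ 2 +
  8 * L ^+ 2 * (op_sample a' k j w ^+ 2 * norm2 (a k w - a' k w) ^+ 2).
have WE w : mean B (W w) = 2 * L ^+ 2 * jac_dist2 a a' k w +
    8 * L ^+ 2 * (op_sample2 a' k w * norm2 (a k w - a' k w) ^+ 2).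
  by rewrite meanD !meanZ meanZr.
pose c (w : Omega) := 0 : 'M[R]_((d 0%N).+1, (d k.+1).+1).
pose Y j w x := jac_step_noise a k j w x - jac_step_noise a' k j w x.
rewrite (_ : (fun w => norm2 _) =
    fun w => norm2 (c w + batch_mean B (fun j => Y j w (z k j w)))); last first.
  by apply/funext => w; rewrite add0r.
rewrite (_ : (fun w => Num.sqrt _) =
    fun w => Num.sqrt (norm2 (c w) ^+ 2 + B%:R^-1 * mean B (W w))); last first.
  by apply/funext => w; rewrite norm2_0 expr0n add0r WE.
apply: (level_norm famz zQ kK).
- exact: mxmeas_cst.
- by move=> j _; apply: mxmeasB; exact: (mxmeas_jac_step_noise reg).
- by move=> w j _; apply: mean0B; exact: (jac_step_noise_mean0 reg).
- move=> w j _; have [_ _ lJ] := levels_smooth reg kK.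
  apply: exle_mul_noiseB => //.
  + exact: (levels_measurable reg kK).2.
  + exact: (levels_unbiased reg kK).2.
  + exact: (levels_mean_square reg kK).2.
  + by apply: (opbound_jac_sample reg); exact: ltnW.
Qed.

Lemma ex_step_noise_mul p (c : Omega -> 'M[R]_((d 0%N).+1, p))
    (M M' : 'M[R]_((d k.+1).+1, p)) mu alpha :
  mxmeas (c : history k -> _) -> opbound M mu -> opbound M' mu ->
  (ex P (fun w => norm2 (c w + batch_mean B (fun j =>
     jac_step_noise a k j w (z k j w) *m M -
     (1 - alpha) *: (jac_step_noise a' k j w (z k j w) *m M'))) ^+ 2)%R <=
  ex P (fun w => norm2 (c w) ^+ 2 + B%:R^-1 *
    (3 * mu ^+ 2 * (2 * L ^+ 2 * jac_dist2 a a' k w +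
    8 * L ^+ 2 * (op_sample2 a' k w * norm2 (a k w - a' k w) ^+ 2)) +
    3 * (norm2 (M - M') ^+ 2 + alpha ^+ 2 * mu ^+ 2) * (L ^+ 2 * op_sample2 a' k w)))%R)%E.
Proof.
move=> mc Mm Mm'.
pose W w j := 3 * mu ^+ 2 *
   (2 * L ^+ 2 * norm2 (jac_sample a k j w - jac_sample a' k j w) ^+ 2 +
    8 * L ^+ 2 * (op_sample a' k j w ^+ 2 * norm2 (a k w - a' k w) ^+ 2)) +
  3 * (norm2 (M - M') ^+ 2 + alpha ^+ 2 * mu ^+ 2) * (L ^+ 2 * op_sample a' k j w ^+ 2).
have WE w : mean B (W w) = 3 * mu ^+ 2 * (2 * L ^+ 2 * jac_dist2 a a' k w +
    8 * L ^+ 2 * (op_sample2 a' k w * norm2 (a k w - a' k w) ^+ 2)) +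
    3 * (norm2 (M - M') ^+ 2 + alpha ^+ 2 * mu ^+ 2) * (L ^+ 2 * op_sample2 a' k w).
  by rewrite meanD !meanZ meanD !meanZ meanZr.
pose Y j w x := jac_step_noise a k j w x *m M -
     (1 - alpha) *: (jac_step_noise a' k j w x *m M').
rewrite (_ : (fun w => norm2 (c w) ^+ 2 + _) =
    fun w => norm2 (c w) ^+ 2 + B%:R^-1 * mean B (W w)); last first.
  by apply/funext => w; rewrite WE.
apply: (level_sqr famz zQ kK (Y := Y)) => //.
- move=> j _; apply: mxmeasB; last apply: mxmeasZ => //.
    by apply: mxmeasM; [exact: (mxmeas_jac_step_noise reg)|exact: mxmeas_cst].
  by apply: mxmeasM; [exact: (mxmeas_jac_step_noise reg)|exact: mxmeas_cst].
- move=> w j _; apply: mean0B; last apply: mean0Z;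
    by apply: mean0_mulr; exact: (jac_step_noise_mean0 reg).
- move=> w j _; have [_ _ lJ] := levels_smooth reg kK.
  apply: exle_mul_noise_mul => //.
  + exact: (levels_measurable reg kK).2.
  + exact: (levels_unbiased reg kK).2.
  + exact: (levels_mean_square reg kK).2.
  + by apply: (opbound_jac_sample reg); exact: ltnW.
Qed.

End pair.

End jacobian_differences.

Section constants.
Context (R : realType) (L : R).

(** Predictor against old estimates, both deterministic: mean squared distance of the sampled
    products, in units of q. *)
Fixpoint diff_const (k : nat) : R :=
  if k is i.+1 then
    8 * L ^+ 2 * diff_const i + 2 * L ^+ 2 * (((2 * L) ^+ i.+1) ^+ 2 * (4 * L ^+ 2) ^+ i)
  else 0.

(** New estimates against predictor: mean of the root of [jac_dist2], in units of alpha (1 + S) /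
    sqrt B. *)
Fixpoint spread_const (k : nat) : R :=
  if k is i.+1 then
    3 * L * spread_const i + L * ((4 * L ^+ 2) ^+ i + drift_const L i)
  else 0.

(** Error caused by replacing u by ubar, in units of alpha (1 + S) / B. The three summands are the
    difference of the noise increments, the propagated error and the change of the true Jacobian. *)
Fixpoint bias_const (k : nat) : R :=
  if k is i.+1 then
    2 * L * (spread_const i + ((4 * L ^+ 2) ^+ i + drift_const L i)) +
    L * bias_const i + L * (i%:R * (4 * L ^+ 2) ^+ i + drift_const L i)
  else 0.

(** [t] measures, in units of sqrt q, the change of the product of the true Jacobians of the later
    levels. A level taken into that product adds (2 L)^(i+1) to [t] and multiplies squares by
    L^2. *)
Fixpoint martingale_const (k : nat) (t : R) : R :=
  if k is i.+1 then
    L ^+ 2 * martingale_const i (t + (2 * L) ^+ i.+1) +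
    (6 * L ^+ 2 * diff_const i +
     (24 * L ^+ 2 * ((2 * L) ^+ i.+1) ^+ 2 + 3 * L ^+ 2 * (t ^+ 2 + 1)) * (4 * L ^+ 2) ^+ i)
  else 0.

End constants.

(* a smoothing of the norm, for which Jensen's inequality turns a conditional
   variance [v] into a gain [v / alpha] *)
Definition soft_norm2 (R : realType) (alpha : R) m n (A : 'M[R]_(m, n)) : R :=
  Num.sqrt (alpha ^+ 2 + norm2 A ^+ 2).

Section soft_norm.
Context (R : realType) (alpha : R) (m n : nat).
Implicit Types A B : 'M[R]_(m, n).

Lemma soft_norm2_ge0 A : 0 <= soft_norm2 alpha A.
Proof. exact: sqrtr_ge0. Qed.

Lemma sqr_soft_norm2 A : soft_norm2 alpha A ^+ 2 = alpha ^+ 2 + norm2 A ^+ 2.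
Proof. by rewrite sqr_sqrtr// addr_ge0 ?sqr_ge0. Qed.

Lemma le_soft_norm2 A : norm2 A <= soft_norm2 alpha A.
Proof.
by rewrite -ler_sqr ?nnegrE ?norm2_ge0 ?soft_norm2_ge0// sqr_soft_norm2 lerDr sqr_ge0.
Qed.

Lemma soft_norm2D A B : soft_norm2 alpha (A + B) <= soft_norm2 alpha A + norm2 B.
Proof.
have h := norm2D A B; have h0 := norm2_ge0 A; have h1 := norm2_ge0 B.
have h2 := norm2_ge0 (A + B).
rewrite -ler_sqr ?nnegrE ?soft_norm2_ge0 ?addr_ge0 ?soft_norm2_ge0//.
rewrite sqrrD !sqr_soft_norm2.
have h3 := le_soft_norm2 A; have h4 := soft_norm2_ge0 A.
have : norm2 (A + B) ^+ 2 <= (norm2 A + norm2 B) ^+ 2.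
  by rewrite ler_sqr ?nnegrE ?addr_ge0.
have : norm2 A * norm2 B <= soft_norm2 alpha A * norm2 B by rewrite ler_wpM2r.
rewrite sqrrD; lra.
Qed.

(** There is equality at A = 0. In squares, the uncontracted part alpha^2 (2 alpha - alpha^2) of the
    floor is covered by the cross term and alpha^4, because the soft norm is at least alpha. *)
Lemma soft_norm2_contract A : 0 <= alpha <= 1 ->
  soft_norm2 alpha ((1 - alpha) *: A) <= (1 - alpha) * soft_norm2 alpha A + alpha ^+ 2.
Proof.
move=> /andP[a0 a1]; have b0 : 0 <= 1 - alpha by lra.
rewrite -ler_sqr ?nnegrE ?soft_norm2_ge0 ?addr_ge0 ?mulr_ge0 ?soft_norm2_ge0 ?sqr_ge0//.
rewrite sqr_soft_norm2 norm2Z ger0_norm//.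
have h : alpha <= soft_norm2 alpha A.
  by rewrite -ler_sqr ?nnegrE ?soft_norm2_ge0// sqr_soft_norm2 lerDl sqr_ge0.
rewrite sqrrD !exprMn sqr_soft_norm2.
set r := soft_norm2 alpha A in h *; set x := norm2 A.
have : 0 <= (1 - alpha) * alpha ^+ 2 * (r - alpha).
  by rewrite !mulr_ge0 ?sqr_ge0// subr_ge0.
have : 0 <= alpha by [].
nra.
Qed.

End soft_norm.

Lemma mulmxBB (R : pzRingType) (m n p : nat) (A A' : 'M[R]_(m, n))
    (J J' : 'M[R]_(n, p)) :
  A *m J - A' *m J' = (A - A') *m J + A' *m (J - J').
Proof. by rewrite mulmxBl mulmxBr addrA subrK. Qed.

Lemma mulmx_diff_split (R : pzRingType) (m n p : nat) (A A' : 'M[R]_(m, n))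
    (J J' : 'M[R]_(n, p)) (N N' : 'M[R]_(m, p)) :
  A *m J + N - (A' *m J' + N') = (A - A') *m J + A' *m (J - J') + (N - N').
Proof. by rewrite -mulmxBB opprD addrACA. Qed.

Lemma sqrtD_le (R : realType) (x v alpha : R) : 0 < alpha -> 0 <= v ->
  alpha ^+ 2 <= x -> Num.sqrt (x + v) <= Num.sqrt x + v / alpha.
Proof.
move=> a0 v0 ax; have x0 : 0 <= x by exact: le_trans (sqr_ge0 _) ax.
have as_ : alpha <= Num.sqrt x.
  by rewrite -(@ler_sqr R) ?nnegrE ?sqrtr_ge0 ?(ltW a0)// sqr_sqrtr.
have va : 0 <= v / alpha by rewrite divr_ge0// ltW.
rewrite -(@ler_sqr R) ?nnegrE ?sqrtr_ge0 ?addr_ge0 ?sqrtr_ge0//.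
rewrite sqrrD !sqr_sqrtr ?addr_ge0// -addrA lerD2l.
have h : v <= Num.sqrt x * (v / alpha).
  by rewrite mulrCA ler_peMr// ler_pdivlMr// mul1r.
by have := sqr_ge0 (v / alpha); lra.
Qed.

Lemma martingale_const_ge0 (R : realType) (L t : R) k :
  0 <= L -> 0 <= martingale_const L k t.
Proof.
move=> L0; have l2 := sqr_ge0 L.
have d0 i : 0 <= diff_const L i.
  elim: i => //= i IH; apply: addr_ge0; first by rewrite !mulr_ge0.
  apply: mulr_ge0; first by rewrite mulr_ge0.
  by rewrite mulr_ge0 ?sqr_ge0// exprn_ge0// mulr_ge0.
elim: k t => //= k IH t; apply: addr_ge0; first by rewrite mulr_ge0.
apply: addr_ge0; first by rewrite mulr_ge0// mulr_ge0.
apply: mulr_ge0; last by rewrite exprn_ge0// mulr_ge0.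
by apply: addr_ge0; apply: mulr_ge0; rewrite ?sqr_ge0 ?mulr_ge0// addr_ge0 ?sqr_ge0.
Qed.

Lemma momentum_mulmx_split (R : comPzRingType) (m n r p : nat) (b : R)
    (c : 'M[R]_(m, p)) (A A' : 'M[R]_(m, n)) (J J' : 'M[R]_(n, r))
    (N N' : 'M[R]_(m, r)) (M M' : 'M[R]_(r, p)) :
  c + ((A *m J + N) *m M - b *: ((A' *m J' + N') *m M')) =
  c + (A *m (J *m M) - b *: (A' *m (J' *m M'))) + (N *m M - b *: (N' *m M')).
Proof. by rewrite !mulmxDl !mulmxA scalerDr opprD addrACA -!addrA. Qed.

(** The new error is the old one shrunk, plus the momentum difference of the errors at deterministic
    points, plus the change of error from ubar to u. The factors [1%:M] are the empty suffixes with
    which [exle_martingale] is used. *)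
Lemma momentum_error_split (R : pzRingType) (m n : nat) (b : R)
    (v g g' gb S S' Sb : 'M[R]_(m, n)) :
  b *: v + S - b *: S' - g =
  b *: (v - g') + ((Sb - gb) *m 1%:M - b *: ((S' - g') *m 1%:M))
  + (S - g - (Sb - gb)).
Proof.
rewrite !mulmx1.
rewrite -[RHS]addrA (addrC (Sb - gb - _)) -(addrA (S - g)) addKr !scalerBr opprB.
by rewrite (addrC (S - g)) addrA (addrA (b *: v - _)) subrK addrA (addrAC (b *: v)).
Qed.

(** * One update of the gradient estimate from a frozen state *)

Section one_gradient_update.
Context (R : realType) (K : nat) (L : R) (d : nat -> nat)
  (f : forall i, 'rV[R]_(d i).+1 -> 'rV[R]_(d i.+1).+1)
  (dX : measure_display) (Xi : measurableType dX) (Q : nat -> probability Xi R)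
  (fo : forall i, 'rV[R]_(d i).+1 -> Xi -> 'rV[R]_(d i.+1).+1)
  (Jo : forall i, 'rV[R]_(d i).+1 -> Xi -> 'M[R]_((d i).+1, (d i.+1).+1)).
Hypothesis reg : regular_problem K L f Q fo Jo.
Context (dO : measure_display) (Omega : measurableType dO)
  (P : probability Omega R) (z : nat -> nat -> {RV P >-> Xi}) (B : nat).
Hypothesis famz : indep_family P (sigma_sample z).
Hypothesis zQ : forall i j, (i < K)%N -> sampled_from (z i j) (Q i).
Hypothesis B_gt0 : (0 < B)%N.

Let L1 : 1 <= L := const_ge1 reg.
Let L0 : 0 <= L. Proof. exact: le_trans L1. Qed.

Context (u' : forall i, 'rV[R]_(d i).+1) (x : 'rV[R]_(d 0%N).+1) (alpha : R).
Hypothesis alpha_ge0 : 0 <= alpha.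
Hypothesis xu' : norm2 (x - u' 0%N) <= alpha * L.

Hypothesis alpha_gt0 : 0 < alpha.

Notation process := (forall i, Omega -> 'rV[R]_(d i).+1).
Notation history := (history z).
Notation s := (tracking f K u').
Notation q := (alpha ^+ 2 * (1 + s)).
Notation y := (alpha * (1 + s)).
Notation ubar := (predictor f alpha u' x).
Notation jac_sample := (jac_sample Jo z).
Notation jac_true := (jac_true f).
Notation jac_error := (jac_error f Jo z B).
Notation op_sample2 := (op_sample2 L f Jo z B).
Notation jac_step_noise := (jac_step_noise f Jo z).
Notation jac_dist2 := (jac_dist2 Jo z B).
Notation updated := (updated fo z B u' x alpha).

Let U : process := updated.
Let Ub : process := fun k _ => ubar k.
Let Up : process := fun k _ => u' k.
Let aU : adapted K z U := adapted_updated reg B u' x alpha.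
Let aUb : adapted K z Ub := @adapted_cst _ K _ _ _ _ _ _ z ubar.
Let aUp : adapted K z Up := @adapted_cst _ K _ _ _ _ _ _ z u'.

Let g k : R := (4 * L ^+ 2) ^+ k.
Let E k : R := ((2 * L) ^+ k.+1) ^+ 2.
Let g0 k : 0 <= g k. Proof. by rewrite exprn_ge0// mulr_ge0// sqr_ge0. Qed.
Let E0 k : 0 <= E k. Proof. exact: sqr_ge0. Qed.
Let s0 : 0 <= s. Proof. exact: tracking_ge0. Qed.
Let q0 : 0 <= q. Proof. exact: drift_scale_ge0. Qed.
Let y0 : 0 <= y. Proof. by rewrite mulr_ge0// addr_ge0. Qed.
Let bi := B%:R^-1 : R.
Let bi_gt0 : 0 < bi. Proof. by rewrite invr_gt0 ltr0n. Qed.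
Let b := Num.sqrt bi.
Let b_gt0 : 0 < b. Proof. by rewrite sqrtr_gt0. Qed.
Let bb : b * b = bi. Proof. by rewrite -expr2 sqr_sqrtr// ltW. Qed.
Let qy : q = alpha * y. Proof. by rewrite expr2 mulrA. Qed.
Let ay : alpha <= y. Proof. by rewrite ler_peMr// lerDl. Qed.

Let distU k w := norm2 (U k w - Ub k w) ^+ 2.

Let distU_ge0 k w : 0 <= distU k w. Proof. exact: sqr_ge0. Qed.
Let La0 : 0 <= L * alpha. Proof. exact: mulr_ge0. Qed.
Let Lia0 : 0 <= L / alpha. Proof. by rewrite divr_ge0. Qed.

Let mdist k : (k <= K)%N -> measurable_fun [set: Omega] (distU k).
Proof.
move=> kK; apply: measurable_funX; apply: measurable_norm2; apply: mxmeasB.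
  exact: (mxmeas_updated reg B famz u' x alpha kK).
exact: mxmeas_cst.
Qed.

Let mop2 (a : process) k : (k <= K)%N -> adapted K z a ->
  measurable_fun [set: Omega] (op_sample2 a k).
Proof.
move=> kK aa; apply: (measurable_history famz).
exact: (measurable_op_sample2 reg _ kK aa).
Qed.

Let mdist2 (a a' : process) k : (k <= K)%N -> adapted K z a -> adapted K z a' ->
  measurable_fun [set: Omega] (jac_dist2 a a' k).
Proof.
move=> kK aa aa'; apply: (measurable_history famz).
exact: (measurable_jac_dist2 reg _ kK aa aa').
Qed.

Lemma exle_predictor_dist2 k : (k <= K)%N ->
  exle P (jac_dist2 Ub Up k) (diff_const L k * q).
Proof.
elim: k => [_|k IH kK].
  rewrite mul0r; apply: exle_cst => w; first exact: jac_dist2_ge0.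
  rewrite /jac_dist2 /mean big1 ?mulr0// => j _.
  by rewrite subrr norm2_0 expr0n.
have {}IH := IH (ltnW kK).
apply: le_trans (ex_jac_dist2S reg B famz zQ kK aUb aUp) _.
have -> : diff_const L k.+1 * q = 8 * L ^+ 2 * (diff_const L k * q) +
    2 * L ^+ 2 * (E k * q) * g k + 0.
  by rewrite /= -/(E k) -/(g k); ring.
apply: (@exle_lin2 _ _ _ _ _ (jac_dist2 Ub Up k) (op_sample2 Up k)) => //.
- move=> w; apply: addr_ge0; apply: mulr_ge0; rewrite ?jac_dist2_ge0//;
    try by rewrite mulr_ge0 ?sqr_ge0.
  by apply: mulr_ge0; [exact: op_sample2_ge0|exact: sqr_ge0].
- by rewrite mulr_ge0// sqr_ge0.
- by apply: mulr_ge0; apply: mulr_ge0; rewrite ?E0 ?q0 ?sqr_ge0.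
- move=> w; rewrite addr0 lerD2l -(mulrA (2 * L ^+ 2)) ler_wpM2l ?mulr_ge0 ?sqr_ge0//.
  rewrite mulrC ler_wpM2r ?op_sample2_ge0//.
  exact: (predictor_sqr_dist reg alpha_ge0 xu' (ltnW kK)).
- by apply: mdist2 => //; exact: ltnW.
- by apply: mop2 => //; exact: ltnW.
- exact: jac_dist2_ge0.
- exact: op_sample2_ge0.
- exact: (exle_op_sample2 reg famz zQ B_gt0 (ltnW kK) aUp).
Qed.

(* AM-GM weight balancing the products of [op_sample2] and [distU] *)
Let lam := alpha * b.
Let lam_gt0 : 0 < lam. Proof. exact: mulr_gt0. Qed.
Let mix k w := lam * op_sample2 Ub k w + lam^-1 * distU k w.

Let mix_ge0 k w : 0 <= mix k w.
Proof. by rewrite addr_ge0// mulr_ge0 ?op_sample2_ge0 ?sqr_ge0// ?invr_ge0 ltW. Qed.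

Let mix_sqr k w : 4 * (op_sample2 Ub k w * distU k w) <= mix k w ^+ 2.
Proof.
rewrite /mix; set A := op_sample2 _ _ _; set D := distU _ _.
have -> : (lam * A + lam^-1 * D) ^+ 2 = 4 * (A * D) + (lam * A - lam^-1 * D) ^+ 2.
  by field; rewrite gt_eqF.
by rewrite lerDl sqr_ge0.
Qed.

Let mmix k : (k <= K)%N -> measurable_fun [set: Omega] (mix k).
Proof.
move=> kK; apply: measurable_funD; apply: measurable_funM => //.
  by apply: mop2.
exact: mdist.
Qed.

Let exle_mix k : (k <= K)%N -> exle P (mix k) ((g k + drift_const L k) * (b * y)).
Proof.
move=> kK.
apply: (@exleW _ _ _ _ _ (lam * g k + lam^-1 * (drift_const L k * (q / B%:R)) + 0)).
  rewrite addr0 mulrDl lerD//.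
    rewrite (mulrC lam); apply: ler_wpM2l; first exact: g0.
    by rewrite /lam (mulrC alpha); apply: ler_wpM2l => //; exact: ltW.
  rewrite -/bi qy -bb /lam le_eqVlt; apply/orP; left; apply/eqP.
  by field; rewrite !gt_eqF.
apply: (@exle_lin2 _ _ _ _ _ (op_sample2 Ub k) (distU k)) => //.
- by rewrite ltW.
- by rewrite invr_ge0 ltW.
- by move=> w; rewrite addr0.
- by apply: mop2.
- exact: mdist.
- exact: op_sample2_ge0.
- exact: (exle_op_sample2 reg famz zQ B_gt0 kK aUb).
- exact: (exle_drift reg famz zQ B_gt0 alpha_ge0 xu' kK).
Qed.

Let spread k w := Num.sqrt (jac_dist2 U Ub k w).

Let spread_sqr k w : spread k w ^+ 2 = jac_dist2 U Ub k w.
Proof. by rewrite sqr_sqrtr// jac_dist2_ge0. Qed.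

Let mspread k : (k <= K)%N -> measurable_fun [set: Omega] (spread k).
Proof. by move=> kK; apply: measurable_fun_sqrt; exact: mdist2. Qed.

Lemma exle_spread k : (k <= K)%N -> exle P (spread k) (spread_const L k * (b * y)).
Proof.
elim: k => [_|k IH kK].
  rewrite mul0r; apply: exle_cst => w; first exact: sqrtr_ge0.
  rewrite /spread /jac_dist2 /mean big1 ?mulr0 ?sqrtr0// => j _.
  by rewrite subrr norm2_0 expr0n.
have {}IH := IH (ltnW kK).
apply: le_trans (ex_sqrt_jac_dist2S reg B famz zQ kK aU aUb) _.
have -> : spread_const L k.+1 * (b * y) = 3 * L * (spread_const L k * (b * y)) +
    L * ((g k + drift_const L k) * (b * y)) + 0.
  by rewrite /= -/(g k); ring.
apply: (@exle_lin2 _ _ _ _ _ (spread k) (mix k)) => //.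
- by rewrite mulr_ge0.
(* Compared in squares: 9 L^2 covers the 8 L^2 of the spread, and by [mix_sqr] the square of L mix
   covers the product term. *)
- move=> w; rewrite addr0 -spread_sqr -/(distU k w).
  have h0 : 0 <= spread k w by exact: sqrtr_ge0.
  have h1 := mix_ge0 k w; have h2 := mix_sqr k w.
  have l2 : 0 <= L ^+ 2 by exact: sqr_ge0.
  have hAD : 0 <= op_sample2 Ub k w * distU k w.
    by rewrite mulr_ge0 ?op_sample2_ge0 ?sqr_ge0.
  rewrite -[leRHS]ger0_norm ?addr_ge0 ?mulr_ge0// -sqrtr_sqr ler_wsqrtr//.
  have h3 : L ^+ 2 * (4 * (op_sample2 Ub k w * distU k w)) <= L ^+ 2 * mix k w ^+ 2.
    exact: ler_wpM2l.
  have h4 : 0 <= L ^+ 2 * (spread k w * mix k w) by rewrite !mulr_ge0.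
  have h5 : 0 <= L ^+ 2 * spread k w ^+ 2 by rewrite mulr_ge0// sqr_ge0.
  have h6 : 0 <= L ^+ 2 * (op_sample2 Ub k w * distU k w) by rewrite mulr_ge0.
  rewrite sqrrD !exprMn; lra.
- by apply: mspread; exact: ltnW.
- by apply: mmix; exact: ltnW.
- by move=> w; exact: sqrtr_ge0.
- by apply: exle_mix; exact: ltnW.
Qed.

Let noise_gap k w := batch_mean B (fun j =>
  jac_step_noise U k j w (z k j w) - jac_step_noise Ub k j w (z k j w)).

(** Averaging the increments gives a second factor 1 / sqrt B, next to the one already contained in
    the bounds of [spread] and [mix]. *)
Lemma exle_noise_gap k : (k < K)%N -> exle P (fun w => norm2 (noise_gap k w))
  (2 * L * (spread_const L k + (g k + drift_const L k)) * (y / B%:R)).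
Proof.
move=> kK; apply: le_trans (ex_step_noiseB reg B famz zQ kK aU aUb) _.
have -> : 2 * L * (spread_const L k + (g k + drift_const L k)) * (y / B%:R) =
    b * (2 * L) * (spread_const L k * (b * y)) +
    b * (2 * L) * ((g k + drift_const L k) * (b * y)) + 0.
  by rewrite -/bi -bb; ring.
have bL : 0 <= b * (2 * L) by rewrite !mulr_ge0// ltW.
apply: (@exle_lin2 _ _ _ _ _ (spread k) (mix k)) => //.
- move=> w; rewrite addr0 -spread_sqr -/(distU k w).
  have h0 : 0 <= spread k w by exact: sqrtr_ge0.
  have h1 := mix_ge0 k w; have h2 := mix_sqr k w.
  have l2 : 0 <= bi * L ^+ 2 by rewrite mulr_ge0 ?sqr_ge0// ltW.
  have hAD : 0 <= op_sample2 Ub k w * distU k w.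
    by rewrite mulr_ge0 ?op_sample2_ge0 ?sqr_ge0.
  rewrite -[leRHS]ger0_norm ?addr_ge0 ?mulr_ge0//; try exact: ltW.
  rewrite -sqrtr_sqr ler_wsqrtr//.
  have h3 : bi * L ^+ 2 * (4 * (op_sample2 Ub k w * distU k w)) <=
      bi * L ^+ 2 * mix k w ^+ 2 by exact: ler_wpM2l.
  have h4 : 0 <= bi * L ^+ 2 * (spread k w * mix k w) by rewrite mulr_ge0// mulr_ge0.
  have h5 : 0 <= bi * L ^+ 2 * spread k w ^+ 2 by rewrite mulr_ge0// sqr_ge0.
  have h6 : 0 <= bi * L ^+ 2 * (op_sample2 Ub k w * distU k w) by rewrite mulr_ge0.
  rewrite -/bi -mulrDr [leRHS]exprMn (exprMn _ b) (expr2 b) bb.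
  have -> : bi * (2 * L) ^+ 2 * (spread k w + mix k w) ^+ 2 =
    4 * (bi * L ^+ 2 * spread k w ^+ 2) + 8 * (bi * L ^+ 2 * (spread k w * mix k w)) +
    4 * (bi * L ^+ 2 * mix k w ^+ 2) by ring.
  lra.
- by apply: mspread; exact: ltnW.
- by apply: mmix; exact: ltnW.
- by move=> w; exact: sqrtr_ge0.
- by apply: exle_spread; exact: ltnW.
- by apply: exle_mix; exact: ltnW.
Qed.

Let merror (a : process) k : (k <= K)%N -> adapted K z a -> mxmeas (jac_error a k).
Proof.
by move=> kK aa; apply: (mxmeas_history famz (mxmeas_jac_error reg _ kK aa)).
Qed.

Lemma exle_bias k : (k <= K)%N ->
  exle P (fun w => norm2 (jac_error U k w - jac_error Ub k w)) (bias_const L k * (y / B%:R)).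
Proof.
elim: k => [_|k IH kK].
  rewrite mul0r; apply: exle_cst => w; first exact: norm2_ge0.
  by rewrite /jac_error /= subrr norm2_0.
have {}IH := IH (ltnW kK).
have [_ _ lJ] := levels_smooth reg kK.
(* The error at the predictor times the change of the true Jacobian is split by AM-GM with weights
   alpha and 1 / alpha: the second moments are of orders 1 / B and alpha^2 (1 + S) / B, so both
   parts are O(alpha (1 + S) / B). *)
pose F w := L * norm2 (jac_error U k w - jac_error Ub k w) +
  (L * alpha * norm2 (jac_error Ub k w) ^+ 2 + L / alpha * distU k w).
have F0 w : 0 <= F w.
  apply: addr_ge0; first by rewrite mulr_ge0 ?norm2_ge0.
  by apply: addr_ge0; apply: mulr_ge0; rewrite ?sqr_ge0.
have mb : measurable_fun [set: Omega] (fun w => norm2 (jac_error U k w - jac_error Ub k w)).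
  by apply: measurable_norm2; apply: mxmeasB; apply: merror => //; exact: ltnW.
have mPhi : measurable_fun [set: Omega] (fun w => norm2 (jac_error Ub k w) ^+ 2).
  by apply: measurable_funX; apply: measurable_norm2; apply: merror => //; exact: ltnW.
have md := mdist (ltnW kK).
have mF : measurable_fun [set: Omega] F.
  by apply: measurable_funD; [|apply: measurable_funD]; apply: measurable_funM.
have mgap : measurable_fun [set: Omega] (fun w => norm2 (noise_gap k w)).
  apply: measurable_norm2; apply: mxmeas_batch_mean => j _.
  apply: (mxmeas_history famz (k := k.+1)).
  have mn (a : process) : adapted K z a ->
      mxmeas ((fun w => jac_step_noise a k j w (z k j w)) : history k.+1 -> _).
    move=> aa; apply: mxmeasM.
      by apply: mxmeas_historyS; exact: (mxmeas_jac_sample reg j (ltnW kK) aa).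
    apply: mxmeasB; last first.
      by apply: mxmeas_historyS; exact: (mxmeas_adapted_J reg kK aa).
    apply: (mxmeas_oracle (levels_measurable reg kK).2).
      by apply: mxmeas_historyS; exact: (aa _ (ltnW kK)).
    exact: measurable_sample_history.
  exact: mxmeasB (mn _ aU) (mn _ aUb).
have -> : bias_const L k.+1 * (y / B%:R) =
   (L * (bias_const L k * (y / B%:R)) +
    L * (k%:R * g k + drift_const L k) * (y / B%:R)) +
   2 * L * (spread_const L k + (g k + drift_const L k)) * (y / B%:R).
  by rewrite /= -/(g k); ring.
apply: (@exle_le _ _ _ _ _ (fun w => F w + norm2 (noise_gap k w))).
- by move=> w; exact: norm2_ge0.
- move=> w; have -> : jac_error U k.+1 w - jac_error Ub k.+1 w =
    (jac_error U k w - jac_error Ub k w) *m 'J (@f k) (U k w) +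
    jac_error Ub k w *m ('J (@f k) (U k w) - 'J (@f k) (Ub k w)) + noise_gap k w.
    rewrite /noise_gap batch_meanB.
    rewrite (jac_errorS f Jo z B U k w) (jac_errorS f Jo z B Ub k w).
    exact: mulmx_diff_split.
  rewrite (le_trans (norm2D _ _))// lerD2r (le_trans (norm2D _ _))// lerD//.
    by apply: opbound_mull; exact: (opbound_J reg).
  set p := norm2 (jac_error Ub k w); set e := norm2 (U k w - Ub k w).
  have p0 : 0 <= p by exact: norm2_ge0.
  have e0 : 0 <= e by exact: norm2_ge0.
  apply: (@le_trans _ _ (L * e * p)).
    apply: (le_trans (opbound_mull _ (opbound_norm2 _))).
    by rewrite ler_wpM2r//; exact: lJ.
  rewrite /distU -/e -!mulrA -mulrDr ler_wpM2l//.
  rewrite -subr_ge0.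
  have -> : alpha * p ^+ 2 + alpha^-1 * e ^+ 2 - e * p =
      (3 / 4) * (alpha * p ^+ 2) + alpha^-1 * (e - alpha * p / 2) ^+ 2.
    by field; rewrite gt_eqF.
  by apply: addr_ge0; rewrite mulr_ge0 ?sqr_ge0 ?invr_ge0// mulr_ge0// sqr_ge0.
apply: exleD => //.
- by move=> w; exact: norm2_ge0.
- apply: exleD => //.
  + by apply: measurable_funM.
  + by apply: measurable_funD; apply: measurable_funM.
  + by move=> w; rewrite mulr_ge0// norm2_ge0.
  + by move=> w; apply: addr_ge0; apply: mulr_ge0; rewrite ?sqr_ge0.
  + by apply: exleZ => // w; exact: norm2_ge0.
  + apply: (@exleW _ _ _ _ _ (L * alpha * (k%:R * g k * B%:R^-1) +
      L / alpha * (drift_const L k * (q / B%:R)) + 0)).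
      rewrite addr0 -/bi -!(mulrA L) -mulrDr; apply: ler_wpM2l => //.
      rewrite mulrDl lerD//.
        have -> : alpha * (k%:R * g k * bi) = (k%:R * g k * bi) * alpha by ring.
        have -> : k%:R * g k * (y * bi) = (k%:R * g k * bi) * y by ring.
        apply: ler_wpM2l => //; apply: mulr_ge0; last exact: ltW.
        by rewrite mulr_ge0.
      rewrite qy le_eqVlt; apply/orP; left; apply/eqP.
      by field; rewrite gt_eqF.
    apply: (@exle_lin2 _ _ _ _ _ (fun w => norm2 (jac_error Ub k w) ^+ 2) (distU k)) => //.
    * by move=> w; apply: addr_ge0; apply: mulr_ge0; rewrite ?sqr_ge0.
    * by move=> w; rewrite addr0.
    * by move=> w; exact: sqr_ge0.
    * exact: (exle_jac_error reg famz zQ B_gt0 (ltnW kK) aUb).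
    * exact: (exle_drift reg famz zQ B_gt0 alpha_ge0 xu' (ltnW kK)).
- exact: exle_noise_gap.
Qed.

Hypothesis alpha_le1 : alpha <= 1.

Let bi_ge0 : 0 <= bi. Proof. by rewrite invr_ge0. Qed.
Let l2 : 0 <= L ^+ 2. Proof. exact: sqr_ge0. Qed.

Let mart k p (M M' : 'M[R]_((d k).+1, p)) w :=
  jac_error Ub k w *m M - (1 - alpha) *: (jac_error Up k w *m M').

Let mmart k p (c : 'M[R]_((d 0%N).+1, p)) (M M' : 'M[R]_((d k).+1, p)) :
  (k <= K)%N -> mxmeas ((fun w => c + mart M M' w) : history k -> _).
Proof.
move=> kK; apply: mxmeasD; first exact: mxmeas_cst.
apply: mxmeasB.
  by apply: mxmeasM; [exact: (mxmeas_jac_error reg B kK aUb)|exact: mxmeas_cst].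
apply: mxmeasZ; first exact: measurable_cst.
by apply: mxmeasM; [exact: (mxmeas_jac_error reg B kK aUp)|exact: mxmeas_cst].
Qed.

Let martS k p (c : 'M[R]_((d 0%N).+1, p)) (M M' : 'M[R]_((d k.+1).+1, p)) w :
  c + mart M M' w =
  (c + mart ('J (@f k) (ubar k) *m M) ('J (@f k) (u' k) *m M') w) +
  batch_mean B (fun j => jac_step_noise Ub k j w (z k j w) *m M -
     (1 - alpha) *: (jac_step_noise Up k j w (z k j w) *m M')).
Proof.
rewrite batch_meanB batch_meanZ -!batch_meanM /mart.
rewrite (jac_errorS f Jo z B Ub k w) (jac_errorS f Jo z B Up k w).
exact: momentum_mulmx_split.
Qed.

(** Induction peels off the last sampled level: its true Jacobians move into the suffixes [M] and
    [M'], which preserves the form of the statement, and its noise is centred given the lower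
    levels. Hence [c], the suffixes and their bounds [mu] and [t] all vary. *)
Lemma exle_martingale k p (c : 'M[R]_((d 0%N).+1, p)) (M M' : 'M[R]_((d k).+1, p))
    mu t : (k <= K)%N -> opbound M mu -> opbound M' mu -> 0 <= t ->
  norm2 (M - M') <= mu * t * Num.sqrt q ->
  exle P (fun w => norm2 (c + mart M M' w) ^+ 2)
    (norm2 c ^+ 2 + mu ^+ 2 * martingale_const L k t * (q / B%:R)).
Proof.
elim: k => [|k IH] in p c M M' mu t * => kK Mm Mm' t0 MM'.
  apply: exle_cst => w; first exact: sqr_ge0.
  rewrite mulr0 mul0r addr0 /mart /jac_error /jac_sample /jac_true /=.
  by rewrite !batch_mean_cst// !subrr !mul0mx scaler0 subrr addr0.
have [mu0 _] := Mm; have kK' := ltnW kK.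
have [_ _ lJ] := levels_smooth reg kK.
have JM : opbound ('J (@f k) (ubar k) *m M) (L * mu).
  by apply: opboundM => //; exact: (opbound_J reg).
have JM' : opbound ('J (@f k) (u' k) *m M') (L * mu).
  by apply: opboundM => //; exact: (opbound_J reg).
have sq0 : 0 <= Num.sqrt q by exact: sqrtr_ge0.
have JMM' : norm2 ('J (@f k) (ubar k) *m M - 'J (@f k) (u' k) *m M') <=
    L * mu * (t + (2 * L) ^+ k.+1) * Num.sqrt q.
  have -> : 'J (@f k) (ubar k) *m M - 'J (@f k) (u' k) *m M' =
      ('J (@f k) (ubar k) - 'J (@f k) (u' k)) *m M + 'J (@f k) (u' k) *m (M - M').
    exact: mulmxBB.
  have h1 : norm2 (('J (@f k) (ubar k) - 'J (@f k) (u' k)) *m M) <=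
      mu * (L * ((2 * L) ^+ k.+1 * Num.sqrt q)).
    rewrite (le_trans (opbound_mull _ Mm))// ler_wpM2l//.
    rewrite (le_trans (lJ _ _))// ler_wpM2l//.
    exact: (predictor_dist reg alpha_ge0 xu').
  have h2 : norm2 ('J (@f k) (u' k) *m (M - M')) <= L * (mu * t * Num.sqrt q).
    have JL := opbound_J reg (u' k) kK.
    by rewrite (le_trans (opbound_mulr _ JL))// ler_wpM2l.
  rewrite (le_trans (norm2D _ _))// (le_trans (lerD h1 h2))//.
  by rewrite le_eqVlt; apply/orP; left; apply/eqP; ring.
have t0' : 0 <= t + (2 * L) ^+ k.+1 by rewrite addr_ge0// exprn_ge0// mulr_ge0.
pose cw w := c + mart ('J (@f k) (ubar k) *m M) ('J (@f k) (u' k) *m M') w.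
have {}IH : exle P (fun w => norm2 (cw w) ^+ 2) _ :=
  IH p c _ _ (L * mu) (t + (2 * L) ^+ k.+1) kK' JM JM' t0' JMM'.
have -> : (fun w => norm2 (c + mart M M' w) ^+ 2) = fun w => norm2 (cw w +
  batch_mean B (fun j => jac_step_noise Ub k j w (z k j w) *m M -
     (1 - alpha) *: (jac_step_noise Up k j w (z k j w) *m M'))) ^+ 2.
  by apply/funext => w; rewrite martS.
apply: le_trans (ex_step_noise_mul reg B famz zQ kK aUb aUp alpha (mmart c _ _ kK') Mm Mm') _.
set a1 := 6 * mu ^+ 2 * L ^+ 2 * bi.
set a2 := mu ^+ 2 * (24 * L ^+ 2 * E k + 3 * L ^+ 2 * (t ^+ 2 + 1)) * (q * bi).
have a10 : 0 <= a1 by rewrite !mulr_ge0// sqr_ge0.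
have a20 : 0 <= a2.
  apply: mulr_ge0; last exact: mulr_ge0.
  apply: mulr_ge0; first exact: sqr_ge0.
  by apply: addr_ge0; apply: mulr_ge0; rewrite ?E0 ?mulr_ge0// addr_ge0 ?sqr_ge0.
have -> : norm2 c ^+ 2 + mu ^+ 2 * martingale_const L k.+1 t * (q / B%:R) =
  (norm2 c ^+ 2 + (L * mu) ^+ 2 * martingale_const L k (t + (2 * L) ^+ k.+1) * (q / B%:R)) +
  (a1 * (diff_const L k * q) + a2 * g k + 0).
  by rewrite /= /a1 /a2 -/(E k) -/(g k) -/bi; ring.
have d20 w : 0 <= jac_dist2 Ub Up k w by exact: jac_dist2_ge0.
have o20 w : 0 <= op_sample2 Up k w by exact: op_sample2_ge0.
have mD := mdist2 kK' aUb aUp; have mO := mop2 kK' aUp.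
apply: (@exle_le _ _ _ _ _ (fun w => norm2 (cw w) ^+ 2 +
  (a1 * jac_dist2 Ub Up k w + a2 * op_sample2 Up k w))).
- move=> w; apply: addr_ge0; first exact: sqr_ge0.
  apply: mulr_ge0 => //; apply: addr_ge0; apply: mulr_ge0.
  + by rewrite mulr_ge0// sqr_ge0.
  + apply: addr_ge0; apply: mulr_ge0 => //; try by rewrite mulr_ge0.
    by apply: mulr_ge0 => //; exact: sqr_ge0.
  + by rewrite mulr_ge0// addr_ge0 ?sqr_ge0// mulr_ge0 ?sqr_ge0.
  + exact: mulr_ge0.
- move=> w; rewrite lerD2l -/bi.
  have h1 := predictor_sqr_dist reg alpha_ge0 xu' kK'; rewrite -/(E k) in h1.
  have h2 : norm2 (M - M') ^+ 2 <= mu ^+ 2 * t ^+ 2 * q.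
    rewrite -(sqr_sqrtr q0) -!exprMn.
    by rewrite ler_sqr ?nnegrE ?norm2_ge0 ?mulr_ge0.
  have h3 : alpha ^+ 2 <= q by exact: sqr_alpha_le.
  set D := jac_dist2 _ _ _ _; set O := op_sample2 _ _ _.
  have O0 : 0 <= O by exact: o20.
  have h4 : O * norm2 (Ub k w - Up k w) ^+ 2 <= O * (E k * q) by exact: ler_wpM2l.
  have h5 : alpha ^+ 2 * mu ^+ 2 <= q * mu ^+ 2 by rewrite ler_wpM2r// sqr_ge0.
  have -> : a1 * D + a2 * O = bi * (3 * mu ^+ 2 * (2 * L ^+ 2 * D +
      8 * L ^+ 2 * (O * (E k * q))) +
      3 * (mu ^+ 2 * t ^+ 2 * q + q * mu ^+ 2) * (L ^+ 2 * O)).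
    by rewrite /a1 /a2; ring.
  apply: ler_wpM2l => //; apply: lerD.
    apply: ler_wpM2l; first by rewrite mulr_ge0// sqr_ge0.
    by rewrite lerD2l; apply: ler_wpM2l => //; rewrite mulr_ge0.
  apply: ler_wpM2r; first exact: mulr_ge0.
  by apply: ler_wpM2l => //; exact: lerD.
apply: exleD => //.
- apply: measurable_funX; apply: measurable_norm2.
  exact: (mxmeas_history famz (mmart c _ _ kK')).
- by apply: measurable_funD; apply: measurable_funM.
- by move=> w; exact: sqr_ge0.
- by move=> w; apply: addr_ge0; apply: mulr_ge0.
- apply: (@exle_lin2 _ _ _ _ _ (jac_dist2 Ub Up k) (op_sample2 Up k)) => //.
  + by move=> w; apply: addr_ge0; apply: mulr_ge0.
  + by move=> w; rewrite addr0.
  + exact: (exle_predictor_dist2 kK').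
  + exact: (exle_op_sample2 reg famz zQ B_gt0 kK' aUp).
Qed.

Lemma exle_soft_gradient (v : 'M[R]_((d 0%N).+1, (d K).+1)) :
  exle P (fun w => soft_norm2 alpha
      ((1 - alpha) *: v + batch_mean B (fun j => jac_sample U K j w)
       - (1 - alpha) *: batch_mean B (fun j => jac_sample Up K j w)
       - jac_true U K w))
    ((1 - alpha) * soft_norm2 alpha (v - jprod (fun i => 'J (@f i) (u' i)) K)
     + alpha ^+ 2 + (martingale_const L K 0 + bias_const L K) * (y / B%:R)).
Proof.
set e := v - _; pose c := (1 - alpha) *: e.
pose n w := @mart K (d K).+1 1%:M 1%:M w.
pose bw w := jac_error U K w - jac_error Ub K w.
have mc0 := martingale_const_ge0 0 K L0.
have yb0 : 0 <= y / B%:R by rewrite divr_ge0.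
have cn : exle P (fun w => norm2 (c + n w) ^+ 2)
    (norm2 c ^+ 2 + martingale_const L K 0 * (q / B%:R)).
  have h0 : norm2 (1%:M - 1%:M : 'M[R]_((d K).+1)) <= 1 * 0 * Num.sqrt q.
    by rewrite subrr norm2_0 mulr0 mul0r.
  have := @exle_martingale K _ c 1%:M 1%:M 1 0 (leqnn K)
    (opbound1 R _) (opbound1 R _) (lexx 0) h0.
  by rewrite expr1n mul1r.
have mn : mxmeas (fun w => c + n w).
  exact: (mxmeas_history famz (mmart c _ _ (leqnn K))).
apply: (@exle_le _ _ _ _ _ (fun w => soft_norm2 alpha (c + n w) + norm2 (bw w))).
- by move=> w; exact: soft_norm2_ge0.
- move=> w; rewrite (_ : _ - jac_true U K w = (c + n w) + bw w).
    exact: soft_norm2D.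
  rewrite /c /e /n /mart /bw /jac_error.
  exact: momentum_error_split.
rewrite (mulrDl (martingale_const L K 0)) addrA; apply: exleD => //.
- apply: measurable_fun_sqrt; apply: measurable_funD => //.
  by apply: measurable_funX; exact: measurable_norm2.
- apply: measurable_norm2; apply: mxmeasB;
    exact: (mxmeas_history famz (mxmeas_jac_error reg B (leqnn K) _)).
- by move=> w; exact: soft_norm2_ge0.
- by move=> w; exact: norm2_ge0.
(* Jensen's inequality brings the variance under the root; [sqrtD_le] then takes it out as q /
   (alpha B) = y / B. *)
- apply: (@exleW _ _ _ _ _ (Num.sqrt (alpha ^+ 2 + norm2 c ^+ 2 +
      martingale_const L K 0 * (q / B%:R)))).
    have v0 : 0 <= martingale_const L K 0 * (q / B%:R) by rewrite mulr_ge0// divr_ge0.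
    apply: (le_trans (sqrtD_le alpha_gt0 v0 _)); first by rewrite lerDl sqr_ge0.
    apply: lerD; first by apply: soft_norm2_contract; rewrite alpha_ge0.
    rewrite le_eqVlt; apply/orP; left; apply/eqP.
    by field; rewrite pnatr_eq0 -lt0n B_gt0 gt_eqF.
  apply: exle_sqrt.
  + by rewrite addr_ge0 ?mulr_ge0 ?divr_ge0// addr_ge0 ?sqr_ge0.
  + apply: measurable_funD => //.
    by apply: measurable_funX; exact: measurable_norm2.
  + by move=> w; rewrite addr_ge0 ?sqr_ge0.
  + rewrite -addrA; apply: exleD => //.
    * by apply: measurable_funX; exact: measurable_norm2.
    * by move=> w; exact: sqr_ge0.
    * by move=> w; exact: sqr_ge0.
    * by apply: exle_cst => // w; exact: sqr_ge0.
- exact: (exle_bias (leqnn K)).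
Qed.

Lemma exle_tracking : exle P (fun w => tracking f K (fun k => updated k w))
  ((1 - alpha) ^+ 2 * s + (\sum_(k < K) drift_const L k.+1) * (q / B%:R)).
Proof.
rewrite /tracking big_distrr big_distrl -big_split /=.
apply: (@exle_sum _ _ _ _ K (fun k w => norm2 (updated k.+1 w - f (updated k w)) ^+ 2)
  (fun k => (1 - alpha) ^+ 2 * norm2 (u' k.+1 - f (u' k)) ^+ 2 +
            drift_const L k.+1 * (q / B%:R))).
- move=> k kK; have [lf _ _] := levels_smooth reg kK.
  apply: measurable_funX; apply: measurable_norm2; apply: mxmeasB.
    exact: (mxmeas_updated reg B famz u' x alpha kK).
  apply: (mxmeas_lipschitz lf).
  exact: (mxmeas_updated reg B famz u' x alpha (ltnW kK)).
- by move=> k w _; exact: sqr_ge0.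
by move=> k kK; exact: (exle_tracking_level reg famz zQ B_gt0 alpha_ge0 xu').
Qed.

End one_gradient_update.

(** * The potential and its descent *)

Section objective_geometry.
Context (R : realType) (K : nat) (L : R) (d : nat -> nat)
  (f : forall i, 'rV[R]_(d i).+1 -> 'rV[R]_(d i.+1).+1).
Hypothesis L1 : 1 <= L.
Hypothesis smooth : smooth_levels K L L f.

Let L0 : 0 <= L. Proof. exact: le_trans L1. Qed.
Let Ln k : 1 <= L ^+ k. Proof. exact: exprn_ege1. Qed.
Let Ln0 k : 0 <= L ^+ k. Proof. exact: exprn_ge0. Qed.

Definition true_gradient (u : forall i, 'rV[R]_(d i).+1) k :=
  jprod (fun i => 'J (@f i) (u i)) k.

Lemma true_gradientS u k :
  true_gradient u k.+1 = true_gradient u k *m 'J (@f k) (u k).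
Proof. by []. Qed.

Let id_diff (x : 'rV[R]_(d 0%N).+1) :
  differentiable (compose f 0) x /\ 'd (compose f 0) x = id :> (_ -> _).
Proof.
have -> : compose f 0 = id by [].
by split; [exact: (@ex_diff _ _ _ _ _ id id _)|exact: (@diff_val _ _ _ _ _ id id _)].
Qed.

Lemma compose_differentiable k x : (k <= K)%N ->
  differentiable (compose f k) x.
Proof.
elim: k => [_|k IH kK]; first exact: (id_diff x).1.
have [_ df _] := smooth kK.
apply: (@differentiable_comp _ _ _ _ (compose f k) (@f k)); last exact: df.
exact/IH/ltnW.
Qed.

Lemma jacobian_compose k x : (k <= K)%N ->
  'J (compose f k) x = true_gradient (fun i => compose f i x) k.
Proof.
elim: k => [_|k IH kK].
  rewrite /true_gradient /=; apply/row_matrixP => i.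
  have [did dE] := id_diff x.
  by rewrite !rowE -deriveEjacobian// mulmx1 deriveE// dE.
have [_ df _] := smooth kK.
rewrite true_gradientS -IH; last exact: ltnW.
apply/row_matrixP => i; rewrite !rowE.
have dk := compose_differentiable x (ltnW kK).
rewrite -deriveEjacobian; last exact: compose_differentiable.
rewrite mulmxA -deriveEjacobian; last exact: df.
rewrite -deriveEjacobian// !deriveE; last 3 first.
- exact: dk.
- exact: df.
- exact: compose_differentiable.
exact: (congr1 (fun h => h (delta_mx 0 i)) (diff_comp dk (df _))).
Qed.

Lemma compose_lipschitz k : (k <= K)%N -> lipschitz2 (L ^+ k) (compose f k).
Proof.
elim: k => [_|k IH kK] x y; first by rewrite expr0 mul1r.
have [lf _ _] := smooth kK.
by rewrite /= exprS (le_trans (lf _ _))// -mulrA ler_wpM2l//; exact/IH/ltnW.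
Qed.

Lemma opbound_true_gradient u k : (k <= K)%N -> opbound (true_gradient u k) (L ^+ k).
Proof.
elim: k => [_|k IH kK]; first by rewrite expr0; exact: opbound1.
have [lf df _] := smooth kK.
rewrite exprSr; apply: opboundM; first exact/IH/ltnW.
exact: lipschitz2_opbound.
Qed.

Lemma true_gradient_dist u u' k : (k <= K)%N ->
  norm2 (true_gradient u k - true_gradient u' k) <=
  L ^+ k * \sum_(i < k) norm2 (u i - u' i).
Proof.
elim: k => [_|k IH kK].
  by rewrite /true_gradient /= subrr norm2_0 mulr_ge0 ?sumr_ge0// => i _; exact: norm2_ge0.
have [lf df lJ] := smooth kK.
rewrite !true_gradientS mulmxBB big_ord_recr /= mulrDr.
rewrite (le_trans (norm2D _ _))// lerD//.
  rewrite (le_trans (opbound_mull _ (lipschitz2_opbound L0 lf (df _))))//.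
  by rewrite exprS -mulrA ler_wpM2l//; exact/IH/ltnW.
rewrite (le_trans (opbound_mulr _ (opbound_true_gradient _ (ltnW kK))))//.
by rewrite exprSr -mulrA ler_wpM2l.
Qed.

Let sum_norm_ge0 (F : nat -> R) k : (forall i, 0 <= F i) -> 0 <= \sum_(i < k) F i.
Proof. by move=> F0; apply: sumr_ge0. Qed.

Definition level_error (u : forall i, 'rV[R]_(d i).+1) i := norm2 (u i.+1 - f (u i)).

Lemma compose_dist u k : (k <= K)%N ->
  norm2 (u k - compose f k (u 0%N)) <= L ^+ k * \sum_(i < k) level_error u i.
Proof.
elim: k => [_|k IH kK]; first by rewrite subrr norm2_0 big_ord0 mulr0.
have [lf df lJ] := smooth kK.
have e0 i : 0 <= level_error u i by exact: norm2_ge0.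
have -> : u k.+1 - compose f k.+1 (u 0%N) =
    (u k.+1 - f (u k)) + (f (u k) - f (compose f k (u 0%N))).
  by rewrite addrA subrK.
rewrite (le_trans (norm2D _ _))// addrC big_ord_recr /= mulrDr lerD//.
  rewrite (le_trans (lf _ _))// exprS -mulrA ler_wpM2l//; exact/IH/ltnW.
by rewrite -[leLHS]mul1r; apply: ler_wpM2r; [exact: e0|exact: Ln].
Qed.

(** A Lipschitz constant of the gradient: one of K factors changes at a time, the product of
    Jacobians costs L^K and the distance of the inner points another L^K. It also converts level
    errors into gradient error. *)
Definition grad_const : R := K%:R * (L ^+ K * L ^+ K).

Lemma grad_const_ge0 : 0 <= grad_const.
Proof. by rewrite !mulr_ge0. Qed.

Let Lmono k : (k <= K)%N -> L ^+ k <= L ^+ K.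
Proof. by move=> kK; rewrite ler_weXn2l. Qed.

Lemma gradient_estimate_dist u :
  norm2 (true_gradient u K - 'J (compose f K) (u 0%N)) <=
  grad_const * \sum_(i < K) level_error u i.
Proof.
rewrite jacobian_compose// (le_trans (true_gradient_dist _ _ _))//.
have e0 i : 0 <= level_error u i by exact: norm2_ge0.
rewrite /grad_const (mulrCA K%:R) -mulrA ler_wpM2l//.
rewrite [leRHS](_ : _ = \sum_(k < K) (L ^+ K * \sum_(i < K) level_error u i)); last first.
  by rewrite sumr_const card_ord -[RHS]mulr_natl mulrA.
apply: ler_sum => k _; rewrite (le_trans (compose_dist u (ltnW (ltn_ord k))))//.
apply: ler_pM => //; first exact: sum_norm_ge0.
  exact/Lmono/ltnW.
rewrite (big_ord_widen _ (fun i => level_error u i) (ltnW (ltn_ord k))).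
by rewrite [leRHS](bigID (fun i : 'I_K => (i < k)%N)) /= lerDl sumr_ge0.
Qed.

Lemma objective_gradient_lipschitz x y :
  norm2 ('J (compose f K) x - 'J (compose f K) y) <= grad_const * norm2 (x - y).
Proof.
rewrite !jacobian_compose// (le_trans (true_gradient_dist _ _ _))//.
rewrite /grad_const (mulrCA K%:R) -mulrA ler_wpM2l//.
rewrite [leRHS](_ : _ = \sum_(k < K) (L ^+ K * norm2 (x - y))); last first.
  by rewrite sumr_const card_ord -[RHS]mulr_natl mulrA.
apply: ler_sum => k _; rewrite (le_trans (compose_lipschitz (ltnW (ltn_ord k)) _ _))//.
by rewrite ler_wpM2r ?norm2_ge0//; exact/Lmono/ltnW.
Qed.

Lemma innerDl m n (x y : 'rV[R]_m) (v : 'M[R]_(m, n.+1)) :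
  inner (x + y) v = inner x v + inner y v.
Proof. by rewrite /inner mulmxDl mxE. Qed.

Lemma innerNl m n (x : 'rV[R]_m) (v : 'M[R]_(m, n.+1)) : inner (- x) v = - inner x v.
Proof. by rewrite /inner mulNmx mxE. Qed.

Lemma innerZl m n a (x : 'rV[R]_m) (v : 'M[R]_(m, n.+1)) :
  inner (a *: x) v = a * inner x v.
Proof. by rewrite /inner -scalemxAl mxE. Qed.

Lemma innerBr m n (x : 'rV[R]_m) (v w : 'M[R]_(m, n.+1)) :
  inner x (v - w) = inner x v - inner x w.
Proof. by rewrite /inner mulmxBr !mxE. Qed.

Context (X : set 'rV[R]_(d 0%N).+1) (Fstar : R)
  (lmo : 'M[R]_((d 0%N).+1, (d K).+1) -> 'rV[R]_(d 0%N).+1).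
Hypothesis feasX : feasible_set L X.
Hypothesis minX : is_min_on X (objective f K) Fstar.
Hypothesis convF : convex_objective f K X.
Hypothesis lmoX : linear_minimizer X lmo.

Definition gap x := objective f K x - Fstar.

Lemma gap_ge0 x : X x -> 0 <= gap x.
Proof. by move=> Xx; rewrite subr_ge0; exact: minX.2. Qed.

Lemma conditional_gradient_in eta x v : 0 <= eta <= 1 -> X x ->
  X (x + eta *: (lmo v - x)).
Proof.
move=> /andP[e0 e1] Xx; have [_ cX _] := feasX; have [Xz _] := lmoX v.
have := cX (lmo v) x (Itv01 e0 e1); rewrite !inE => /(_ Xz Xx).
rewrite /conv /= /unstable.onem scalerBl scale1r addrCA -scalerBr.
exact.
Qed.

(* convexity at the new point replaces the descent lemma *)
Lemma gap_step eta x v : 0 <= eta <= 1 -> X x ->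
  gap (x + eta *: (lmo v - x)) <= (1 - eta) * gap x +
    eta * L * norm2 (v - 'J (compose f K) x) + grad_const * (eta * L) ^+ 2.
Proof.
move=> eta01 Xx; have [e0 e1] := andP eta01.
have [_ _ diam] := feasX; have [Xz zmin] := lmoX v.
have [[xs Xxs Fxs] _] := minX.
set z := lmo v in Xz zmin *; set x' := x + _.
have Xx' : X x' by exact: conditional_gradient_in.
have h1 := convF Xx' Xx; have h2 := convF Xx Xxs.
have xx' : x' - x = eta *: (z - x) by rewrite /x' addrC addKr.
have nx : norm2 (x' - x) <= eta * L.
  by rewrite xx' norm2Z ger0_norm// ler_wpM2l//; exact: diam.
set g := 'J (compose f K) x in h2 *; set g' := 'J (compose f K) x' in h1.
have h3 : inner (x - x') g' = - (inner (x' - x) g + inner (x' - x) (g' - g)).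
  rewrite (innerBr (x' - x) g' g) (addrC (inner (x' - x) g)) subrK.
  by rewrite -innerNl opprB.
have h4 : inner (x' - x) (g' - g) <= grad_const * (eta * L) ^+ 2.
  rewrite (le_trans (ler_norm _))// (le_trans (inner_le _ _))//.
  apply: (@le_trans _ _ (norm2 (x' - x) * (grad_const * norm2 (x' - x)))).
    by rewrite ler_wpM2l ?norm2_ge0// objective_gradient_lipschitz.
  rewrite mulrCA -expr2 ler_wpM2l ?grad_const_ge0//.
  by rewrite ler_sqr ?nnegrE ?norm2_ge0// mulr_ge0.
have h5 : inner (x' - x) g = eta * inner (z - x) g by rewrite xx' innerZl.
clearbody g g' x' z.
(* [z] is optimal for the estimate [v], not for [g]. Comparison with the minimiser [xs] of the
   objective costs the pairing of xs - z with v - g, bounded through the diameter. *)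
have h6 : inner (z - x) g <= inner (xs - x) g + L * norm2 (v - g).
  have a1 : inner (z - x) g = inner (xs - x) g + (inner z v - inner xs v)
     + inner (xs - z) (v - g).
    by rewrite !(innerDl, innerNl) !innerBr; ring.
  have a2 : inner (xs - z) (v - g) <= L * norm2 (v - g).
    rewrite (le_trans (ler_norm _))// (le_trans (inner_le _ _))//.
    by rewrite ler_wpM2r ?norm2_ge0//; exact: diam.
  by have := zmin xs Xxs; lra.
have h7 : eta * inner (z - x) g <= eta * (Fstar - objective f K x + L * norm2 (v - g)).
  by apply: ler_wpM2l => //; rewrite -Fxs; lra.
rewrite /gap; lra.
Qed.

End objective_geometry.

Section potential.
Context (R : realType) (K : nat) (L : R) (d : nat -> nat)
  (f : forall i, 'rV[R]_(d i).+1 -> 'rV[R]_(d i.+1).+1).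

Definition track_const : R := \sum_(k < K) drift_const L k.+1.
Definition grad_noise_const : R := martingale_const L K 0 + bias_const L K.
(** The summand L absorbs what the gap receives from the gradient error, the summand L [grad_const]
    what it receives from the level errors. *)
Definition pot_const : R := L * (1 + grad_const K L).
(** Collects, rounded up, the terms of order alpha^2 in [frozen_potential]. *)
Definition step_const : R :=
  L * grad_const K L * K%:R + grad_const K L * L ^+ 2 + 3 * pot_const.

(** One step adds noise of order alpha^3 to the tracking error; the division by alpha brings it to
    the order alpha^2 of the other terms. *)
Definition potential (Fstar alpha : R) (st : state R d K) : R :=
  gap K f Fstar (est st 0%N)
  + pot_const * soft_norm2 alpha (grad st - true_gradient f (est st) K)
  + pot_const * (tracking f K (est st) / alpha).
End potential.

(** * Measurability of the states of the algorithm *)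

Section measurable_states.
Context (R : realType) (K : nat) (L : R) (d : nat -> nat)
  (f : forall i, 'rV[R]_(d i).+1 -> 'rV[R]_(d i.+1).+1)
  (dX : measure_display) (Xi : measurableType dX) (Q : nat -> probability Xi R)
  (fo : forall i, 'rV[R]_(d i).+1 -> Xi -> 'rV[R]_(d i.+1).+1)
  (Jo : forall i, 'rV[R]_(d i).+1 -> Xi -> 'M[R]_((d i).+1, (d i.+1).+1)).
Hypothesis reg : regular_problem K L f Q fo Jo.
Context (lmo : 'M[R]_((d 0%N).+1, (d K).+1) -> 'rV[R]_(d 0%N).+1).
Hypothesis mlmo : measurable_fun [set: borel_mx R (d 0%N).+1 (d K).+1]
  (lmo : _ -> borel_mx R 1 (d 0%N).+1).
Context (dT : measure_display) (T : measurableType dT).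

(** Only levels up to K matter, as the oracles are measurable below K. [T] is abstract so that it
    can be any sigma-algebra of draws or a product of two. *)
Definition mstate (st : T -> state R d K) :=
  (forall k, (k <= K)%N -> mxmeas (fun w => est (st w) k)) /\
  mxmeas (fun w => grad (st w)).

Lemma mxmeas_jprod (A : forall i, T -> 'M[R]_((d i).+1, (d i.+1).+1)) k :
  (forall i, (i < k)%N -> mxmeas (A i)) ->
  mxmeas (fun w => jprod (fun i => A i w) k).
Proof.
elim: k => [_|k IH mA]; first exact: mxmeas_cst.
apply: mxmeasM; last exact: mA.
by apply: IH => i ik; apply: mA; exact: leqW.
Qed.

Lemma mstate_step B eta alpha (z : nat -> nat -> T -> Xi) st :
  (forall i j, (i < K)%N -> measurable_fun setT (z i j)) -> mstate st ->
  mstate (fun w => pmvr_step fo Jo lmo B eta alpha (fun i j => z i j w) (st w)).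
Proof.
move=> mz [mu mg].
pose x w := est (st w) 0%N + eta *: (lmo (grad (st w)) - est (st w) 0%N).
have mx : mxmeas x.
  apply: mxmeasD; first exact: mu.
  apply: mxmeasZ; first exact: measurable_cst.
  by apply: mxmeasB; [exact: (mxmeas_borel mlmo mg)|exact: mu].
pose u k w := update_est fo B alpha (est (st w)) (x w) (fun i j => z i j w) k.
have mU k : (k <= K)%N -> mxmeas (u k).
  elim: k => [_|k IH kK]; first exact: mx.
  have [mf _] := levels_measurable reg kK.
  apply: mxmeasB.
    apply: mxmeasD; first by apply: mxmeasZ; [exact: measurable_cst|exact: mu].
    apply: (@mxmeas_batch_mean _ _ _ _ _ B (fun j w => fo (u k w) (z k j w))) => j _.
    by apply: (mxmeas_oracle mf); [exact/IH/ltnW|exact: mz].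
  apply: mxmeasZ; first exact: measurable_cst.
  apply: (@mxmeas_batch_mean _ _ _ _ _ B (fun j w => fo (est (st w) k) (z k j w))) => j _.
  by apply: (mxmeas_oracle mf); [exact/mu/ltnW|exact: mz].
split=> //.
have mJ (a : forall i, T -> 'rV[R]_(d i).+1) : (forall k, (k <= K)%N -> mxmeas (a k)) ->
    mxmeas (fun w => batch_mean B (fun j => jprod (fun i => @Jo i (a i w) (z i j w)) K)).
  move=> ma; apply: (@mxmeas_batch_mean _ _ _ _ _ B
    (fun j w => jprod (fun i => @Jo i (a i w) (z i j w)) K)) => j _.
  apply: mxmeas_jprod => i iK; have [_ mJi] := levels_measurable reg iK.
  by apply: (mxmeas_oracle mJi); [exact/ma/ltnW|exact: mz].
apply: mxmeasB.
  apply: mxmeasD; first by apply: mxmeasZ; [exact: measurable_cst|exact: mg].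
  exact: (mJ u mU).
apply: mxmeasZ; first exact: measurable_cst.
exact: (mJ (fun i w => est (st w) i) mu).
Qed.

Lemma mstate_pmvr B eta alpha (z : nat -> nat -> nat -> T -> Xi) st n :
  (forall t i j, (t <= n.+1)%N -> (i < K)%N -> measurable_fun setT (z t i j)) ->
  mstate st ->
  mstate (fun w => pmvr fo Jo lmo B eta alpha (fun t i j => z t i j w) (st w) n).
Proof.
elim: n => [//|n IH mz mst]; apply: (@mstate_step _ _ _ (z n.+2)).
  by move=> i j iK; exact: mz.
by apply: IH => // t i j tn; apply: mz; exact: leqW.
Qed.

Lemma mstate_init B x0 (z : nat -> nat -> T -> Xi) :
  (forall i j, (i < K)%N -> measurable_fun setT (z i j)) ->
  mstate (fun w => init_state K fo Jo B x0 (fun i j => z i j w)).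
Proof.
move=> mz; pose u k w := init_est fo B x0 (fun i j => z i j w) k.
have mU k : (k <= K)%N -> mxmeas (u k).
  elim: k => [_|k IH kK]; first exact: mxmeas_cst.
  have [mf _] := levels_measurable reg kK.
  apply: (@mxmeas_batch_mean _ _ _ _ _ B (fun j w => fo (u k w) (z k j w))) => j _.
  by apply: (mxmeas_oracle mf); [exact/IH/ltnW|exact: mz].
split=> //.
apply: (@mxmeas_batch_mean _ _ _ _ _ B
  (fun j w => jprod (fun i => @Jo i (u i w) (z i j w)) K)) => j _.
apply: mxmeas_jprod => i iK; have [_ mJi] := levels_measurable reg iK.
by apply: (mxmeas_oracle mJi); [exact/mU/ltnW|exact: mz].
Qed.

(** The random index has countably many values, along which a preimage is decomposed. *)
Lemma measurable_random_index d' (S : measurableType d') (F : nat -> T -> S)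
    (t : T -> nat) : (forall n, measurable_fun setT (F n)) ->
  measurable_fun setT t -> measurable_fun setT (fun w => F (t w) w).
Proof.
move=> mF mt _ Y mY; rewrite setTI.
rewrite [X in measurable X](_ : _ =
    \bigcup_n (t @^-1` [set n] `&` F n @^-1` Y)); last first.
  apply/seteqP; split => [w /= FY|w [n _ [/= <-]]//].
  by exists (t w).
apply: bigcupT_measurable => n; apply: measurableI.
  by rewrite -[X in measurable X]setTI; exact: mt.
by rewrite -[X in measurable X]setTI; exact: mF.
Qed.

Lemma mstate_random_index (st : nat -> T -> state R d K) (t : T -> nat) :
  (forall n, mstate (st n)) -> measurable_fun setT t ->
  mstate (fun w => st (t w) w).
Proof.
move=> mst mt; split=> [k kK|] i j.
  apply: (measurable_random_index (F := fun n w => est (st n w) k i j)) => // n.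
  by have [mu _] := mst n; exact: mu.
apply: (measurable_random_index (F := fun n w => grad (st n w) i j)) => // n.
by have [_ mg] := mst n; exact: mg.
Qed.

Lemma measurable_soft_norm2 alpha m n (F : T -> 'M[R]_(m, n)) : mxmeas F ->
  measurable_fun setT (fun w => soft_norm2 alpha (F w)).
Proof.
move=> mF; apply: measurable_fun_sqrt; apply: measurable_funD => //.
by apply: measurable_funX; exact: measurable_norm2.
Qed.

Lemma measurable_tracking st : mstate st ->
  measurable_fun setT (fun w => tracking f K (est (st w))).
Proof.
move=> [mu _]; apply: measurable_sum => k.
have [lf _ _] := levels_smooth reg (ltn_ord k).
apply: measurable_funX; apply: measurable_norm2; apply: mxmeasB; first exact: mu.
by apply: (mxmeas_lipschitz lf); exact/mu/ltnW.
Qed.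

Lemma mxmeas_grad_error st : mstate st ->
  mxmeas (fun w => grad (st w) - true_gradient f (est (st w)) K).
Proof.
move=> [mu mg]; apply: mxmeasB => //; apply: mxmeas_jprod => i iK.
have [_ _ lJ] := levels_smooth reg iK.
by apply: (mxmeas_lipschitz lJ); exact/mu/ltnW.
Qed.

Lemma measurable_gap Fstar st : mstate st ->
  measurable_fun setT (fun w => gap K f Fstar (est (st w) 0%N)).
Proof.
move=> [mu _]; apply: measurable_funB => //.
have lF := compose_lipschitz (const_ge1 reg) (levels_smooth reg) (leqnn K).
by apply: (mxmeas_lipschitz lF (mu 0%N isT)).
Qed.

Lemma measurable_potential Fstar alpha st : mstate st ->
  measurable_fun setT (fun w => potential L f Fstar alpha (st w)).
Proof.
move=> mst; apply: measurable_funD; first apply: measurable_funD.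
- exact: measurable_gap.
- apply: measurable_funM => //; apply: measurable_soft_norm2.
  exact: mxmeas_grad_error.
by apply: measurable_funM => //; apply: measurable_funM => //; exact: measurable_tracking.
Qed.

End measurable_states.

(** * Contraction of the potential in one step *)

Section one_step.
Context (R : realType) (K : nat) (L : R) (d : nat -> nat)
  (f : forall i, 'rV[R]_(d i).+1 -> 'rV[R]_(d i.+1).+1)
  (dX : measure_display) (Xi : measurableType dX) (Q : nat -> probability Xi R)
  (fo : forall i, 'rV[R]_(d i).+1 -> Xi -> 'rV[R]_(d i.+1).+1)
  (Jo : forall i, 'rV[R]_(d i).+1 -> Xi -> 'M[R]_((d i).+1, (d i.+1).+1)).
Hypothesis reg : regular_problem K L f Q fo Jo.
Context (dO : measure_display) (Omega : measurableType dO)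
  (P : probability Omega R) (z : nat -> nat -> {RV P >-> Xi}) (B : nat).
Hypothesis famz : indep_family P (sigma_sample z).
Hypothesis zQ : forall i j, (i < K)%N -> sampled_from (z i j) (Q i).
Hypothesis B_gt0 : (0 < B)%N.

Let L1 : 1 <= L := const_ge1 reg.
Let L0 : 0 <= L. Proof. exact: le_trans L1. Qed.

Context (X : set 'rV[R]_(d 0%N).+1) (Fstar : R)
  (lmo : 'M[R]_((d 0%N).+1, (d K).+1) -> 'rV[R]_(d 0%N).+1).
Hypothesis feasX : feasible_set L X.
Hypothesis minX : is_min_on X (objective f K) Fstar.
Hypothesis convF : convex_objective f K X.
Hypothesis lmoX : linear_minimizer X lmo.
Hypothesis mlmo : measurable_fun [set: borel_mx R (d 0%N).+1 (d K).+1]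
  (lmo : _ -> borel_mx R 1 (d 0%N).+1).

Let smooth := levels_smooth reg.
Let C1 : R := pot_const K L.
Let CF : R := grad_const K L.
Let CF0 : 0 <= CF. Proof. exact: grad_const_ge0. Qed.

Lemma pot_const_ge0 : 0 <= C1.
Proof. by rewrite mulr_ge0// addr_ge0. Qed.

Lemma potential_ge0 alpha (st : state R d K) : 0 <= alpha -> X (est st 0%N) ->
  0 <= potential L f Fstar alpha st.
Proof.
move=> a0 Xst; apply: addr_ge0; first apply: addr_ge0.
- exact: (gap_ge0 minX).
- by rewrite mulr_ge0 ?pot_const_ge0 ?soft_norm2_ge0.
- by rewrite mulr_ge0 ?pot_const_ge0// divr_ge0// tracking_ge0.
Qed.

(** The inequality e <= alpha + e^2 / alpha turns the norms that enter the gap into the squares that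
    the potential carries. *)
Lemma sum_level_error_le (u : forall i, 'rV[R]_(d i).+1) alpha : 0 < alpha ->
  \sum_(i < K) level_error f u i <= K%:R * alpha + tracking f K u / alpha.
Proof.
move=> a0.
have -> : K%:R * alpha = \sum_(i < K) alpha by rewrite sumr_const card_ord mulr_natl.
rewrite /tracking big_distrl -big_split /=; apply: ler_sum => i _.
rewrite -/(level_error f u i); set e := level_error f u i.
rewrite -subr_ge0 (_ : _ - _ = (3 / 4) * alpha + alpha^-1 * (e - alpha / 2) ^+ 2).
  apply: addr_ge0; apply: mulr_ge0; rewrite ?sqr_ge0 ?invr_ge0 ?ltW//.
by field; rewrite gt_eqF.
Qed.

Section step.
Context (alpha b : R) (st : state R d K).
Hypothesis alpha_gt0 : 0 < alpha.
Hypothesis alpha_le : alpha <= 1 / 2.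
Hypothesis track_le : track_const K L <= b.
Hypothesis noise_le : grad_noise_const K L <= b.
Hypothesis batch_ge : b <= B%:R * alpha.
Hypothesis Xst : X (est st 0%N).

Let next w := pmvr_step fo Jo lmo B (alpha / 2) alpha (fun i j => z i j w) st.
Let x' := est st 0%N + (alpha / 2) *: (lmo (grad st) - est st 0%N).

Let eta01 : 0 <= alpha / 2 <= 1.
Proof.
rewrite divr_ge0 ?(ltW alpha_gt0)//= ler_pdivrMr// mul1r (le_trans alpha_le)//.
by lra.
Qed.

Lemma frozen_in w : X (est (next w) 0%N).
Proof. exact: (conditional_gradient_in feasX lmoX). Qed.

Let xx' : norm2 (x' - est st 0%N) <= alpha * L.
Proof.
have [_ _ diam] := feasX; have [Xz _] := lmoX (grad st).
have l0 : 0 <= L := L0.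
have a0 := ltW alpha_gt0; have ah := alpha_le; have a2 : 0 <= alpha / 2 by lra.
rewrite /x' addrC addKr norm2Z ger0_norm//.
apply: (@le_trans _ _ (alpha / 2 * L)); first by rewrite ler_wpM2l ?diam.
by apply: ler_wpM2r => //; lra.
Qed.

Let scale_le c : c <= b -> c / B%:R <= alpha.
Proof.
by move=> cb; rewrite ler_pdivrMr ?ltr0n// mulrC (le_trans cb).
Qed.

Let s := tracking f K (est st).
Let s0 : 0 <= s. Proof. exact: tracking_ge0. Qed.

Lemma frozen_tracking : exle P (fun w => tracking f K (est (next w)))
  ((1 - alpha) ^+ 2 * s + alpha ^+ 3 * (1 + s)).
Proof.
apply: exleW (exle_tracking reg famz zQ B_gt0 (ltW alpha_gt0) xx').
rewrite -/s lerD2l -/(track_const K L).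
have -> : track_const K L * (alpha ^+ 2 * (1 + s) / B%:R) =
  track_const K L / B%:R * (alpha ^+ 2 * (1 + s)) by ring.
have -> : alpha ^+ 3 * (1 + s) = alpha * (alpha ^+ 2 * (1 + s)) by ring.
by rewrite ler_wpM2r ?scale_le// mulr_ge0 ?sqr_ge0// addr_ge0.
Qed.

Let psi := soft_norm2 alpha (grad st - true_gradient f (est st) K).

Lemma frozen_gradient : exle P (fun w =>
    soft_norm2 alpha (grad (next w) - true_gradient f (est (next w)) K))
  ((1 - alpha) * psi + alpha ^+ 2 + alpha ^+ 2 * (1 + s)).
Proof.
have ah := alpha_le; have a1 : alpha <= 1 by lra.
apply: exleW (exle_soft_gradient reg famz zQ B_gt0 (ltW alpha_gt0) xx' alpha_gt0 a1 (grad st)).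
rewrite -/s -/(true_gradient f (est st) K) -/psi lerD2l -/(grad_noise_const K L).
have -> : grad_noise_const K L * (alpha * (1 + s) / B%:R) =
  grad_noise_const K L / B%:R * (alpha * (1 + s)) by ring.
rewrite (_ : alpha ^+ 2 * (1 + s) = alpha * (alpha * (1 + s))); last by ring.
by rewrite ler_wpM2r ?scale_le// mulr_ge0 ?(ltW alpha_gt0)// addr_ge0.
Qed.

Lemma frozen_gap w : gap K f Fstar (est (next w) 0%N) <=
  (1 - alpha / 2) * gap K f Fstar (est st 0%N) +
  alpha / 2 * L * (psi + CF * (K%:R * alpha + s / alpha)) + CF * (alpha / 2 * L) ^+ 2.
Proof.
have a0 := ltW alpha_gt0; apply: (le_trans (gap_step L1 smooth feasX minX convF lmoX _ eta01 Xst)).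
rewrite lerD2r lerD2l ler_wpM2l//; first by rewrite mulr_ge0//; lra.
set g := 'J _ _; rewrite -(subrK (true_gradient f (est st) K) (grad st)) -addrA.
rewrite (le_trans (norm2D _ _))// lerD ?le_soft_norm2//.
rewrite (le_trans (gradient_estimate_dist L1 smooth _))// ler_wpM2l//.
exact: sum_level_error_le.
Qed.

Lemma frozen_potential : exle P (fun w => potential L f Fstar alpha (next w))
  ((1 - alpha / 2) * potential L f Fstar alpha st + step_const K L * alpha ^+ 2).
Proof.
have C10 := pot_const_ge0; have ah := alpha_le; have a0 := alpha_gt0.
have mnext : @mstate R K d _ Omega next.
  apply: (@mstate_step _ _ _ _ _ _ _ _ _ _ reg _ mlmo _ _ _ _ _ (fun i j w => z i j w) (fun=> st)) => //.
  by split=> [k _|]; exact: mxmeas_cst.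
have msoft := measurable_soft_norm2 alpha (mxmeas_grad_error reg mnext).
have mtrack := measurable_tracking reg mnext.
set gp := gap K f Fstar (est st 0%N).
have gp0 : 0 <= gp by exact: (gap_ge0 minX).
have psi0 : 0 <= psi by exact: soft_norm2_ge0.
set c := (1 - alpha / 2) * gp +
  alpha / 2 * L * (psi + CF * (K%:R * alpha + s / alpha)) + CF * (alpha / 2 * L) ^+ 2.
have c0 : 0 <= c.
  apply: le_trans (frozen_gap point); first exact: (gap_ge0 minX (frozen_in _)).
have pot0 w : 0 <= potential L f Fstar alpha (next w).
  by apply: potential_ge0; [exact: ltW|exact: frozen_in].
have pot_le w : potential L f Fstar alpha (next w) <=
    C1 * soft_norm2 alpha (grad (next w) - true_gradient f (est (next w)) K) +
    C1 / alpha * tracking f K (est (next w)) + c.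
  have hg := frozen_gap w; rewrite -/gp -/c in hg.
  rewrite /potential -/C1; move: (gap _ _ _ _) (soft_norm2 _ _) (tracking _ _ _) hg.
  move=> g p t gc; rewrite [C1 * (_ / _)]mulrA [C1 * t / _]mulrAC.
  by rewrite -addrA [leLHS]addrC lerD2l.
have C1a : 0 <= C1 / alpha by rewrite divr_ge0// ltW.
have soft0 w : 0 <= soft_norm2 alpha (grad (next w) - true_gradient f (est (next w)) K).
  exact: soft_norm2_ge0.
have track0 w : 0 <= tracking f K (est (next w)) by exact: tracking_ge0.
have := exle_lin2 pot0 C10 C1a c0 pot_le msoft mtrack soft0 track0
  frozen_gradient frozen_tracking.
apply: exleW.
rewrite /potential -/gp -/psi -/s -/C1 /c.
set sa := s / alpha.
have sE : s = alpha * sa by rewrite /sa mulrC divfK// gt_eqF.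
have sa0 : 0 <= sa by rewrite divr_ge0// ltW.
have -> : C1 / alpha * ((1 - alpha) ^+ 2 * s + alpha ^+ 3 * (1 + s)) =
    C1 * (((1 - alpha) ^+ 2 + alpha ^+ 3) * sa + alpha ^+ 2).
  by rewrite sE; field; rewrite gt_eqF.
rewrite sE.
have C1E : C1 = L + L * CF by rewrite /C1 /pot_const mulrDr mulr1.
have LCF : 0 <= L * CF by rewrite mulr_ge0.
have -> : step_const K L = L * CF * K%:R + CF * L ^+ 2 + 3 * C1 by [].
have k0 : 0 <= K%:R :> R by [].
have CFL : 0 <= CF * L ^+ 2 by rewrite mulr_ge0// sqr_ge0.
have l0 : 0 <= L := L0.
rewrite -subr_ge0.
set lhs := (X in 0 <= X).
have -> : lhs = alpha / 2 * (L * CF) * psi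
   + C1 * sa * (1 - alpha / 2 - (1 - alpha) ^+ 2 - 2 * alpha ^+ 3) - alpha / 2 * (L * CF) * sa
   + alpha ^+ 2 * (L * CF * K%:R / 2 + CF * L ^+ 2 * (3 / 4)).
  by rewrite /lhs C1E; field.
have h1 : 0 <= alpha / 2 * (L * CF) * psi.
  by apply: mulr_ge0 => //; apply: mulr_ge0 => //; apply: divr_ge0 => //; exact: ltW.
have h2 : 0 <= alpha ^+ 2 * (L * CF * K%:R / 2 + CF * L ^+ 2 * (3 / 4)).
  rewrite mulr_ge0 ?sqr_ge0// addr_ge0// mulr_ge0 ?invr_ge0//.
  by rewrite mulr_ge0.
(* The two cubes are the parts of the gradient and tracking noise proportional to S. The difference
   of the sides has the factor 1 - 2 alpha, whose sign is [alpha_le]. *)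
have h3 : alpha / 2 <= 1 - alpha / 2 - (1 - alpha) ^+ 2 - 2 * alpha ^+ 3.
  rewrite -subr_ge0 (_ : _ - _ = alpha * (1 - 2 * alpha) * (1 + alpha)); last by field.
  by rewrite mulr_ge0 ?mulr_ge0//; lra.
have h4 : C1 * sa * (alpha / 2) <= C1 * sa * (1 - alpha / 2 - (1 - alpha) ^+ 2 - 2 * alpha ^+ 3).
  by rewrite ler_wpM2l// mulr_ge0.
have h5 : alpha / 2 * (L * CF) * sa <= C1 * sa * (alpha / 2).
  have : 0 <= L * (sa * (alpha / 2)) by apply: mulr_ge0 => //; apply: mulr_ge0 => //; lra.
  rewrite C1E; lra.
lra.
Qed.

End step.

End one_step.

(** * The potential after the initialisation *)

Section initial_state.
Context (R : realType) (K : nat) (L : R) (d : nat -> nat)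
  (f : forall i, 'rV[R]_(d i).+1 -> 'rV[R]_(d i.+1).+1)
  (dX : measure_display) (Xi : measurableType dX) (Q : nat -> probability Xi R)
  (fo : forall i, 'rV[R]_(d i).+1 -> Xi -> 'rV[R]_(d i.+1).+1)
  (Jo : forall i, 'rV[R]_(d i).+1 -> Xi -> 'M[R]_((d i).+1, (d i.+1).+1)).
Hypothesis reg : regular_problem K L f Q fo Jo.
Context (dO : measure_display) (Omega : measurableType dO)
  (P : probability Omega R) (z : nat -> nat -> {RV P >-> Xi}) (B : nat).
Hypothesis famz : indep_family P (sigma_sample z).
Hypothesis zQ : forall i j, (i < K)%N -> sampled_from (z i j) (Q i).
Hypothesis B_gt0 : (0 < B)%N.

Let L1 : 1 <= L := const_ge1 reg.
Let L0 : 0 <= L. Proof. exact: le_trans L1. Qed.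

Context (X : set 'rV[R]_(d 0%N).+1) (Fstar : R) (x0 : 'rV[R]_(d 0%N).+1).
Hypothesis minX : is_min_on X (objective f K) Fstar.
Hypothesis Xx0 : X x0.
Hypothesis gap_x0 : gap K f Fstar x0 <= L.

Let initial k w := init_est fo B x0 (fun i j => z i j w) k.
Let start w := init_state K fo Jo B x0 (fun i j => z i j w).

Let adapted_init : adapted K z initial.
Proof.
move=> k; elim: k => [_|k IH kK]; first exact: mxmeas_cst.
have [mf _] := levels_measurable reg kK.
apply: (@mxmeas_batch_mean _ _ _ _ _ B (fun j (w : history z k.+1) =>
  fo (initial k w) (z k j w))) => j _.
apply: mxmeas_oracle => //; last exact: measurable_sample_history.
by apply: mxmeas_historyS; apply: IH; exact: ltnW.
Qed.

Let exle_init_level k : (k < K)%N ->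
  exle P (fun w => norm2 (initial k.+1 w - f (initial k w)) ^+ 2) (L ^+ 2).
Proof.
move=> kK.
have [lf _ _] := levels_smooth reg kK.
have [mf _] := levels_measurable reg kK.
have [uf _] := levels_unbiased reg kK.
rewrite (_ : (fun w => _) = fun w => norm2 (0 + batch_mean B (fun j =>
    noise (@fo k) (@f k) (initial k w) (z k j w))) ^+ 2); last first.
  by apply/funext => w; rewrite add0r batch_meanB batch_mean_cst.
apply: le_trans (@level_sqr _ _ _ _ _ _ _ _ _ _ famz zQ k kK _ _ (fun=> 0)
   (fun j w => noise (@fo k) (@f k) (initial k w)) (fun _ _ => L ^+ 2) _ _ _ _) _.
- exact: mxmeas_cst.
- have mu : mxmeas (fun v : (history z k * Xi)%type => initial k v.1).
    by apply: (mxmeas_comp (adapted_init (ltnW kK))); exact: measurable_fst.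
  move=> j _; apply: mxmeasB; last exact: (mxmeas_lipschitz lf mu).
  by apply: (mxmeas_oracle mf mu); exact: measurable_snd.
- by move=> w j _; exact: (noise_mean0 mf uf).
- by move=> w j _; exact: (exle_noise uf).
apply: exle_cst => w; rewrite norm2_0 expr0n add0r mean_cst//.
  by rewrite mulr_ge0 ?invr_ge0// sqr_ge0.
by rewrite ler_piMl ?sqr_ge0// invf_le1 ?ltr0n// ler1n.
Qed.

Definition init_const : R :=
  L + pot_const K L * (1 + K%:R * (4 * L ^+ 2) ^+ K + K%:R * L ^+ 2).

Lemma exle_init_potential : exle P (fun w => potential L f Fstar 1 (start w)) init_const.
Proof.
have C10 : 0 <= pot_const K L by exact: (pot_const_ge0 reg).
have mst : @mstate R K d _ Omega start.
  exact: (mstate_init reg B x0 (z := fun i j w => z i j w)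
    (fun i j _ => measurable_funPT (z i j))).
have track : exle P (fun w => tracking f K (est (start w))) (K%:R * L ^+ 2).
  have -> : K%:R * L ^+ 2 = \sum_(k < K) L ^+ 2 by rewrite sumr_const card_ord mulr_natl.
  apply: (@exle_sum _ _ _ _ K (fun k w => norm2 (initial k.+1 w - f (initial k w)) ^+ 2)
    (fun=> L ^+ 2)).
  - move=> k kK; apply: measurable_funX; apply: measurable_norm2.
    have mi i : (i <= K)%N -> mxmeas (initial i) by exact: (mst.1 i).
    have [lf _ _] := levels_smooth reg kK.
    by apply: mxmeasB; [exact: mi|apply: (mxmeas_lipschitz lf); exact/mi/ltnW].
  - by move=> *; exact: sqr_ge0.
  - exact: exle_init_level.
have gerr : exle P (fun w => norm2 (grad (start w) - true_gradient f (est (start w)) K) ^+ 2)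
    (K%:R * (4 * L ^+ 2) ^+ K).
  apply: exleW (exle_jac_error reg famz zQ B_gt0 (leqnn K) adapted_init).
  rewrite ler_piMr ?invf_le1 ?ltr0n ?ler1n// mulr_ge0// exprn_ge0// mulr_ge0//.
  exact: sqr_ge0.
set g := fun w => norm2 _ ^+ 2 in gerr; set t := fun w => tracking _ _ _ in track.
have mg : measurable_fun setT g.
  by apply: measurable_funX; apply: measurable_norm2; exact: (mxmeas_grad_error reg mst).
have mt : measurable_fun setT t by exact: (measurable_tracking reg mst).
have g0 w : 0 <= g w by exact: sqr_ge0.
have t0 w : 0 <= t w by exact: tracking_ge0.
have pot0 w : 0 <= potential L f Fstar 1 (start w).
  by apply: (potential_ge0 reg minX).
have pot_le w : potential L f Fstar 1 (start w) <=
    pot_const K L * g w + pot_const K L * t w + (L + pot_const K L).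
  rewrite /potential divr1 -/(t w) -[leRHS]addrA [X in _ <= _ + X]addrC.
  rewrite [leRHS]addrA lerD2r.
  rewrite -/(start w) (_ : pot_const K L * g w + _ = L + pot_const K L * (1 + g w)); last first.
    by ring.
  rewrite lerD// ler_wpM2l//.
  rewrite /g; set A := grad _ - _; have := sqr_soft_norm2 1 A.
  have := soft_norm2_ge0 1 A; move: (soft_norm2 1 A) (norm2 A) => s n s0.
  by rewrite expr1n => sn; have := sqr_ge0 (s - 1); have := sqr_ge0 n; nra.
have := exle_lin2 pot0 C10 C10 (addr_ge0 L0 C10) pot_le mg mt g0 t0 gerr track.
by apply: exleW; rewrite /init_const le_eqVlt; apply/orP; left; apply/eqP; ring.
Qed.

End initial_state.

(** Telescoping of q e_t = e_t - e_(t+1) + c along the recursion. *)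
Lemma sum_affine_iter (R : realFieldType) (q c e : R) n :
  q * \sum_(t < n) iter t (fun e => (1 - q) * e + c) e =
  e - iter n (fun e => (1 - q) * e + c) e + n%:R * c.
Proof.
elim: n => [|n IH]; first by rewrite big_ord0 /= subrr mulr0 mul0r addr0.
by rewrite big_ord_recr /= mulrDr IH -natr1; ring.
Qed.

(** * Stages *)

Section uniform.
Context (dO : measure_display) (Omega : measurableType dO) (R : realType)
  (P : probability Omega R) (tau : {RV P >-> nat}) (T : nat).
Hypothesis T_gt0 : (0 < T)%N.
Hypothesis tauT : uniform_index tau T.

Let event (t : nat) : set Omega := tau @^-1` [set t].

Let mevent t : measurable (event t).
Proof. by rewrite -[X in measurable X]setTI; exact: measurable_funPT. Qed.

Let range : set Omega := [set w | (0 < tau w <= T)%N].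

Let mrange : measurable range.
Proof.
have -> : range = \bigcup_(t in [set t | (0 < t <= T)%N]) event t.
  apply/seteqP; split => [w Rw|w [t /= tT tE]]; last by rewrite /range /= tE.
  by exists (tau w).
exact: bigcup_measurable.
Qed.

Let weighted (v : nat -> R) w := \sum_(t < T) v t * \1_(event t.+1) w.

Let weightedE v w : weighted v w = v (tau w).-1 * \1_range w.
Proof.
rewrite /weighted [\1_range w]indicE; case: (boolP (w \in range)) => [|] Rw.
  move: (Rw); rewrite inE /range /= => /andP[tau0 tauT'].
  have tl : ((tau w).-1 < T)%N by rewrite prednK.
  rewrite (bigD1 (Ordinal tl)) //= big1 => [|t tE].
    by rewrite addr0 indicE mem_set ?mulr1// /event /= prednK.
  rewrite indicE memNset ?mulr0// /event /= => E.
  by move/eqP: tE; apply; apply: val_inj; rewrite /= E.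
rewrite mulr0 big1// => t _; rewrite indicE memNset ?mulr0// /event /= => E.
by move: Rw; rewrite notin_setE /range /= E ltn_ord.
Qed.

Let weighted_mean v : (forall t, 0 <= v t) ->
  ex P (weighted v) = (T%:R^-1 * \sum_(t < T) v t)%:E.
Proof.
move=> v0; rewrite (@ex_sum _ _ _ P T (fun t w => v t * \1_(event t.+1) w)).
- rewrite big_distrr /= -sumEFin; apply: eq_bigr => t _; rewrite exZ//.
  have -> : ex P \1_(event t.+1) = P (event t.+1) by rewrite /ex integral_indic// setIT.
  have -> : P (event t.+1) = (T%:R^-1)%:E by apply: tauT; rewrite ltn_ord.
  by rewrite -EFinM mulrC.
- by move=> t _; apply: measurable_funM => //; exact: measurable_indic.
- by move=> t w _; rewrite mulr_ge0// indicE.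
Qed.

(** [uniform_index] prescribes the probabilities of 1, ..., T; they add up to 1, so other values are
    negligible. The predecessor turns a time counted from 1 into an index counted from 0. *)
Lemma exle_uniform (v : nat -> R) : (forall t, 0 <= v t) ->
  exle P (fun w => v (tau w).-1) (T%:R^-1 * \sum_(t < T) v t).
Proof.
move=> v0; rewrite /exle -weighted_mean// le_eqVlt; apply/orP; left; apply/eqP.
have Prange : P range = 1%E.
  have := weighted_mean (v := fun=> 1) (fun=> ler01).
  rewrite sumr_const card_ord -[1 *+ T]/(T%:R) mulVf ?pnatr_eq0 -?lt0n//.
  rewrite (_ : weighted _ = \1_range); last by apply/funext => w; rewrite weightedE mul1r.
  by rewrite /ex integral_indic// setIT.
apply: ae_eq_integral => //.
- by apply/measurable_EFinP; exact: (measurableT_comp (f := fun n => v n.-1)).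
- apply/measurable_EFinP; apply: measurable_sum => t.
  by apply: measurable_funM => //; exact: measurable_indic.
exists (~` range); split.
- exact: measurableC.
- suff : P (~` range) = 0%E by [].
  by rewrite probability_setC// Prange subee.
move=> w /=; apply: contra_not => Rw _.
by rewrite weightedE indicE mem_set// mulr1.
Qed.
End uniform.

Section stage_constants.
Context (R : realType) (K : nat) (L : R).
Hypothesis L1 : 1 <= L.
Let L0 : 0 <= L. Proof. exact: le_trans L1. Qed.

(** Let c be this constant and a the momentum of the next stage. The potential starts that stage at
    2 c (2 a), averaging leaves an eighth plus 2 [step_const] a, and c / 2 + 2 [step_const] <= c
    closes the induction; [init_const] covers stage 0. *)
Definition stage_const : R := init_const K L + 4 * step_const K L.

Let pot0 : 0 <= pot_const K L.
Proof. by rewrite mulr_ge0// addr_ge0// grad_const_ge0. Qed.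

Lemma step_const_ge0 : 0 <= step_const K L.
Proof.
have g0 := grad_const_ge0 K L1.
apply: addr_ge0; [apply: addr_ge0|]; apply: mulr_ge0 => //; last exact: sqr_ge0.
exact: mulr_ge0.
Qed.

Lemma init_const_gt0 : 0 < init_const K L.
Proof.
have L2 : 0 <= L ^+ 2 by exact: sqr_ge0.
apply: ltr_wpDr; last exact: lt_le_trans L1.
apply: mulr_ge0 => //; apply: addr_ge0; last exact: mulr_ge0.
by apply: addr_ge0 => //; apply: mulr_ge0 => //; apply: exprn_ge0; exact: mulr_ge0.
Qed.

Lemma stage_const_gt0 : 0 < stage_const.
Proof. by apply: ltr_wpDr init_const_gt0; rewrite mulr_ge0// step_const_ge0. Qed.
End stage_constants.

(** * Decay of the potential over the stages *)

Section stages.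
Context (R : realType) (K : nat) (L : R) (d : nat -> nat)
  (f : forall i, 'rV[R]_(d i).+1 -> 'rV[R]_(d i.+1).+1)
  (dX : measure_display) (Xi : measurableType dX) (Q : nat -> probability Xi R)
  (fo : forall i, 'rV[R]_(d i).+1 -> Xi -> 'rV[R]_(d i.+1).+1)
  (Jo : forall i, 'rV[R]_(d i).+1 -> Xi -> 'M[R]_((d i).+1, (d i.+1).+1)).
Hypothesis reg : regular_problem K L f Q fo Jo.
Context (X : set 'rV[R]_(d 0%N).+1) (x0 : 'rV[R]_(d 0%N).+1) (Fstar : R)
  (lmo : 'M[R]_((d 0%N).+1, (d K).+1) -> 'rV[R]_(d 0%N).+1).
Hypothesis feasX : feasible_set L X.
Hypothesis minX : is_min_on X (objective f K) Fstar.
Hypothesis convF : convex_objective f K X.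
Hypothesis lmoX : linear_minimizer X lmo.
Hypothesis mlmo : measurable_fun [set: borel_mx R (d 0%N).+1 (d K).+1]
  (lmo : _ -> borel_mx R 1 (d 0%N).+1).
Hypothesis Xx0 : X x0.
Hypothesis gap_x0 : gap K f Fstar x0 <= L.
Context (dO : measure_display) (Omega : measurableType dO)
  (P : probability Omega R) (B0 : nat)
  (xi0 : nat -> nat -> {RV P >-> Xi})
  (xi : nat -> nat -> nat -> nat -> {RV P >-> Xi})
  (tau : nat -> {RV P >-> nat}).
Context (b : nat).
Hypothesis track_le : track_const K L <= b%:R.
Hypothesis noise_le : grad_noise_const K L <= b%:R.
Hypothesis b_gt0 : (0 < b)%N.
Hypothesis B0_gt0 : (0 < B0)%N.

(** Batch size times momentum is [b] in every stage, as [frozen_potential] requires. *)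
Definition stage_batch s := (b * 2 ^ s)%N.
(** At contraction rate q = alpha / 2 these N = 16 / alpha steps give N q = 8, the divisor in
    [stage_mean]. *)
Definition stage_length s := (16 * 2 ^ s)%N.
Definition stage_momentum s : R := (2 ^+ s)^-1.
Definition stage_rate s : R := stage_momentum s / 2.

Hypothesis xi0Q : forall i j, (i < K)%N -> sampled_from (xi0 i j) (Q i).
Hypothesis xiQ : forall s t i j, (i < K)%N -> sampled_from (xi s t i j) (Q i).
Hypothesis tauT : forall s, (1 <= s)%N -> uniform_index (tau s) (stage_length s).
Hypothesis indep : independent_draws xi0 xi tau.

Definition key := (nat * nat + nat * nat * nat * nat + nat)%type.
Definition draws (k : key) :=
  match k with
  | inl (inl (i, j)) => sigma_of (xi0 i j)
  | inl (inr (s, t, i, j)) => sigma_of (xi s t i j)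
  | inr s => sigma_of (tau s)
  end.

Lemma sigma_of_measurable d' (S : measurableType d') (Y : {mfun Omega >-> S}) :
  [/\ sigma_of Y `<=` measurable, sigma_of Y setT & setI_closed (sigma_of Y)].
Proof.
split.
- by move=> _ [B mB <-]; exact: measurable_funPT.
- by exists setT => //; rewrite preimage_setT setTI.
move=> _ _ [B mB <-] [C mC <-]; exists (B `&` C); first exact: measurableI.
by rewrite !setTI preimage_setI.
Qed.

Lemma draws_family : indep_family P draws.
Proof.
have h k : [/\ draws k `<=` measurable, draws k setT & setI_closed (draws k)].
  by case: k => [[[i j]|[[[s t] i] j]]|s]; exact: sigma_of_measurable.
by split=> [k|k|k|]; [have [] := h k|have [] := h k|have [] := h k|].
Qed.

Lemma measurable_draw d' (S : measurableType d') (Y : Omega -> S) k (A : set key) :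
  draws k = sigma_of Y -> A k -> measurable_fun [set: joinT draws A] Y.
Proof.
move=> kY Ak _ B mB; rewrite setTI; apply: sub_sigma_algebra.
by apply: (@join_pi_sub _ _ _ _ k) => //; rewrite kY; exists B => //; rewrite setTI.
Qed.

Definition stage s w := stagewise_pmvr fo Jo lmo stage_batch stage_rate
  stage_momentum (fun s t i j => xi s t i j w) (fun s => tau s w)
  (init_state K fo Jo B0 x0 (fun i j => xi0 i j w)) s.
Definition trajectory s n w := pmvr fo Jo lmo (stage_batch s.+1)
  (stage_rate s.+1) (stage_momentum s.+1) (fun t i j => xi s.+1 t i j w)
  (stage s w) n.

(** Three sets of draws that determine states. [trajectory_keys] stops at time n + 1 of stage s + 1,
    so the draws of the next time are fresh; [run_keys] takes that whole stage without its output
    index, so the index is fresh. *)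
Definition stage_keys s : set key := [set k | match k with
  | inl (inl _) => true
  | inl (inr (r, _, _, _)) => (r <= s)%N
  | inr r => (r <= s)%N
  end].
Definition trajectory_keys s n : set key := [set k | match k with
  | inl (inl _) => true
  | inl (inr (r, t, _, _)) => (r <= s)%N || ((r == s.+1) && (t <= n.+1)%N)
  | inr r => (r <= s)%N
  end].
Definition run_keys s : set key := [set k | match k with
  | inl (inl _) => true
  | inl (inr (r, _, _, _)) => (r <= s.+1)%N
  | inr r => (r <= s)%N
  end].

Lemma mstate_sub (A A' : set key) (st : Omega -> state R d K) : A `<=` A' ->
  @mstate R K d _ (joinT draws A) st -> @mstate R K d _ (joinT draws A') st.
Proof.
move=> AA' [mu mg]; split=> [k kK|] i j.
  exact: (measurable_joinT_sub AA' (mu k kK i j)).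
exact: (measurable_joinT_sub AA' (mg i j)).
Qed.

Lemma mstate_stage s : @mstate R K d _ (joinT draws (stage_keys s)) (stage s).
Proof.
elim: s => [|s IH].
  apply: (mstate_init reg B0 x0 (T := joinT draws (stage_keys 0))
    (z := fun i j w => xi0 i j w)) => i j _.
  exact: (@measurable_draw _ _ _ (inl (inl (i, j)))).
pose A := stage_keys s.+1.
have mstart : @mstate R K d _ (joinT draws A) (stage s).
  apply: mstate_sub IH => -[[[i j]|[[[r t] i] j]]|r] //= rs; exact: leqW.
apply: (@mstate_random_index R K d _ (joinT draws A) (trajectory s)
  (fun w => (tau s.+1 w).-1)) => [n|].
  apply: (mstate_pmvr reg mlmo _ _ _ (T := joinT draws A)
    (z := fun t i j w => xi s.+1 t i j w)) => // t i j _ _.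
  by apply: (@measurable_draw _ _ _ (inl (inr (s.+1, t, i, j)))) => //=; exact: leqnn.
apply: (measurableT_comp (f := fun n => n.-1)) => //.
by apply: (@measurable_draw _ _ _ (inr s.+1)) => //=; exact: leqnn.
Qed.

Lemma mstate_trajectory s n :
  @mstate R K d _ (joinT draws (trajectory_keys s n)) (trajectory s n).
Proof.
apply: (mstate_pmvr reg mlmo _ _ _ (T := joinT draws (trajectory_keys s n))
    (z := fun t i j w => xi s.+1 t i j w)) => [t i j tn _|].
  by apply: (@measurable_draw _ _ _ (inl (inr (s.+1, t, i, j)))) => //=; rewrite eqxx tn orbT.
apply: mstate_sub (mstate_stage s) => -[[[i j]|[[[r t] i] j]]|r] //= rs.
by rewrite rs.
Qed.

Lemma mstate_run s n :
  @mstate R K d _ (joinT draws (run_keys s)) (trajectory s n).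
Proof.
apply: mstate_sub (@mstate_trajectory s n) => -[[[i j]|[[[r t] i] j]]|r] //=.
by case/orP => [/leqW//|/andP[/eqP -> _]].
Qed.

Lemma mstate_Omega (A : set key) (st : Omega -> state R d K) :
  @mstate R K d _ (joinT draws A) st -> mstate st.
Proof.
have [Gm _ _ _] := draws_family.
move=> [mu mg]; split=> [k kK|] i j.
  exact: (measurable_from_joinT Gm (mu k kK i j)).
exact: (measurable_from_joinT Gm (mg i j)).
Qed.

Lemma momentum_gt0 s : 0 < stage_momentum s.
Proof. by rewrite invr_gt0 exprn_gt0. Qed.

Lemma momentumS s : stage_momentum s = 2 * stage_momentum s.+1.
Proof. by rewrite /stage_momentum exprS invfM mulrA divff ?mul1r. Qed.

Lemma momentum_le1 s : stage_momentum s <= 1.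
Proof. by rewrite invf_le1 ?exprn_gt0// exprn_ege1// ler1n. Qed.

Lemma momentum_half s : stage_momentum s.+1 <= 1 / 2.
Proof. by have := momentum_le1 s; rewrite momentumS; lra. Qed.

Lemma rate01 s : 0 <= stage_rate s <= 1.
Proof.
have := momentum_gt0 s; have := momentum_le1 s; rewrite /stage_rate => h1 h2.
by apply/andP; split; lra.
Qed.

Lemma step_in s (z : nat -> nat -> Xi) (st : state R d K) : X (est st 0%N) ->
  X (est (pmvr_step fo Jo lmo (stage_batch s) (stage_rate s)
            (stage_momentum s) z st) 0%N).
Proof. by move=> Xst; exact: (conditional_gradient_in feasX lmoX _ (rate01 s)). Qed.

Lemma stage_in s w : X (est (stage s w) 0%N).
Proof.
elim: s => [//|s IH].
rewrite -[stage s.+1 w]/(trajectory s (tau s.+1 w).-1 w).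
by elim: (tau s.+1 w).-1 => [//|n IHn]; exact: step_in.
Qed.

Lemma trajectory_in s n w : X (est (trajectory s n w) 0%N).
Proof. by elim: n => [|n IHn]; [exact: stage_in|exact: step_in]. Qed.

Let pot s := @potential R K L d f Fstar (stage_momentum s).

Let pot_ge0 s (st : state R d K) : X (est st 0%N) -> 0 <= pot s st.
Proof. by move=> Xst; apply: (potential_ge0 reg minX) => //; exact/ltW/momentum_gt0. Qed.

Let q s := stage_momentum s / 2.
Let c2 s := step_const K L * stage_momentum s ^+ 2.

Let step_const_nonneg : 0 <= step_const K L := step_const_ge0 K (const_ge1 reg).

Lemma exle_step s n e :
  exle P (fun w => pot s.+1 (trajectory s n w)) e ->
  exle P (fun w => pot s.+1 (trajectory s n.+1 w)) ((1 - q s.+1) * e + c2 s.+1).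
Proof.
(* [trajectory s n] is the state at time n + 1, so the fresh draws are those of time n + 2. *)
move=> IH; set z := xi s.+1 n.+2.
pose step w w' := pmvr_step fo Jo lmo (stage_batch s.+1) (stage_rate s.+1)
  (stage_momentum s.+1) (fun i j => z i j w') (trajectory s n w).
pose A := trajectory_keys s n.
pose A' : set key := [set k | match k with
  | inl (inr (r, t, _, _)) => (r == s.+1) && (t == n.+2)
  | _ => false end].
pose u (ij : nat * nat) : key := inl (inr (s.+1, n.+2, ij.1, ij.2)).
have famz : indep_family P (sigma_sample z).
  by apply: (@indep_family_inj _ _ _ _ _ _ _ u _ draws_family) => -[i j] [i' j'] [-> ->].
have zQ i j : (i < K)%N -> sampled_from (z i j) (Q i) by exact: xiQ.
have B_gt0 : (0 < stage_batch s.+1)%N by rewrite muln_gt0 b_gt0 expn_gt0.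
have batch_ge : b%:R <= (stage_batch s.+1)%:R * stage_momentum s.+1 :> R.
  by rewrite /stage_batch /stage_momentum natrM natrX mulfK// expf_neq0.
have frozen w := frozen_potential reg famz zQ B_gt0 feasX minX convF lmoX mlmo
  (momentum_gt0 s.+1) (momentum_half s) track_le noise_le batch_ge (trajectory_in s n w).
have q1 : 0 <= 1 - q s.+1.
  by have /andP[_] := rate01 s.+1; rewrite /stage_rate -/(q s.+1); lra.
apply: (le_trans (@tower _ _ _ _ _ _ draws_family A A' (fun w w' => pot s.+1 (step w w'))
  (fun w => (1 - q s.+1) * pot s.+1 (trajectory s n w) + c2 s.+1) _ _ _ _)).
- apply/seteqP; split => // k []; case: k => [[[i j]|[[[r t] i] j]]|r] //=.
  move=> /orP[rs|/andP[_ tn]] /andP[/eqP rE /eqP tE].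
    by rewrite rE ltnn in rs.
  by rewrite tE ltnn in tn.
- apply: (measurable_potential reg).
  apply: (mstate_step reg mlmo _ _ _ (T := (joinT draws A * joinT draws A')%type)
    (z := fun i j v => z i j v.2) (st := fun v => trajectory s n v.1)).
    move=> i j _; apply: (measurableT_comp (f := (z i j : joinT draws A' -> _))) => //.
    by apply: (@measurable_draw _ _ _ (inl (inr (s.+1, n.+2, i, j)))) => //=; rewrite !eqxx.
  have [mu mg] := @mstate_trajectory s n; split=> [k kK|].
    by apply: (mxmeas_comp (mu k kK)); exact: measurable_fst.
  by apply: (mxmeas_comp mg); exact: measurable_fst.
- by move=> w w'; apply: pot_ge0; apply: step_in; exact: trajectory_in.
- exact: frozen.
have pot0 w : 0 <= pot s.+1 (trajectory s n w) by apply: pot_ge0; exact: trajectory_in.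
have c0 : 0 <= c2 s.+1 by rewrite mulr_ge0// sqr_ge0.
apply: (@exle_lin1 _ _ _ _ _ (fun w => pot s.+1 (trajectory s n w))) => //.
- by move=> w; rewrite addr_ge0// mulr_ge0.
- exact: (measurable_potential reg _ _ (mstate_Omega (@mstate_trajectory s n))).
Qed.

Lemma potentialS s (st : state R d K) : X (est st 0%N) ->
  pot s.+1 st <= 2 * pot s st.
Proof.
move=> Xst; rewrite /pot /potential (momentumS s).
have a0 := momentum_gt0 s.+1; set a := stage_momentum s.+1 in a0 *.
set e := grad st - _; set t := tracking _ _ _.
have p0 := pot_const_ge0 reg.
have g0 : 0 <= gap K f Fstar (est st 0%N) := gap_ge0 minX Xst.
have tE : t / a = 2 * (t / (2 * a)) by field; rewrite gt_eqF.
have se : soft_norm2 a e <= soft_norm2 (2 * a) e.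
  by rewrite ler_wsqrtr// lerD2r ler_sqr ?nnegrE; lra.
have se0 := soft_norm2_ge0 a e.
have : pot_const K L * soft_norm2 a e <= 2 * (pot_const K L * soft_norm2 (2 * a) e).
  by rewrite mulrCA ler_wpM2l//; lra.
rewrite tE; lra.
Qed.

Let init_const_nonneg : 0 <= init_const K L := ltW (init_const_gt0 K (const_ge1 reg)).

Let stage_mean s (e : R) : 0 <= e ->
  (stage_length s.+1)%:R^-1 * \sum_(t < stage_length s.+1)
    iter t (fun e => (1 - q s.+1) * e + c2 s.+1) e <=
  e / 8 + 2 * step_const K L * stage_momentum s.+1.
Proof.
move=> e0; set N := stage_length s.+1; set a := stage_momentum s.+1.
have a0 : 0 < a := momentum_gt0 s.+1.
have N0 : (0 < N)%N by rewrite muln_gt0 expn_gt0.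
have Na : N%:R = 16 / a :> R.
  by rewrite /N /stage_length natrM natrX /a /stage_momentum invrK.
have := sum_affine_iter (q s.+1) (c2 s.+1) e N.
set S := \sum_(t < N) _; set eN := iter N _ e => SE.
have eN0 : 0 <= eN.
  have q1 : 0 <= 1 - q s.+1.
    by have /andP[_] := rate01 s.+1; rewrite /stage_rate -/(q s.+1); lra.
  rewrite /eN; elim: (N) => [//|n IHn] /=.
  by apply: addr_ge0; apply: mulr_ge0 => //; exact: sqr_ge0.
have -> : N%:R^-1 * S = (q s.+1 * S) / 8.
  rewrite Na /q -/a; field; rewrite gt_eqF//.
rewrite SE Na /c2 -/a.
have -> : 16 / a * (step_const K L * a ^+ 2) = 16 * step_const K L * a.
  by field; rewrite gt_eqF.
clearbody eN; lra.
Qed.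

Lemma exle_stage s :
  exle P (fun w => pot s (stage s w)) (stage_const K L * stage_momentum s).
Proof.
have c0 := step_const_nonneg; have i0 := init_const_nonneg.
elim: s => [|s IH].
  have -> : stage_momentum 0 = 1 by rewrite /stage_momentum invr1.
  rewrite mulr1 /pot (_ : stage_momentum 0 = 1); last by rewrite /stage_momentum invr1.
  pose u (ij : nat * nat) : key := inl (inl (ij.1, ij.2)).
  have fam0 : indep_family P (sigma_sample xi0).
    apply: (@indep_family_inj _ _ _ _ _ _ _ u _ draws_family).
    by move=> [i j] [i' j'] [-> ->].
  apply: exleW (exle_init_potential reg fam0 xi0Q B0_gt0 minX Xx0 gap_x0).
  by rewrite /stage_const lerDl mulr_ge0.
have a0 : 0 < stage_momentum s.+1 := momentum_gt0 s.+1.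
pose e := 2 * (stage_const K L * stage_momentum s).
have e0 : 0 <= e.
  by rewrite !mulr_ge0// ?(ltW (momentum_gt0 s))// addr_ge0// mulr_ge0.
have start : exle P (fun w => pot s.+1 (trajectory s 0 w)) e.
  apply: (@exle_le _ _ _ _ _ (fun w => 2 * pot s (stage s w))).
  - by move=> w; apply: pot_ge0; exact: stage_in.
  - by move=> w; apply: potentialS; exact: stage_in.
  apply: exleZ => //.
  - exact: (measurable_potential reg _ _ (mstate_Omega (mstate_stage s))).
  - by move=> w; apply: pot_ge0; exact: stage_in.
have run t : exle P (fun w => pot s.+1 (trajectory s t w))
    (iter t (fun e => (1 - q s.+1) * e + c2 s.+1) e).
  by elim: t => [//|t IHt]; exact: exle_step.
(* The output index is independent of all draws of its stage; averaging over it with the trajectory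
   frozen gives the mean of the potentials over the stage. *)
pose A := run_keys s; pose A' : set key := [set inr s.+1].
have N0 : (0 < stage_length s.+1)%N by rewrite muln_gt0 expn_gt0.
set N := stage_length s.+1 in N0 *.
have pot0 t w : 0 <= pot s.+1 (trajectory s t w) by apply: pot_ge0; exact: trajectory_in.
have mpot t : measurable_fun setT (fun w => pot s.+1 (trajectory s t w)).
  exact: (measurable_potential reg _ _ (mstate_Omega (@mstate_trajectory s t))).
apply: (le_trans (@tower _ _ _ _ _ _ draws_family A A'
  (fun w w' => pot s.+1 (trajectory s (tau s.+1 w').-1 w))
  (fun w => N%:R^-1 * \sum_(t < N) pot s.+1 (trajectory s t w)) _ _ _ _)).
- by apply/seteqP; split => // k []; case: k => [[[i j]|[[[r t] i] j]]|r] //= + [rE]; rewrite rE ltnn.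
- apply: (measurable_random_index (T := (joinT draws A * joinT draws A')%type)
    (F := fun n v => pot s.+1 (trajectory s n v.1)) (t := fun v => (tau s.+1 v.2).-1)).
    move=> n; apply: (measurableT_comp (f := (fun w : joinT draws A =>
      pot s.+1 (trajectory s n w)))); last exact: measurable_fst.
    exact: (measurable_potential reg _ _ (@mstate_run s n)).
  apply: (measurableT_comp (f := fun n => n.-1)) => //.
  apply: (measurableT_comp (f := (tau s.+1 : joinT draws A' -> _))); last exact: measurable_snd.
  exact: (@measurable_draw _ _ _ (inr s.+1)).
- by [].
- by move=> w; apply: (exle_uniform N0 (tauT _) (v := fun t => pot s.+1 (trajectory s t w))).
apply: (@exleW _ _ _ _ _ (N%:R^-1 * \sum_(t < N) iter t (fun e => (1 - q s.+1) * e + c2 s.+1) e)).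
  have := @stage_mean s e e0; rewrite -/N => /le_trans; apply; rewrite /e (momentumS s) /stage_const.
  have : 0 <= init_const K L * stage_momentum s.+1 by rewrite mulr_ge0// ltW.
  lra.
apply: exleZ; rewrite ?invr_ge0//.
- exact: measurable_sum.
- by move=> w; rewrite sumr_ge0.
by apply: (@exle_sum _ _ _ _ N (fun t w => pot s.+1 (trajectory s t w))
  (fun t => iter t (fun e => (1 - q s.+1) * e + c2 s.+1) e)).
Qed.

(** The gap is a term of the potential. Being nonnegative with a bounded mean it is integrable,
    which allows [Fstar] to be split off from the expectation. *)
Lemma stage_gap s :
  ('E_P[fun w => objective f K (est (stage s w) 0%N)] - Fstar%:E
     <= (stage_const K L * stage_momentum s)%:E)%E.
Proof.
pose gp w := gap K f Fstar (est (stage s w) 0%N).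
have mst := mstate_Omega (mstate_stage s).
have gp0 w : 0 <= gp w by apply: (gap_ge0 minX); exact: stage_in.
have gp_le : exle P gp (stage_const K L * stage_momentum s).
  apply: exle_le gp0 _ (exle_stage s) => w.
  rewrite /pot /potential -addrA lerDl addr_ge0// mulr_ge0//.
  - exact: (pot_const_ge0 reg).
  - exact: soft_norm2_ge0.
  - exact: (pot_const_ge0 reg).
  - by rewrite divr_ge0 ?tracking_ge0// ltW// momentum_gt0.
have mgp : measurable_fun setT gp by exact: (measurable_gap reg Fstar mst).
have igp : P.-integrable setT (EFin \o gp).
  apply/integrableP; split; first exact/measurable_EFinP.
  under eq_integral do rewrite /= ger0_norm//.
  by apply: le_lt_trans gp_le _; rewrite ltry.
rewrite expectationE /ex.
have -> : (fun w => (objective f K (est (stage s w) 0%N))%:E) =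
    fun w => ((EFin \o gp) w + Fstar%:E)%E.
  by apply/funext => w; rewrite /= -EFinD subrK.
rewrite integralD//; last exact: finite_measure_integrable_cst.
rewrite -[X in (_ + X - _)%E]/(ex P (fun=> Fstar)) ex_cst addeK//.
Qed.
End stages.

(** * Parameters and complexity *)

Lemma lipschitz2W (R : realType) (m n p q : nat) (L L' : R)
    (g : 'M[R]_(m, n) -> 'M[R]_(p, q)) :
  L <= L' -> lipschitz2 L g -> lipschitz2 L' g.
Proof. by move=> LL' gL x y; rewrite (le_trans (gL x y))// ler_wpM2r// norm2_ge0. Qed.

Lemma sqr_norm_le (R : realDomainType) (x y : R) : `|x| <= y -> x ^+ 2 <= y ^+ 2.
Proof.
move=> xy; rewrite -real_normK ?num_real// ler_sqr ?nnegrE//.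
exact: le_trans xy.
Qed.

Lemma unbiasedW (R : realType) (dX : measure_display) (Xi : measurableType dX)
    (Q : probability Xi R) (m n p q : nat) (s s' : R)
    (g : 'M[R]_(m, n) -> Xi -> 'M[R]_(p, q)) h :
  `|s| <= s' -> unbiased Q s g h -> unbiased Q s' g h.
Proof.
move=> ss' ug x; have [gh gs] := ug x; split=> //; apply: le_trans gs _.
by rewrite lee_fin sqr_norm_le.
Qed.

Lemma mean_square_lipschitzW (R : realType) (dX : measure_display)
    (Xi : measurableType dX) (Q : probability Xi R) (m n p q : nat) (L L' : R)
    (g : 'M[R]_(m, n) -> Xi -> 'M[R]_(p, q)) :
  `|L| <= L' -> mean_square_lipschitz Q L g -> mean_square_lipschitz Q L' g.
Proof.
move=> LL' gL x y; apply: le_trans (gL x y) _.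
by rewrite lee_fin ler_wpM2r ?sqr_ge0// sqr_norm_le.
Qed.

Section stage_count.
Context (R : realType) (c : R).
Hypothesis c_gt0 : 0 < c.

(** With n one more than the truncation of c / eps, 2 to this power exceeds n and is at most 2 n:
    above c / eps for the accuracy, of the same order for the complexity. *)
Definition stage_count (eps : R) := (trunc_log 2 (Num.truncn (c / eps)).+1).+1.

Lemma stage_countP eps : 0 < eps -> c * stage_momentum R (stage_count eps) <= eps.
Proof.
move=> e0; have ce : 0 <= c / eps by rewrite divr_ge0// ltW.
rewrite /stage_momentum ler_pdivrMr ?exprn_gt0// mulrC -ler_pdivrMr//.
have /andP[_ /ltW/le_trans] := truncn_itv ce; apply.
by rewrite -natrX ler_nat ltnW// trunc_log_ltn.
Qed.

Lemma exp_stage_count_le eps : 0 < eps <= 1 ->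
  2 ^+ (stage_count eps) <= 2 * (c + 1) / eps.
Proof.
move=> /andP[e0 e1]; have ce : 0 <= c / eps by rewrite divr_ge0// ltW.
have /andP[h _] := truncn_itv ce.
have h2 : 2 ^+ (trunc_log 2 (Num.truncn (c / eps)).+1) <= (Num.truncn (c / eps)).+1%:R :> R.
  by rewrite -natrX ler_nat trunc_logP.
rewrite /stage_count exprS -mulrA ler_wpM2l// (le_trans h2)// -natr1 mulrDl.
by rewrite lerD// mul1r invf_ge1.
Qed.

Lemma stage_count_bigO eps1 : 0 < eps1 ->
  (fun eps : R => (stage_count eps)%:R : R^o) =O_ (0^'+)
  (fun eps : R => ln (eps1 / eps) : R^o).
Proof.
move=> e10; set M := ln (2 * (c + 1) / eps1).
have l2 : 0 < ln (2 : R) by rewrite ln_gt0// ltr1n.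
apply/eqO_exP; exists ((`|M| + 1) / ln 2).
  by rewrite divr_gt0// ltr_wpDl.
near=> eps.
have e0 : 0 < eps by near: eps; exact: nbhs_right_gt.
have e1 : eps <= 1 by near: eps; exact: nbhs_right_le.
(* Near 0 the logarithm is at least 1 and absorbs the additive constant [M]. *)
have t1 : 1 <= ln (eps1 / eps).
  rewrite -[leLHS]expRK ler_ln ?posrE ?expR_gt0 ?divr_gt0//.
  rewrite ler_pdivlMr// mulrC -ler_pdivlMr ?expR_gt0//.
  by near: eps; apply: nbhs_right_le; rewrite divr_gt0// expR_gt0.
suff : (stage_count eps)%:R <= (`|M| + 1) / ln 2 * ln (eps1 / eps).
  by rewrite normr_nat (ger0_norm (le_trans ler01 t1)).
rewrite mulrAC ler_pdivlMr//.
have : 2 ^+ (stage_count eps) <= (2 * (c + 1) / eps1) * (eps1 / eps).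
  rewrite mulrA divfK ?gt_eqF//; apply: exp_stage_count_le; exact/andP.
have c1 : 0 < c + 1 by rewrite addr_gt0.
rewrite -ler_ln ?posrE ?exprn_gt0 ?mulr_gt0 ?invr_gt0//.
rewrite lnXn// lnM ?posrE ?divr_gt0 ?mulr_gt0// -/M mulr_natl.
move=> /le_trans; apply.
rewrite mulrDl mul1r lerD2r (le_trans (ler_norm _))//.
by rewrite ler_peMr.
Unshelve. all: by end_near. Qed.

(** A geometric sum: the last stage dominates the total cost. *)
Lemma sum_stage_length S :
  ((\sum_(1 <= s < S.+1) stage_length s)%N <= 32 * 2 ^ S)%N.
Proof.
elim: S => [|S IH]; first by rewrite big_geq.
by rewrite big_nat_recr//= (leq_trans (leq_add IH (leqnn _)))// /stage_length !expnS; lia.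
Qed.

Lemma total_length_bigO :
  (fun eps : R => (\sum_(1 <= s < (stage_count eps).+1) stage_length s)%N%:R : R^o)
  =O_ (0^'+) (fun eps : R => eps^-1 : R^o).
Proof.
apply/eqO_exP; exists (64 * (c + 1)); first by rewrite mulr_gt0// addr_gt0.
near=> eps.
have e0 : 0 < eps by near: eps; exact: nbhs_right_gt.
have e1 : eps <= 1 by near: eps; exact: nbhs_right_le.
rewrite normr_nat gtr0_norm ?invr_gt0//.
have /(le_trans _)-> // : 32 * 2 ^+ (stage_count eps) <= 64 * (c + 1) / eps.
  have -> : 64 * (c + 1) / eps = 32 * (2 * (c + 1) / eps) by ring.
  by rewrite ler_wpM2l//; apply: exp_stage_count_le; exact/andP.
by rewrite -natrX -natrM ler_nat sum_stage_length.
Unshelve. all: by end_near. Qed.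

End stage_count.

Section parameters.
Context (R : realType) (eps1 : R).
Hypothesis eps1_gt0 : 0 < eps1.
Let epsS s := eps1 / 2 ^+ s.

Lemma scaled_bigO (F : filter_on nat) (k : R) (g h : nat -> R) : 0 < k ->
  (forall s, `|g s| <= k * `|h s|) -> (g : nat -> R^o) =O_F (h : nat -> R^o).
Proof. by move=> k0 gh; apply/eqO_exP; exists k => //; exact: nearW. Qed.

Lemma stage_batch_bigO b : (0 < b)%N ->
  (fun s => (stage_batch b s)%:R : R^o) =O_\oo (fun s => (epsS s)^-1 : R^o).
Proof.
move=> b0; apply: (@scaled_bigO _ (b%:R * eps1)) => [|s].
  by rewrite mulr_gt0// ltr0n.
rewrite normr_nat gtr0_norm ?invr_gt0 ?divr_gt0 ?exprn_gt0//.
rewrite /epsS invf_div -mulrA [eps1 * _]mulrCA divff ?gt_eqF// mulr1.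
by rewrite /stage_batch natrM natrX.
Qed.

Lemma stage_length_bigO :
  (fun s => (stage_length s)%:R : R^o) =O_\oo (fun s => (epsS s)^-1 : R^o).
Proof. exact: (@stage_batch_bigO 16 isT). Qed.

Lemma stage_momentum_bigO :
  (stage_momentum R : nat -> R^o) =O_\oo (fun s => epsS s : R^o).
Proof.
apply: (@scaled_bigO _ eps1^-1) => [|s]; first by rewrite invr_gt0.
have m0 := momentum_gt0 R s.
rewrite gtr0_norm// gtr0_norm ?divr_gt0 ?exprn_gt0//.
by rewrite /epsS mulrA mulVf ?gt_eqF// mul1r.
Qed.

Lemma stage_rate_bigO :
  (stage_rate R : nat -> R^o) =O_\oo (fun s => epsS s : R^o).
Proof.
apply: (@scaled_bigO _ eps1^-1) => [|s]; first by rewrite invr_gt0.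
have m0 := momentum_gt0 R s.
rewrite gtr0_norm ?divr_gt0// gtr0_norm ?divr_gt0 ?exprn_gt0//.
rewrite /epsS mulrA mulVf ?gt_eqF// mul1r.
by rewrite /stage_rate -/(stage_momentum R s) ler_piMr ?ltW//; lra.
Qed.
End parameters.

Theorem theorem6 (R : realType) (K : nat)
    (Lf LJ calLf calLJ sigma sigmaJ D DeltaF eps1 : R)
    (K_gt0 : (0 < K)%N) (eps1_gt0 : 0 < eps1) :
  exists (nstages : R -> nat) (B1 T : nat -> nat) (eta alpha : nat -> R),
    let epsS := fun s : nat => eps1 / 2 ^+ s in
    [/\ (fun eps : R => (nstages eps)%:R : R^o) =O_ (0^'+)
          (fun eps : R => ln (eps1 / eps) : R^o),
        [/\ (fun s : nat => (B1 s)%:R : R^o) =O_\oo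
              (fun s : nat => (epsS s)^-1 : R^o),
            (fun s : nat => eta s : R^o) =O_\oo (fun s : nat => epsS s : R^o),
            (fun s : nat => alpha s : R^o) =O_\oo (fun s : nat => epsS s : R^o) &
            (fun s : nat => (T s)%:R : R^o) =O_\oo
              (fun s : nat => (epsS s)^-1 : R^o)],
        (forall s : nat, (1 <= s)%N ->
          [/\ (0 < B1 s)%N, 0 < eta s <= 1, 0 < alpha s <= 1 & (0 < T s)%N]),
        (fun eps : R => (\sum_(1 <= s < (nstages eps).+1) T s)%N%:R : R^o) =O_ (0^'+)
          (fun eps : R => eps^-1 : R^o) &
        forall (d : nat -> nat)
          (f : forall i, 'rV[R]_(d i).+1 -> 'rV[R]_(d i.+1).+1)
          (X : set 'rV[R]_(d 0%N).+1) (x0 : 'rV[R]_(d 0%N).+1) (Fstar : R)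
          (dX : measure_display) (Xi : measurableType dX)
          (Q : nat -> probability Xi R)
          (fo : forall i, 'rV[R]_(d i).+1 -> Xi -> 'rV[R]_(d i.+1).+1)
          (Jo : forall i,
             'rV[R]_(d i).+1 -> Xi -> 'M[R]_((d i).+1, (d i.+1).+1))
          (lmo : 'M[R]_((d 0%N).+1, (d K).+1) -> 'rV[R]_(d 0%N).+1)
          (dO : measure_display) (Omega : measurableType dO)
          (P : probability Omega R) (B0 : nat)
          (xi0 : nat -> nat -> {RV P >-> Xi})
          (xi : nat -> nat -> nat -> nat -> {RV P >-> Xi})
          (tau : nat -> {RV P >-> nat}),
        d K = 0%N ->
        feasible_set D X ->
        smooth_levels K Lf LJ f ->
        (forall i, (i < K)%N ->
           measurable_oracle (fo i) /\ measurable_oracle (Jo i)) ->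
        (forall i, (i < K)%N ->
           unbiased (Q i) sigma (fo i) (f i) /\
           unbiased (Q i) sigmaJ (Jo i) (fun x => 'J (f i) x)) ->
        (forall i, (i < K)%N ->
           mean_square_lipschitz (Q i) calLf (fo i) /\
           mean_square_lipschitz (Q i) calLJ (Jo i)) ->
        X x0 ->
        is_min_on X (objective f K) Fstar ->
        objective f K x0 - Fstar <= DeltaF ->
        convex_objective f K X ->
        linear_minimizer X lmo ->
        measurable_fun [set: borel_mx R (d 0%N).+1 (d K).+1]
          (lmo : _ -> borel_mx R 1 (d 0%N).+1) ->
        (0 < B0)%N ->
        (forall i j, (i < K)%N -> sampled_from (xi0 i j) (Q i)) ->
        (forall s t i j, (i < K)%N -> sampled_from (xi s t i j) (Q i)) ->
        (forall s, (1 <= s)%N -> uniform_index (tau s) (T s)) ->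
        independent_draws xi0 xi tau ->
        forall eps : R, 0 < eps ->
          ('E_P[fun w =>
             objective f K
               (est (stagewise_pmvr fo Jo lmo B1 eta alpha
                  (fun s t i j => xi s t i j w) (fun s => tau s w)
                  (init_state K fo Jo B0 x0 (fun i j => xi0 i j w))
                  (nstages eps)) 0%N)]
           - Fstar%:E <= eps%:E)%E].
Proof.
(* The constants are arbitrary reals, so absolute values make [L] dominate each of them; the 1
   ensures L >= 1, whence powers of [L] increase. *)
pose L := 1 + `|Lf| + `|LJ| + `|calLf| + `|calLJ| + `|sigma| + `|sigmaJ| + `|D| + `|DeltaF|.
have n1 := normr_ge0 Lf; have n2 := normr_ge0 LJ; have n3 := normr_ge0 calLf.
have n4 := normr_ge0 calLJ; have n5 := normr_ge0 sigma; have n6 := normr_ge0 sigmaJ.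
have n7 := normr_ge0 D; have n8 := normr_ge0 DeltaF.
have L1 : 1 <= L by rewrite /L; lra.
have LfL : `|Lf| <= L by rewrite /L; lra.
have LJL : `|LJ| <= L by rewrite /L; lra.
have calLfL : `|calLf| <= L by rewrite /L; lra.
have calLJL : `|calLJ| <= L by rewrite /L; lra.
have sigmaL : `|sigma| <= L by rewrite /L; lra.
have sigmaJL : `|sigmaJ| <= L by rewrite /L; lra.
have DL : `|D| <= L by rewrite /L; lra.
have DeltaFL : `|DeltaF| <= L by rewrite /L; lra.
clearbody L; clear n1 n2 n3 n4 n5 n6 n7 n8.
have c_gt0 : 0 < stage_const K L by exact: (stage_const_gt0 K L1).
(* [b] exceeds both noise constants; with B alpha = b, either of them divided by B is at most
   alpha. *)
pose b := (Num.truncn (`|track_const K L| + `|grad_noise_const K L|)).+1.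
have b_ge : `|track_const K L| + `|grad_noise_const K L| <= b%:R.
  by rewrite ltW//; have /andP[] := truncn_itv (addr_ge0 (normr_ge0 (track_const K L))
    (normr_ge0 (grad_noise_const K L))).
have track_le : track_const K L <= b%:R.
  by rewrite (le_trans _ b_ge)// (le_trans (ler_norm _))// lerDl.
have noise_le : grad_noise_const K L <= b%:R.
  by rewrite (le_trans _ b_ge)// (le_trans (ler_norm _))// lerDr.
exists (stage_count (stage_const K L)), (stage_batch b), stage_length,
  (stage_rate R), (stage_momentum R); split.
- exact: stage_count_bigO.
- split; [exact: stage_batch_bigO|exact: stage_rate_bigO|
    exact: stage_momentum_bigO|exact: stage_length_bigO].
- move=> s _; have m0 := momentum_gt0 R s; have m1 := momentum_le1 R s.
  split; rewrite ?muln_gt0 ?expn_gt0 ?m0//.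
  by rewrite divr_gt0//=; have /andP[] := rate01 R s.
- exact: total_length_bigO.
move=> d f X x0 Fstar dX Xi Q fo Jo lmo dO Omega P B0 xi0 xi tau _ [closedX convX diamX]
  smooth moracle unb msl Xx0 minX gap0 convF lmoX mlmo B0_gt0 xi0Q xiQ tauT indep eps eps_gt0.
have reg : regular_problem K L f Q fo Jo.
  split=> // i iK.
  - by have [lf df lJ] := smooth i iK; split=> //;
      [apply: lipschitz2W lf|apply: lipschitz2W lJ]; exact: le_trans (ler_norm _) _.
  - by have [uf uJ] := unb i iK; split; [exact: unbiasedW uf|exact: unbiasedW uJ].
  - by have [sf sJ] := msl i iK; split;
      [exact: mean_square_lipschitzW sf|exact: mean_square_lipschitzW sJ].
have feasX : feasible_set L X.
  by split=> // x y Xx Xy; rewrite (le_trans (diamX _ _ Xx Xy))// (le_trans (ler_norm _)).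
have gap_x0 : gap K f Fstar x0 <= L.
  by rewrite (le_trans gap0)// (le_trans (ler_norm _)).
have := stage_gap reg feasX minX convF lmoX mlmo Xx0 gap_x0 track_le
  noise_le (ltn0Sn _) B0_gt0 xi0Q xiQ tauT indep (stage_count (stage_const K L) eps).
by move=> /le_trans; apply; rewrite lee_fin stage_countP.
Qed.
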